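(* Let $1\le n<5$ and let $L\in GL(n,\mathbb{Z})$ be quasi-unipotent and have $1$ as an eigenvalue. Then there exists a minimal $C^\infty$ skew-product diffeomorphism $\varphi$ of the torus $T^n=\mathbb{R}^n/\mathbb{Z}^n$ whose linear part is $L$.
   Context: A homeomorphism is minimal if all of its orbits are dense. The linear part of a homeomorphism $\varphi$ of $T^n$ is the linear map in $GL(n,\mathbb{Z})$ induced by $\varphi$ on $H_1(T^n,\mathbb{Z})\cong\mathbb{Z}^n$; equivalently, it is the matrix $L$ such that $\varphi$ lifts to $\mathbb{R}^n$ as $x\mapsto Lx+\Phi(x)$ with $\Phi$ continuous and $\mathbb{Z}^n$-periodic. A matrix in $GL(n,\mathbb{Z})$ is quasi-unipotent if all of its eigenvalues are roots of unity. Skew-product diffeomorphism: a $C^\infty$ diffeomorphism $\varphi$ of $T^n$ such that, after conjugation by the linear automorphism of $T^n$ given by some $P\in GL(n,\mathbb{Z})$ (a change of basis of $\mathbb{Z}^n$), it is given on the covering $\mathbb{R}^n=\mathbb{R}^p\times\mathbb{R}^{n-p}$, for some $1\le p\le n$, by $$(X,Y)\mapsto (AX+\alpha,\; CX+BY+F(X)),$$ where $A\in GL(p,\mathbb{Z})$ is unipotent ($A-I$ nilpotent), $\alpha\in\mathbb{R}^p$, the affine transformation of $T^p$ induced by $X\mapsto AX+\alpha$ is minimal, $B\in GL(n-p,\mathbb{Z})$ has a power $B^m$ ($m\geq 1$) that is unipotent, $C$ is an $(n-p)\times p$ integer matrix, and $F:\mathbb{R}^p\to\mathbb{R}^{n-p}$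 is a $C^\infty$ function with $F(X+\ell)=F(X)$ for all $\ell\in\mathbb{Z}^p$. (If $p=n$ the second component is absent.) *)

(* Defs.v *)
From HB Require Import structures.
From mathcomp Require Import all_boot all_order all_algebra all_field.
From mathcomp Require Import generic_quotient.
From mathcomp Require Import all_classical all_reals all_analysis.

Set Implicit Arguments.
Unset Strict Implicit.
Unset Printing Implicit Defensive.

Import Order.TTheory GRing.Theory Num.Theory.
Import numFieldNormedType.Exports.

Local Open Scope classical_set_scope.
Local Open Scope ring_scope.
Local Open Scope quotient_scope.

Section Torus.
Variables (R : realType) (n : nat).

(* Points of R^n are column vectors, so that matrices act on the left. *)
Definition lattice_eq (x y : 'cV[R]_n) : bool :=
  x - y \is a mxOver Num.int.

Lemma lattice_eq_refl : reflexive lattice_eq.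
Proof. by move=> x; apply/mxOverP => i j; rewrite !mxE subrr. Qed.

Lemma lattice_eq_sym : symmetric lattice_eq.
Proof.
by move=> x y; apply/mxOverP/mxOverP => h i j; move: (h i j);
   rewrite !mxE -rpredN opprB.
Qed.

Lemma lattice_eq_trans : transitive lattice_eq.
Proof.
move=> y x z /mxOverP xy /mxOverP yz; apply/mxOverP => i j.
by move: (rpredD (xy i j) (yz i j)); rewrite !mxE subrKA.
Qed.

Canonical lattice_eq_equiv :=
  EquivRel lattice_eq lattice_eq_refl lattice_eq_sym lattice_eq_trans.

Definition torus := {eq_quot lattice_eq}.

HB.instance Definition _ := Topological.copy torus (quotient_topology torus).
HB.instance Definition _ := Quotient.on torus.

Definition torus_proj : 'cV[R]_n -> torus := \pi_torus.

Lemma torus_proj_eqP (x y : 'cV[R]_n) :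
  torus_proj x = torus_proj y <->
  exists l : 'cV[int]_n, x = y + map_mx intr l.
Proof.
split.
  move=> /eqquotP /mxOverP xy.
  exists (\matrix_(i, j) Num.floor ((x - y) i j)).
  apply/matrixP => i j; have := xy i j; rewrite !mxE => /floorK ->.
  by rewrite addrCA subrr addr0.
case=> l ->; apply/eqquotP; apply/mxOverP => i j.
by rewrite !mxE [X in X - _]addrC addrK intr_int.
Qed.

Definition Zn_periodic (T : Type) (f : 'cV[R]_n -> T) : Prop :=
  forall (x : 'cV[R]_n) (l : 'cV[int]_n), f (x + map_mx intr l) = f x.

Definition is_lift (f : 'cV[R]_n -> 'cV[R]_n) (phi : torus -> torus) : Prop :=
  forall x, phi (torus_proj x) = torus_proj (f x).

(* The self-map of the torus induced by f; it is independent of the choice of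
   representatives as soon as f maps lattice-equivalent points to
   lattice-equivalent points (toral_map_lift). *)
Definition toral_map (f : 'cV[R]_n -> 'cV[R]_n) : torus -> torus :=
  fun t => torus_proj (f (repr t)).

Lemma toral_map_lift (f : 'cV[R]_n -> 'cV[R]_n) :
  (forall x l, exists m : 'cV[int]_n,
     f (x + map_mx intr l) = f x + map_mx intr m) ->
  is_lift f (toral_map f).
Proof.
move=> fP x; apply/torus_proj_eqP.
have /torus_proj_eqP[l ->] : torus_proj (repr (torus_proj x)) = torus_proj x.
  by rewrite /torus_proj reprK.
exact: fP.
Qed.

Definition affine_map (A : 'M[int]_n) (a : 'cV[R]_n) (x : 'cV[R]_n) :
  'cV[R]_n := map_mx intr A *m x + a.

Lemma toral_affine_map_lift (A : 'M[int]_n) (a : 'cV[R]_n) :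
  is_lift (affine_map A a) (toral_map (affine_map A a)).
Proof.
apply: toral_map_lift => x l; exists (A *m l).
by rewrite /affine_map map_mxM mulmxDr addrAC.
Qed.

(* The full orbit, indexed by the integers, of a bijection f. *)
Definition full_orbit (T : Type) (f : T -> T) (x : T) : set T :=
  [set y | exists k : nat, iter k f x = y \/ iter k f y = x].

Definition is_homeomorphism (T : topologicalType) (f : T -> T) : Prop :=
  continuous f /\
  exists g : T -> T, [/\ cancel f g, cancel g f & continuous g].

Definition is_minimal (T : topologicalType) (f : T -> T) : Prop :=
  is_homeomorphism f /\ forall x, dense (full_orbit f x).

Definition has_linear_part (phi : torus -> torus) (L : 'M[int]_n) : Prop :=
  exists Phi : 'cV[R]_n -> 'cV[R]_n,
    [/\ continuous Phi, Zn_periodic Phi &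
        is_lift (fun x => map_mx intr L *m x + Phi x) phi].

End Torus.

Arguments torus_proj {R n}.

(* C^k through iterated partial derivatives along the standard basis. *)
Fixpoint Ck (R : realType) (m : nat) (W : normedModType R) (k : nat)
    (f : 'cV[R]_m -> W) : Prop :=
  continuous f /\
  match k with
  | 0 => True
  | k'.+1 => forall i : 'I_m,
      (forall x, derivable f x (delta_mx i 0)) /\
      Ck k' (fun x => 'D_(delta_mx i 0) f x)
  end.

Definition smooth (R : realType) (m : nat) (W : normedModType R)
    (f : 'cV[R]_m -> W) : Prop := forall k, Ck k f.

(* Since R^n is the universal cover of the torus, every continuous self-map of
   the torus has a continuous lift, and it is C^oo iff this lift is. *)
Definition torus_smooth (R : realType) (n : nat)
    (phi : torus R n -> torus R n) : Prop :=
  exists2 f : 'cV[R]_n -> 'cV[R]_n, smooth f & is_lift f phi.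

Definition smooth_diffeo (R : realType) (n : nat)
    (phi : torus R n -> torus R n) : Prop :=
  torus_smooth phi /\
  exists psi : torus R n -> torus R n,
    [/\ cancel phi psi, cancel psi phi & torus_smooth psi].

Definition quasi_unipotent (n : nat) (L : 'M[int]_n) : Prop :=
  forall z : algC, eigenvalue (map_mx intr L) z ->
    exists2 k : nat, (0 < k)%N & z ^+ k = 1.

Definition unipotent (n : nat) (A : 'M[int]_n) : Prop :=
  exists k : nat, (A - 1%:M) ^+ k = 0.

Definition skew_map (R : realType) (p q : nat) (A : 'M[int]_p)
    (a : 'cV[R]_p) (C : 'M[int]_(q, p)) (B : 'M[int]_q)
    (F : 'cV[R]_p -> 'cV[R]_q) (z : 'cV[R]_(p + q)) : 'cV[R]_(p + q) :=
  let X := usubmx z in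
  let Y := dsubmx z in
  col_mx (affine_map A a X)
         (map_mx intr C *m X + map_mx intr B *m Y + F X).

(* Transport of a self-map of R^m to R^n along m = n. *)
Definition cast_map (R : realType) (m n : nat) (e : m = n)
    (f : 'cV[R]_m -> 'cV[R]_m) (x : 'cV[R]_n) : 'cV[R]_n :=
  castmx (e, erefl) (f (castmx (esym e, erefl) x)).

(* psi is the conjugate of phi by the linear automorphism given by P, and
   q = n - p. *)
Definition skew_product_diffeo (R : realType) (n : nat)
    (phi : torus R n -> torus R n) : Prop :=
  smooth_diffeo phi /\
  exists (P : 'M[int]_n) (psi : torus R n -> torus R n)
         (p q : nat) (e : (p + q)%N = n)
         (A : 'M[int]_p) (a : 'cV[R]_p) (C : 'M[int]_(q, p)) (B : 'M[int]_q)
         (F : 'cV[R]_p -> 'cV[R]_q),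
    [/\ P \in unitmx,
        toral_map (affine_map P 0) \o phi = psi \o toral_map (affine_map P 0),
        is_lift (cast_map e (skew_map A a C B F)) psi
      & [/\ (0 < p)%N,
            A \in unitmx /\ unipotent A,
            is_minimal (toral_map (affine_map A a)),
            B \in unitmx /\ (exists2 m : nat, (0 < m)%N & unipotent (B ^+ m))
          & smooth F /\ Zn_periodic F]].

(* Main.v *)
(** Let [v] be a primitive integer row vector with [v L = v]. In coordinates
    whose first one is [v], the matrix is [1 0; C B] with [B] quasi-unipotent,
    so one may take [p = 1] and look for a minimal map
    [T (x, Y) = (x + alpha, C x + B Y + F x)] over a rotation of the circle.

    By a Weyl argument, [T] is minimal as soon as every nontrivial character has
    mean zero, uniformly in the starting point, along some finite set of times.
    van der Corput differencing lowers the order of nilpotency of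
    [k (B^m - 1)], up to characters of the base; so only the frequencies [k]
    fixed by [B^m] matter. [F] is a lacunary cosine series attached to a
    Liouville number [alpha]: along the multiples [l] of a denominator [Q] of
    [alpha], the phase of [k] evolves as [l p x + a (ss (N x + t + l eta) -
    ss (N x + t))], up to a constant and small errors, with [ss] the sine of
    period 1. If the integer [p] is nonzero, one difference gives a character of
    the base. If [p = 0], the amplitude [a] tends to infinity along a
    subsequence while [l eta] stays small, so that the phase is locally an
    arithmetic progression in [l], whose ratio is far from the integers outside
    of a small neighborhood of the critical points of the wave. *)
Require Import Defs.
From mathcomp Require Import all_boot all_order all_fingroup all_algebra all_field.
From mathcomp Require Import generic_quotient.
From mathcomp Require Import all_classical all_reals all_analysis.
From mathcomp Require Import ring lra zify.

Set Implicit Arguments.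
Unset Strict Implicit.
Unset Printing Implicit Defensive.

Import Order.TTheory GRing.Theory Num.Theory.
Import numFieldNormedType.Exports.

Local Open Scope classical_set_scope.
Local Open Scope ring_scope.

(** * Trigonometric functions of period 1 *)

Section Cosine.
Context {R : realType}.
Implicit Types x y a b c : R.

(** A Diophantine [alpha] cannot serve. For [B = -1] and [C = 0] it lets one solve
    [u (x + alpha) + u x = F x] with [u] smooth, so that [T] is conjugate to [(x + alpha, - y)],
    which preserves the circle [y = 0]. Hence the Liouville number. Smoothness of [F] and growth of
    the amplitudes are reconciled by the coefficients. The [J]-th frequency times [alpha] lies at a
    distance [step J] from a fraction of denominator [m], and its cosine gets the coefficient
    [J * step J], eventually smaller than any given negative power of the frequency. Summation along
    the orbit divides by a sine of order [step J] and leaves an amplitude of order [J]. The fraction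
    matters as well: the vectors [k B^r], [r < m], may cancel in one block of [m] steps. So the
    fractions [j / m] are all approached in turn, and Parseval on the integers modulo [m] excludes
    cancellation for one of them. *)

Definition cc x : R := cos (x * (pi *+ 2)).
Definition ss x : R := sin (x * (pi *+ 2)).

Lemma ccD x y : cc (x + y) = cc x * cc y - ss x * ss y.
Proof. by rewrite /cc mulrDl cosD. Qed.

Lemma ssD x y : ss (x + y) = ss x * cc y + cc x * ss y.
Proof. by rewrite /ss mulrDl sinD. Qed.

Lemma ccN x : cc (- x) = cc x.
Proof. by rewrite /cc mulNr cosN. Qed.

Lemma ssN x : ss (- x) = - ss x.
Proof. by rewrite /ss mulNr sinN. Qed.

Lemma ccB x y : cc (x - y) = cc x * cc y + ss x * ss y.
Proof. by rewrite ccD ccN ssN mulrN opprK. Qed.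

Lemma ssB x y : ss (x - y) = ss x * cc y - cc x * ss y.
Proof. by rewrite ssD ccN ssN mulrN. Qed.

Lemma cc0 : cc 0 = 1.
Proof. by rewrite /cc mul0r cos0. Qed.

Lemma ss0 : ss 0 = 0.
Proof. by rewrite /ss mul0r sin0. Qed.

Lemma cc2Dss2 x : cc x ^+ 2 + ss x ^+ 2 = 1.
Proof. exact: cos2Dsin2. Qed.

Lemma cc_max x : `|cc x| <= 1.
Proof. exact: cos_max. Qed.

Lemma ss_max x : `|ss x| <= 1.
Proof. exact: sin_max. Qed.

Lemma ccM x y : cc x * cc y = (cc (x + y) + cc (x - y)) / 2.
Proof. by rewrite ccB ccD; field. Qed.

Lemma ccDquarter x : cc (x + 4^-1) = - ss x.
Proof.
rewrite /cc /ss -cosDpihalf; congr (cos _).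
by rewrite mulr2n; field.
Qed.

Lemma ssDquarter x : ss (x + 4^-1) = cc x.
Proof.
rewrite /cc /ss -sinDpihalf; congr (sin _).
by rewrite mulr2n; field.
Qed.

Lemma cc_nat (n : nat) : cc n%:R = 1.
Proof.
rewrite /cc; elim: n => [|n ih]; first by rewrite mul0r cos0.
by rewrite -addn1 natrD mulrDl mul1r cosD2pi ih.
Qed.

Lemma cc_int (n : int) : cc n%:~R = 1.
Proof. by case: n => n; rewrite ?NegzE ?mulrNz ?ccN; apply: cc_nat. Qed.

Lemma ss_int (n : int) : ss n%:~R = 0.
Proof.
have := cc2Dss2 n%:~R; rewrite cc_int expr1n => h.
by apply/eqP; rewrite -sqrf_eq0; apply/eqP; lra.
Qed.

Lemma ccDint x (n : int) : cc (x + n%:~R) = cc x.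
Proof. by rewrite ccD cc_int ss_int mulr1 mulr0 subr0. Qed.

Lemma ssDint x (n : int) : ss (x + n%:~R) = ss x.
Proof. by rewrite ssD cc_int ss_int mulr1 mulr0 addr0. Qed.

(** Free of any order between [a] and [b], so that the Lipschitz and Taylor bounds below need no
    case split. *)
Lemma MVT_abs (f df : R -> R) a b :
  (forall x, is_derive x 1 f (df x)) ->
  exists2 c, `|c - a| <= `|b - a| & f b - f a = df c * (b - a).
Proof.
move=> fd.
have fc : continuous f.
  by move=> x; apply/differentiable_continuous/derivable1_diffP.
have [ab|ba] := leP a b.
  have [//|c cab ->] := @MVT_segment R f df a b ab (fun x _ => fd x).
    exact: continuous_subspaceT.
  exists c => //; have := itvP cab => h.
  by rewrite !ger0_norm ?subr_ge0 ?lerD2r ?h.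
have [//|c cab e] := @MVT_segment R f df b a (ltW ba) (fun x _ => fd x).
  exact: continuous_subspaceT.
exists c; last by rewrite -opprB e -mulrN opprB.
have := itvP cab => h.
have ca : c <= a by rewrite h.
have bc : b <= c by rewrite h.
by rewrite !ler0_norm ?subr_le0// ?opprB ?lerD2l ?lerN2// ltW.
Qed.

Lemma cos_lip x y : `|cos x - cos y| <= `|x - y|.
Proof.
have [c _ ->] := @MVT_abs (@cos R) (fun x => - sin x) y x _.
by rewrite normrM normrN ler_piMl// sin_max.
Qed.

Lemma sin_lip x y : `|sin x - sin y| <= `|x - y|.
Proof.
have [c _ ->] := @MVT_abs (@sin R) (@cos R) y x _.
by rewrite normrM ler_piMl// cos_max.
Qed.

Lemma cos_taylor x t : `|cos (x + t) - cos x + t * sin x| <= t ^+ 2.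
Proof.
have [c cx ->] := @MVT_abs (@cos R) (fun x => - sin x) x (x + t) _.
rewrite addrAC subrr add0r in cx *.
rewrite [_ * t]mulrC -mulrDr addrC normrM -(ger0_norm (sqr_ge0 t)) normrX expr2
  ler_wpM2l//.
by rewrite (le_trans (sin_lip _ _))// distrC.
Qed.

(** Crude bounds on [2 pi], from which the constants 8 and [64 = 8 ^+ 2] below come. *)
Lemma tau_bounds : 4 <= (pi : R) *+ 2 <= 8.
Proof.
have := @pi_ge2 R; have := @pihalf_lt2 R => h1 h2.
by rewrite mulr2n; apply/andP; split; lra.
Qed.

Lemma cc_lip x y : `|cc x - cc y| <= 8 * `|x - y|.
Proof.
have /andP[h1 h2] := tau_bounds.
rewrite (le_trans (cos_lip _ _))// -mulrBl normrM mulrC ler_wpM2r//.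
by rewrite ger0_norm//; lra.
Qed.

Lemma cc_taylor x t :
  `|cc (x + t) - cc x + t * (pi *+ 2) * ss x| <= 64 * t ^+ 2.
Proof.
have /andP[h1 h2] := tau_bounds.
rewrite /cc mulrDl (le_trans (cos_taylor _ _))// exprMn mulrC.
rewrite ler_wpM2r ?sqr_ge0// (_ : 64 = 8 ^+ 2); last by ring.
by rewrite lerXn2r ?nnegrE//; lra.
Qed.

Lemma ss_lip x y : `|ss x - ss y| <= 8 * `|x - y|.
Proof.
have /andP[h1 h2] := tau_bounds.
rewrite (le_trans (sin_lip _ _))// -mulrBl normrM mulrC ler_wpM2r//.
by rewrite ger0_norm//; lra.
Qed.

(** On this range the argument of the sine is at most 1/2, so its derivative is at least 1/2, and
    [4 <= pi *+ 2] makes up for both halvings. *)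
Lemma ss_half_ge0 y : 0 <= y <= 8^-1 -> y <= ss (y / 2).
Proof.
move=> /andP[y0 yl].
have /andP[t1 t2] := tau_bounds; set t := pi *+ 2 in t1 t2.
have [c cx] := @MVT_abs (@sin R) (@cos R) 0 (y / 2 * t) _.
rewrite sin0 !subr0 in cx *.
rewrite /ss -/t => ->; have yt0 : 0 <= y / 2 * t by nra.
have c1 : 1 - `|c| <= cos c.
  have := cos_lip c 0; rewrite cos0 subr0 ler_norml => /andP[]; lra.
rewrite (ger0_norm yt0) in cx.
have c3 : 1 / 2 <= cos c by nra.
nra.
Qed.

Lemma ss_half_ge y : `|y| <= 8^-1 -> `|y| <= `|ss (y / 2)|.
Proof.
move=> yl; have [y0|y0] := leP 0 y.
  rewrite ger0_norm// in yl *; rewrite (le_trans (ss_half_ge0 _))// ?y0//.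
  exact: ler_norm.
rewrite -[`|ss _|]normrN -ssN -mulNr; rewrite ltr0_norm// in yl *.
rewrite (le_trans (ss_half_ge0 _))// ?yl ?oppr_ge0 ?(ltW y0)//.
exact: ler_norm.
Qed.

End Cosine.

(** * Uniform means along orbits *)

Section Average.
Context {R : realType} {I : Type}.
Implicit Types (s : seq I) (f g : I -> R).

Definition avg s g : R := (\sum_(l <- s) g l) / (size s)%:R.

Lemma eq_avg s f g : f =1 g -> avg s f = avg s g.
Proof. by move=> fg; rewrite /avg; congr (_ / _); apply: eq_bigr. Qed.

Lemma avgD s f g : avg s (fun i => f i + g i) = avg s f + avg s g.
Proof. by rewrite /avg big_split mulrDl. Qed.

Lemma avgZ s a f : avg s (fun i => a * f i) = a * avg s f.
Proof. by rewrite /avg -mulr_sumr mulrA. Qed.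

Lemma avg_cst s a : (0 < size s)%N -> avg s (fun=> a) = a.
Proof.
move=> s0; rewrite /avg big_const_seq count_predT iter_addr addr0.
by rewrite -[a *+ _]mulr_natr mulfK// pnatr_eq0 -lt0n.
Qed.

Lemma avg_ge0 s f : (forall i, 0 <= f i) -> 0 <= avg s f.
Proof. by move=> f0; rewrite /avg divr_ge0// sumr_ge0. Qed.

Lemma avg_le s f g : (forall i, f i <= g i) -> avg s f <= avg s g.
Proof. by move=> fg; rewrite /avg ler_wpM2r ?invr_ge0// ler_sum. Qed.

Lemma avg_norm s f : `|avg s f| <= avg s (fun i => `|f i|).
Proof.
by rewrite /avg normrM [X in _ * X]ger0_norm ?invr_ge0// ler_wpM2r ?invr_ge0//
  ler_norm_sum.
Qed.

Lemma avg_sqr s f : (0 < size s)%N -> avg s f ^+ 2 <= avg s (fun i => f i ^+ 2).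
Proof.
move=> s0; set m := avg s f.
have : 0 <= avg s (fun i => (f i - m) ^+ 2) by apply: avg_ge0 => i; apply: sqr_ge0.
rewrite (@eq_avg _ _ (fun i => f i ^+ 2 + (- (2 * m) * f i + m ^+ 2))); last first.
  by move=> i; ring.
rewrite avgD avgD avgZ avg_cst// -/m => h; nra.
Qed.

End Average.

Lemma avg_map (R : realType) (I J : Type) (h : J -> I) (s : seq J) (g : I -> R) :
  avg [seq h i | i <- s] g = avg s (g \o h).
Proof. by rewrite /avg big_map size_map. Qed.

Lemma exchange_avg (R : realType) (I J : Type) (s : seq I) (t : seq J)
    (g : I -> J -> R) :
  avg s (fun i => avg t (g i)) = avg t (fun j => avg s (g^~ j)).
Proof.
rewrite /avg -!mulr_suml exchange_big/=.
by rewrite -!mulrA; congr (_ * _); rewrite mulrC.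
Qed.

Lemma avg_ccB (R : realType) (I : Type) (s : seq I) (g : I -> R) :
  avg s (fun i => avg s (fun j => cc (g i - g j))) =
  avg s (fun i => cc (g i)) ^+ 2 + avg s (fun i => ss (g i)) ^+ 2.
Proof.
rewrite !expr2 -!avgZ -avgD; apply: eq_avg => i.
rewrite mulrC [avg s (fun i => ss (g i)) * _]mulrC -!avgZ -avgD.
by apply: eq_avg => j; rewrite ccB.
Qed.

Lemma avg_cc_sqr (R : realType) (I : Type) (s : seq I) (g : I -> R) :
  avg s (fun i => cc (g i)) ^+ 2 <= avg s (fun i => avg s (fun j => cc (g i - g j))).
Proof. by rewrite avg_ccB lerDl sqr_ge0. Qed.

Section Mean.
Context {R : realType} {Z : Type} (T : Z -> Z).
Implicit Types (s : seq nat) (g : Z -> R) (mu : R).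

Definition orbit_avg s g z : R := avg s (fun l => g (iter l T z)).

(* Nonuniform weights make these means stable under arbitrary further
   averaging, so that no boundary term ever appears. *)
Definition mean g mu : Prop := forall e : R, 0 < e ->
  exists2 s, (0 < size s)%N & forall z, `|orbit_avg s g z - mu| <= e.

(** Sums are kept with multiplicity: averaging over them is averaging along [s] and along [t], in
    either order. *)
Definition conv_seq s t : seq nat := [seq (i + j)%N | i <- s, j <- t].

Lemma size_conv_seq s t : (0 < size s)%N -> (0 < size t)%N -> (0 < size (conv_seq s t))%N.
Proof. by move=> s0 t0; rewrite size_allpairs muln_gt0 s0. Qed.

Lemma orbit_avg_convl s t g z :
  orbit_avg (conv_seq s t) g z = orbit_avg t (orbit_avg s g) z.
Proof.
rewrite /orbit_avg exchange_avg /conv_seq /avg size_allpairs big_allpairs_dep/=.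
rewrite -mulr_suml natrM invfM [_^-1 * _]mulrC mulrA; congr (_ / _ / _).
by apply: eq_bigr => i _; apply: eq_bigr => j _; rewrite iterD.
Qed.

Lemma orbit_avg_convr s t g z :
  orbit_avg (conv_seq s t) g z = orbit_avg s (orbit_avg t g) z.
Proof.
rewrite orbit_avg_convl /orbit_avg exchange_avg; apply: eq_avg => i.
by apply: eq_avg => j; rewrite -!iterD addnC.
Qed.

Lemma orbit_avg_close s g mu (e : R) z : (0 < size s)%N ->
  (forall y, `|g y - mu| <= e) -> `|orbit_avg s g z - mu| <= e.
Proof.
move=> s0 h; have -> : orbit_avg s g z - mu = avg s (fun l => g (iter l T z) + - mu).
  by rewrite avgD avg_cst.
by rewrite (le_trans (avg_norm _ _))// -[leRHS](@avg_cst R _ s)// avg_le.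
Qed.

Lemma mean_ext g g' mu : g =1 g' -> mean g mu -> mean g' mu.
Proof. by move=> /funext ->. Qed.

Lemma mean_cst a : mean (fun=> a) a.
Proof.
by move=> e e0; exists [:: 0%N] => // z; rewrite /orbit_avg avg_cst// subrr normr0 ltW.
Qed.

Lemma meanD g g' mu mu' : mean g mu -> mean g' mu' ->
  mean (fun z => g z + g' z) (mu + mu').
Proof.
move=> h h' e e0; have e20 : 0 < e / 2 by rewrite divr_gt0.
have [s s0 hs] := h _ e20; have [t t0 ht] := h' _ e20.
exists (conv_seq s t) => [|z]; first exact: size_conv_seq.
rewrite {1}/orbit_avg avgD -/(orbit_avg _ g z) -/(orbit_avg _ g' z).
rewrite orbit_avg_convl orbit_avg_convr opprD addrACA (splitr e).
rewrite (le_trans (ler_normD _ _))// lerD//.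
  exact: orbit_avg_close.
exact: orbit_avg_close.
Qed.

Lemma meanZ a g mu : mean g mu -> mean (fun z => a * g z) (a * mu).
Proof.
move=> h e e0; have a0 : 0 < `|a| + 1 by rewrite ltr_wpDl.
have [s s0 hs] := h _ (divr_gt0 e0 a0).
exists s => // z; rewrite {1}/orbit_avg avgZ -/(orbit_avg _ g z) -mulrBr normrM.
apply: (le_trans (ler_wpM2l _ (hs z))) => //.
by rewrite mulrA ler_pdivrMr// mulrC ler_wpM2l ?(ltW e0)// lerDl.
Qed.

Lemma mean_sum (I : Type) (r : seq I) (G : I -> Z -> R) (mu : I -> R) :
  (forall i, mean (G i) (mu i)) ->
  mean (fun z => \sum_(i <- r) G i z) (\sum_(i <- r) mu i).
Proof.
move=> h; elim: r => [|i r ih].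
  by rewrite big_nil; apply: mean_ext (mean_cst 0) => z; rewrite big_nil.
by rewrite big_cons; apply: mean_ext (meanD (h i) ih) => z; rewrite big_cons.
Qed.

Lemma mean_avg (I : Type) (r : seq I) (G : I -> Z -> R) (mu : I -> R) :
  (forall i, mean (G i) (mu i)) ->
  mean (fun z => avg r (fun i => G i z)) (avg r mu).
Proof.
move=> h; rewrite /avg mulrC.
by apply: mean_ext (meanZ _ (mean_sum r h)) => z; rewrite mulrC.
Qed.

Lemma mean_shift k g mu : mean g mu -> mean (g \o iter k T) mu.
Proof.
move=> h e /h[s s0 hs]; exists s => // z;
  rewrite -[X in X - mu](_ : orbit_avg s g (iter k T z) = _)//.
by apply: eq_avg => l; rewrite /= -!iterD addnC.
Qed.

(** Means are uniform in the starting point, so a comparison along a single orbit is enough. *)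
Lemma mean_le g g' mu mu' z : mean g mu -> mean g' mu' ->
  (forall l, g (iter l T z) <= g' (iter l T z)) -> mu <= mu'.
Proof.
move=> h h' gg; apply/ler_addgt0Pr => e e0.
have [s s0 hs] := meanD h' (meanZ (-1) h) e0.
have := hs z; rewrite /orbit_avg ler_norml => /andP[_].
have : 0 <= avg s (fun l => g' (iter l T z) + -1 * g (iter l T z)).
  by apply: avg_ge0 => l; rewrite mulN1r subr_ge0.
lra.
Qed.

(** A second averaging, along times adapted to [Psi], replaces the pointwise bound by the mean of
    [Psi]; Jensen's inequality moves the square outside of it. *)
Lemma mean0_of_sqr g :
  (forall e, 0 < e -> exists (s : seq nat) (Psi : Z -> R) (mu : R),
    [/\ (0 < size s)%N, mean Psi mu, mu <= e &
        forall z, orbit_avg s g z ^+ 2 <= Psi z]) ->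
  mean g 0.
Proof.
move=> h e e0; have e2 : 0 < e ^+ 2 / 2 by rewrite divr_gt0// exprn_gt0.
have [s [Psi [mu [s0 Pmu mue hPsi]]]] := h _ e2.
have [t t0 ht] := Pmu _ e2.
exists (conv_seq s t) => [|z]; first exact: size_conv_seq.
rewrite subr0 orbit_avg_convl -ler_sqr ?nnegrE ?(ltW e0)// -normrX ger0_norm ?sqr_ge0//.
apply: (le_trans (avg_sqr _ t0)); apply: (le_trans (avg_le _ (fun l => hPsi _))).
have := ht z; rewrite ler_norml => /andP[_]; rewrite /orbit_avg.
lra.
Qed.

(** Allowing every phase [c] covers sine and cosine together, so real functions stand for complex
    characters. *)
Definition null (theta : Z -> R) : Prop :=
  forall c, mean (fun z => cc (theta z + c)) 0.

(** The squared average along the times [D * h] is the double average of the correlations: the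
    diagonal weighs [1 / H], and any other pair is a shifted correlation. As [D] may depend on [H]
    and [e], the times can be chosen to almost fix the base. *)
Lemma null_vdc theta :
  (forall (H : nat) (e : R), 0 < e -> exists D : nat, forall h, (0 < h < H)%N ->
    exists2 vt : Z -> R, null vt &
      forall z, cc (theta (iter (D * h) T z) - theta z) <= cc (vt z) + e) ->
  null theta.
Proof.
move=> hyp c; apply: mean0_of_sqr => e e0.
have e20 : 0 < e / 2 by rewrite divr_gt0.
pose H := (Num.truncn (2 / e)).+1.
have He : (H%:R)^-1 <= e / 2.
  by rewrite -[e / 2]invrK lef_pV2 ?posrE ?invr_gt0 ?divr_gt0// invf_div ltW// truncnS_gt.
have [D hD] := hyp H _ e20.
have /choice[vt hvt] : forall h, exists vt : Z -> R, (0 < h < H)%N -> null vt /\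
   forall z, cc (theta (iter (D * h) T z) - theta z) <= cc (vt z) + e / 2.
  move=> h; have [/hD[vt v1 v2]|hh] := boolP (0 < h < H)%N; first by exists vt.
  (* A default value outside of the range of [h]. *)
  by exists theta.
pose Psi h h' z := if h == h' then 1 else
  if (h < h')%N then cc (vt (h' - h)%N (iter (D * h) T z)) + e / 2
  else cc (vt (h - h')%N (iter (D * h') T z)) + e / 2.
pose s := enum 'I_H.
have s0 : (0 < size s)%N by rewrite size_enum_ord.
exists [seq (D * val h)%N | h <- s].
exists (fun z => avg s (fun h => avg s (fun h' => Psi (val h) (val h') z))).
exists (avg s (fun h : 'I_H => avg s (fun h' : 'I_H => if h == h' then 1 else e / 2))).
have Psi_mean (h h' : 'I_H) : mean (Psi h h') (if h == h' then 1 else e / 2).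
  have [<-|hh] := eqVneq h h'; first by apply: mean_ext (mean_cst 1) => z;
    rewrite /Psi eqxx.
  have vtm k (k' : nat) : (0 < k < H)%N ->
      mean (fun z => cc (vt k (iter (D * k') T z)) + e / 2) (e / 2).
    move=> /hvt[v _]; rewrite -[X in mean _ X]add0r; apply: meanD; last exact: mean_cst.
    apply: mean_ext (mean_shift (D * k') (v 0)) => z /=.
    by rewrite addr0.
  rewrite -val_eqE in hh; rewrite /Psi (negPf hh).
  have [lt|lt] := ltnP h h'; apply: vtm.
    by rewrite subn_gt0 lt (leq_ltn_trans (leq_subr _ _)).
  by rewrite subn_gt0 ltn_neqAle eq_sym hh lt (leq_ltn_trans (leq_subr _ _)).
split.
- by rewrite size_map.
- apply: (mean_avg s (G := fun h z => avg s (fun h' => Psi h h' z))) => h.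
  by apply: (mean_avg s (G := Psi h)).
- rewrite -[leRHS](@avg_cst R _ s)//; apply: avg_le => h.
  rewrite (@eq_avg _ _ _ _ (fun h' => (if h == h' then 1 - e / 2 else 0) + e / 2));
    last first.
    by move=> h'; case: ifP; rewrite ?add0r ?subrK.
  rewrite avgD avg_cst// -lerBrDr (_ : e - e / 2 = e / 2); last by field.
  rewrite /avg size_enum_ord.
  rewrite big_enum/= -big_mkcond/= (big_pred1 h)//.
  rewrite (le_trans _ He)// ler_pdivrMr ?ltr0n// mulVf ?pnatr_eq0//.
  by rewrite gerBl ltW.
move=> z; rewrite /orbit_avg avg_map/= (le_trans (avg_cc_sqr _ _))//.
apply: avg_le => h; apply: avg_le => h'.
rewrite opprD addrACA subrr addr0 /Psi.
have [e1|hh] := eqVneq; first by rewrite e1 subrr cc0.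
have hvt' k (k' : nat) : (0 < k < H)%N ->
    cc (theta (iter (D * (k + k')) T z) - theta (iter (D * k') T z)) <=
    cc (vt k (iter (D * k') T z)) + e / 2.
  by move=> /hvt[_ v]; rewrite mulnDr iterD; apply: v.
have [lt|lt] := ltnP h h'.
  rewrite -opprB ccN -[X in (D * X)%N](subnK (ltnW lt)); apply: hvt'.
  by rewrite subn_gt0 lt (leq_ltn_trans (leq_subr _ _)).
rewrite -[X in iter (D * X) T z](subnK lt); apply: hvt'.
by rewrite subn_gt0 ltn_neqAle eq_sym hh lt (leq_ltn_trans (leq_subr _ _)).
Qed.

End Mean.

Lemma mean_factor (R : realType) (Z Z' : Type) (T : Z -> Z) (T' : Z' -> Z')
    (p : Z -> Z') (g : Z' -> R) (mu : R) :
  (forall z, p (T z) = T' (p z)) -> mean T' g mu -> mean T (g \o p) mu.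
Proof.
move=> pT h e /h[s s0 hs]; exists s => // z.
rewrite (_ : orbit_avg T s _ z = orbit_avg T' s g (p z))//.
apply: eq_avg => l /=; congr g.
by elim: l => //= l <-.
Qed.

(** * Geometric sums of cosines, and phases that advance by a constant *)

Section Rotation.
Context {R : realType}.
Implicit Types c e t y : R.

(** The sum telescopes. It is kept multiplied by the sine, so that integer ratios [y] need no
    exception. *)
Lemma geometric_cc (H : nat) c y :
  2 * ss (y / 2) * \sum_(h <- iota 0 H) cc (c + h%:R * y) =
  ss (c + H%:R * y - y / 2) - ss (c - y / 2).
Proof.
elim: H => [|H ih]; first by rewrite big_nil mulr0 mul0r addr0 subrr.
rewrite -[H.+1]addn1 iotaD big_cat/= mulrDr ih big_seq1 add0n natrD.
have -> : c + (H%:R + 1) * y - y / 2 = (c + H%:R * y) + y / 2 by field.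
by rewrite !ssD !ssN !ccN; ring.
Qed.

Lemma avg_cc_iota (H : nat) c y :
  `|avg (iota 0 H) (fun h => cc (c + h%:R * y))| * (H%:R * `|ss (y / 2)|) <= 1.
Proof.
case: H => [|H]; first by rewrite mul0r mulr0 ler01.
have := congr1 Num.norm (geometric_cc H.+1 c y).
rewrite normrM normrM (ger0_norm (ler0n R 2)) => e.
have : `|ss (c + H.+1%:R * y - y / 2) - ss (c - y / 2)| <= 2.
  by rewrite (le_trans (ler_normB _ _))// (_ : 2 = 1 + 1)// lerD// ss_max.
rewrite -e -mulrA -[leRHS]mulr1 ler_pM2l// /avg size_iota normrM normfV normr_nat.
by move=> h; rewrite mulrA mulfVK ?pnatr_eq0// mulrC.
Qed.

Lemma int_near (t : R) : exists n : int, `|t - n%:~R| <= 2^-1.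
Proof.
exists (Num.floor (t + 2^-1)); have := floor_itv (t + 2^-1).
rewrite intrD => /andP[h1 h2]; rewrite ler_norml; apply/andP; split; lra.
Qed.

Lemma cc_near1 e : 0 < e -> exists2 d, 0 < d &
  forall t, 1 - d < cc t -> exists n : int, `|t - n%:~R| < e.
Proof.
move=> e0; pose e' := Num.min e 2^-1.
have e'0 : 0 < e' by rewrite lt_min e0 invr_gt0 ltr0n.
have /andP[t1 t2] := @tau_bounds R.
have mem (u : R) : 0 <= u -> u <= 2^-1 -> u * (pi *+ 2) \in `[0, pi].
  move=> u0 u1; rewrite in_itv/= mulr_ge0//; last by lra.
  by rewrite mulr2n; rewrite mulr2n in t1 t2; nra.
have e'h : e' <= 2^-1 by rewrite ge_min lexx orbT.
exists (1 - cc e').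
  have m0 : 0 \in `[0, pi : R] by rewrite in_itv/= lexx pi_ge0.
  rewrite subr_gt0 -cos0 /cc (ltr_cos m0 (mem _ (ltW e'0) e'h)).
  by rewrite mulr_gt0//; lra.
move=> t; rewrite subKr; have [n tn] := int_near t.
have -> : cc t = cc `|t - n%:~R|.
  rewrite -(ccDint t (- n)) mulrNz.
  have [h|h] := leP 0 (t - n%:~R); first by rewrite ger0_norm.
  by rewrite ltr0_norm// ccN.
rewrite /cc (ltr_cos (mem _ (normr_ge0 _) tn) (mem _ (ltW e'0) e'h)) ltr_pM2r;
  last by lra.
by move=> h; exists n; rewrite (lt_le_trans h)// ge_min lexx.
Qed.

Lemma cc_eq1 t : cc t = 1 -> exists n : int, t = n%:~R.
Proof.
move=> t1; have [n tn] := int_near t; exists n.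
apply/eqP; rewrite -subr_eq0 -normr_eq0; apply/negP => /negP h.
have tn0 : 0 < `|t - n%:~R| by rewrite lt_def h normr_ge0.
have /cc_near1[d d0 /(_ t)] : 0 < Num.min `|t - n%:~R| 4^-1.
  by rewrite lt_min tn0 invr_gt0 ltr0n.
rewrite t1 gtrBl => /(_ d0)[k]; rewrite lt_min => /andP[k1 k2].
suff e : k = n by rewrite e ltxx in k1.
have : `|(k - n)%:~R : R| < 1.
  rewrite (_ : _%:~R = (t - n%:~R) - (t - k%:~R)); last by rewrite intrB; ring.
  by rewrite (le_lt_trans (ler_normB _ _))//; lra.
by rewrite -intr_norm -[1]/(1%:~R) ltr_int; lia.
Qed.

(** Averaging over the times 0 and 1 multiplies the cosine by [cc (b / 2)] and shifts its phase.
    Iterating contracts geometrically, because [|cc (b / 2)| = 1] would make [b] an integer. *)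
Lemma null_rotation (Z : Type) (T : Z -> Z) (theta : Z -> R) (b : R) :
  (forall z, exists n : int, theta (T z) = theta z + b + n%:~R) ->
  (forall n : int, b <> n%:~R) -> null T theta.
Proof.
move=> hT hb.
have r1 : `|cc (b / 2)| < 1.
  rewrite lt_neqAle cc_max andbT; apply/negP => /eqP h.
  have [n] : exists n : int, b = n%:~R; last exact: hb.
  apply: cc_eq1; have -> : b = b / 2 + b / 2 by field.
  have := cc2Dss2 (b / 2); rewrite ccD -!expr2 -(ger0_norm (sqr_ge0 (cc _))) normrX h.
  by rewrite expr1n => h'; lra.
have step k : exists2 s : seq nat, (0 < size s)%N & forall c z,
    `|orbit_avg T s (fun z => cc (theta z + c)) z| <= `|cc (b / 2)| ^+ k.
  elim: k => [|k [s s0 hs]].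
    exists [:: 0%N] => // c z.
    by rewrite expr0 /orbit_avg /avg big_seq1 divr1 cc_max.
  exists (conv_seq s [:: 0; 1]%N) => [|c z]; first exact: size_conv_seq.
  rewrite orbit_avg_convr.
  rewrite (_ : orbit_avg T s _ z = cc (b / 2) *
      orbit_avg T s (fun z => cc (theta z + (c + b / 2))) z).
    by rewrite normrM exprS ler_wpM2l.
  rewrite /orbit_avg -avgZ; apply: eq_avg => l.
  rewrite /avg big_cons big_seq1/=; have [n ->] := hT (iter l T z).
  have -> : theta (iter l T z) + b + n%:~R + c = theta (iter l T z) + b + c + n%:~R
    by ring.
  rewrite ccDint ccM addrC.
  congr ((_ + _) / _); last rewrite -ccN; by congr (cc _); field.
move=> c e e0.
have [k hk] : exists k, `|cc (b / 2)| ^+ k <= e.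
  have r1' : `| `|cc (b / 2)| | < 1 by rewrite normr_id.
  have /cvgrPdist_le/(_ e e0)[k _ hk] := cvg_expr r1'.
  exists k; have := hk k (leqnn k); rewrite /= sub0r normrN.
  by rewrite normrX normr_id.
have [s s0 hs] := step k; exists s => // z.
by rewrite subr0 (le_trans (hs _ _)).
Qed.

End Rotation.

(** * Equidistribution implies density *)

Lemma avg_diag (R : realType) (M : nat) (a : R) : (0 < M)%N ->
  avg (iota 0 M) (fun i => avg (iota 0 M) (fun j => if i == j then a else 0)) = a / M%:R.
Proof.
move=> M0; have sz : (0 < size (iota 0 M))%N by rewrite size_iota.
rewrite -[RHS](avg_cst _ sz) /avg; congr (_ / _); apply: eq_big_seq => i.
rewrite mem_iota add0n => /andP[_ iM]; rewrite size_iota; congr (_ / _).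
rewrite (bigD1_seq i)/= ?iota_uniq ?mem_iota ?eqxx// big1 ?addr0// => j.
by rewrite eq_sym => /negPf ->.
Qed.

Section Density.
Context {R : realType} {n : nat} (T : 'cV[R]_n -> 'cV[R]_n).
Implicit Types (s : seq 'I_n) (w : 'rV[int]_n).

Definition char w (z : 'cV[R]_n) : R := (map_mx intr w *m z) 0 0.

Lemma charD w w' z : char (w + w') z = char w z + char w' z.
Proof. by rewrite /char map_mxD mulmxDl mxE. Qed.

Lemma charN w z : char (- w) z = - char w z.
Proof. by rewrite /char map_mxN mulNmx mxE. Qed.

Lemma char_delta (k : int) i z : char (k *: delta_mx 0 i) z = k%:~R * z i 0.
Proof.
rewrite /char mxE (bigD1 i)//= big1 ?addr0 => [|j ji].
  by rewrite !mxE !eqxx mulr1.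
by rewrite !mxE (negPf ji) andbF mulr0 mulr0z mul0r.
Qed.

Hypothesis T_null : forall w, w != 0 -> null T (char w).
Variables (z0 : 'cV[R]_n) (M : nat).
Hypothesis M_gt0 : (0 < M)%N.

(** The Fejer kernel in the [i]-th coordinate of [z - z0]: the squared modulus of the average of [M]
    powers of a character, with value 1 at [z0] and mean [1 / M]. *)
Definition fejer i (z : 'cV[R]_n) : R :=
  avg (iota 0 M) (fun j => avg (iota 0 M) (fun j' =>
    cc (j%:R * (z i 0 - z0 i 0) - j'%:R * (z i 0 - z0 i 0)))).

Lemma fejer_ge0 i z : 0 <= fejer i z.
Proof. by rewrite /fejer avg_ccB addr_ge0// sqr_ge0. Qed.

(** Expanding the kernel of [i] adds to [w] the [i]-th basis frequency times [j - j'] or its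
    opposite. Since [w] vanishes at [i], the new frequency can only be zero if [j = j'] and [w = 0];
    what survives is the diagonal, of weight [1 / M]. The phase [c] is general because the expansion
    produces phases. *)
Lemma mean_fejer s w c : uniq s -> (forall i, i \in s -> w 0 i = 0) ->
  mean T (fun z => cc (char w z + c) * \prod_(i <- s) fejer i z)
    (if w == 0 then cc c / M%:R ^+ size s else 0).
Proof.
elim: s w c => [w c _ _|i s ih w c /=/andP[iNs us] hw].
  case: eqP => [->|/eqP w0].
    apply: mean_ext (mean_cst T _) => z.
    by rewrite big_nil expr0 divr1 mulr1 /char map_mx0 mul0mx mxE add0r.
  by apply: mean_ext (T_null w0 c) => z; rewrite big_nil mulr1.
have wi : w 0 i = 0 by apply: hw; rewrite mem_head.
pose d (j j' : nat) : int := (j%:Z - j'%:Z)%R.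
pose g (k : int) z := cc (char (w + k *: delta_mx 0 i) z + (c - k%:~R * z0 i 0)) *
  \prod_(i <- s) fejer i z.
pose m (k : int) : R := if (k == 0) && (w == 0) then cc c / M%:R ^+ size s else 0.
have gm k : mean T (g k) (m k).
  rewrite /m; have [->|k0]/= := eqVneq k 0.
    have -> : (if w == 0 then cc c / M%:R ^+ size s else 0 : R) =
        (if w + 0 *: delta_mx 0 i == 0 then cc (c - 0%:~R * z0 i 0) / M%:R ^+ size s
          else 0).
      by rewrite scale0r addr0 mul0r subr0.
    apply: ih => // i' i's; rewrite scale0r addr0 hw// inE i's orbT//.
  have h : w + k *: delta_mx 0 i != 0.
    by apply: contra k0 => /eqP/rowP/(_ i); rewrite !mxE wi !eqxx mulr1 add0r => ->.
  have := ih (w + k *: delta_mx 0 i) (c - k%:~R * z0 i 0) us.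
  rewrite (negPf h); apply => i' i's.
  have ii' : i' != i by apply: contra iNs => /eqP <-.
  by rewrite !mxE (negPf ii') andbF mulr0 addr0 hw// inE i's orbT.
have -> : (if w == 0 then cc c / M%:R ^+ (size s).+1 else 0) =
    avg (iota 0 M) (fun j => avg (iota 0 M) (fun j' =>
      2^-1 * (m (d j j') + m (- d j j')))).
  have mE j j' : 2^-1 * (m (d j j') + m (- d j j')) = m (d j j').
    have -> : m (- d j j') = m (d j j') by rewrite /m oppr_eq0.
    by move: (m _) => a; field.
  rewrite (eq_avg _ (g := fun j => avg (iota 0 M) (fun j' =>
    if j == j' then m 0 else 0))).
    rewrite avg_diag// /m eqxx/=; case: ifP => _; last by rewrite mul0r.
    by rewrite exprSr invfM mulrA.
  move=> j; apply: eq_avg => j'; rewrite mE /m /d subr_eq0.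
  by have [->|/eqP jj] := eqVneq j j'; rewrite ?eqxx//; case: eqP => // -[].
have M0 : (0 < size (iota 0 M))%N by rewrite size_iota.
apply: (@mean_ext _ _ _ (fun z => avg (iota 0 M) (fun j => avg (iota 0 M)
    (fun j' => 2^-1 * (g (d j j') z + g (- d j j') z))))).
  move=> z; rewrite big_cons [fejer i z * _]mulrC mulrA /fejer.
  rewrite -avgZ; apply: eq_avg => j; rewrite -avgZ; apply: eq_avg => j'.
  rewrite /g -mulrDl mulrA [RHS]mulrAC; congr (_ * _).
  rewrite !charD !char_delta ccM mulrC; congr ((cc _ + cc _) * _).
    by rewrite /d; ring.
  by rewrite /d; ring.
apply: (mean_avg _ (G := fun j z => avg (iota 0 M)
    (fun j' => 2^-1 * (g (d j j') z + g (- d j j') z)))) => j.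
apply: (mean_avg _ (G := fun j' z => 2^-1 * (g (d j j') z + g (- d j j') z))) => j'.
by apply: meanZ; apply: meanD.
Qed.

Lemma mean_prod_fejer s : uniq s ->
  mean T (fun z => \prod_(i <- s) fejer i z) (M%:R ^- size s).
Proof.
move=> us; have := @mean_fejer s 0 0 us (fun i _ => mxE _ _ _ _).
rewrite eqxx cc0 div1r; apply: mean_ext => z.
by rewrite /char map_mx0 mul0mx mxE addr0 cc0 mul1r.
Qed.

(** The cosine and sine averages are both at most [1 / (M |ss (t / 2)|)], and [1 - cc t] is twice
    the square of [ss (t / 2)]: hence 4. *)
Lemma fejer_le i z : fejer i z * (M%:R ^+ 2 * (1 - cc (z i 0 - z0 i 0))) <= 4.
Proof.
rewrite /fejer avg_ccB; move: (z i 0 - z0 i 0) => t;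
  have ct : 1 - cc t = 2 * ss (t / 2) ^+ 2.
  have -> : cc t = cc (t / 2) ^+ 2 - ss (t / 2) ^+ 2.
    by rewrite !expr2 -ccD; congr cc; field.
  by have := cc2Dss2 (t / 2); lra.
have key c : avg (iota 0 M) (fun h => cc (c + h%:R * t)) ^+ 2 *
    (M%:R ^+ 2 * ss (t / 2) ^+ 2) <= 1.
  have := avg_cc_iota M c t; move: (avg _ _) => a h.
  have h0 : 0 <= `|a| * (M%:R * `|ss (t / 2)|) by rewrite !mulr_ge0.
  by have := exprn_ile1 2 h0 h; rewrite !exprMn !real_normK ?num_real.
rewrite ct.
have -> : avg (iota 0 M) (fun i : nat => cc (i%:R * t)) = avg (iota 0 M) (fun h =>
  cc (0 + h%:R * t)).
  by apply: eq_avg => j; rewrite add0r.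
have -> : avg (iota 0 M) (fun i : nat => ss (i%:R * t)) =
    - 1 * avg (iota 0 M) (fun h => cc (4^-1 + h%:R * t)).
  by rewrite -avgZ; apply: eq_avg => j; rewrite addrC ccDquarter mulN1r opprK.
rewrite mulN1r sqrrN; move: (key 0) (key 4^-1).
move: (avg _ _) => a; move: (avg _ _) => b; move=> h1 h2.
lra.
Qed.

End Density.

(** Otherwise at each time some coordinate is far from that of [z0], and its kernel is at most
    [c = 4 / (M^2 d)]. So the product of all kernels is at most [c] times the sum of the products
    that omit one of them. Taking means, [M^-n <= n c M^-(n-1)], which fails once [M > 4 n / d]. *)
Lemma null_dense (R : realType) (n : nat) (T : 'cV[R]_n -> 'cV[R]_n) :
  (forall w, w != 0 -> null T (char w)) ->
  forall (z z0 : 'cV[R]_n) (e : R), 0 < e ->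
  exists l, forall i, exists k : int, `|iter l T z i 0 - z0 i 0 - k%:~R| < e.
Proof.
move=> Tn z z0 e e0; have [d d0 hd] := cc_near1 e0.
apply: contrapT => /forallNP far.
have {}far l : exists i, cc (iter l T z i 0 - z0 i 0) <= 1 - d.
  apply: contrapT => /forallNP h; apply: (far l) => i; apply: hd.
  by rewrite ltNge; apply/negP/h.
pose M := (Num.truncn (n%:R * (4 / d))).+1.
have M0 : (0 < M)%N by [].
have MR0 : 0 < M%:R :> R by rewrite ltr0n.
pose P (r : seq 'I_n) y := \prod_(i <- r) fejer z0 M i y.
have P0 r y : 0 <= P r y by apply: prodr_ge0 => i _; apply: fejer_ge0.
pose c : R := 4 / (M%:R ^+ 2 * d).
have us := index_enum_uniq 'I_n.
have size_idx : size (index_enum 'I_n) = n by rewrite -[RHS]card_ord cardT enumT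
  [index_enum _]unlock.
have bound l : P (index_enum 'I_n) (iter l T z) <=
    \sum_(i < n) c * P (rem i (index_enum 'I_n)) (iter l T z).
  have [i hi] := far l; rewrite (bigD1 i)//=.
  rewrite -[leLHS]addr0 lerD//; last first.
    by apply: sumr_ge0 => j _; rewrite mulr_ge0// /c divr_ge0// mulr_ge0 ?sqr_ge0// ltW.
  rewrite {1}/P (perm_big _ (perm_to_rem (mem_index_enum i)))/= big_cons.
  apply: ler_wpM2r; first exact: P0.
  rewrite /c ler_pdivlMr ?mulr_gt0 ?exprn_gt0//.
  apply: le_trans (fejer_le z0 M i (iter l T z)).
  by rewrite !ler_wpM2l ?fejer_ge0 ?sqr_ge0//; lra.
have /= := mean_le (mean_prod_fejer Tn z0 M0 us)
  (mean_sum (index_enum 'I_n) (fun i =>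
    meanZ c (mean_prod_fejer Tn z0 M0 (rem_uniq i us)))) bound.
apply/negP; rewrite -ltNge.
rewrite (eq_bigr (fun=> c * M%:R / M%:R ^+ n)); last first.
  move=> i _; rewrite size_rem ?mem_index_enum//.
  rewrite size_idx -mulrA; congr (_ * _).
  rewrite -{2}(prednK (leq_ltn_trans (leq0n i) (ltn_ord i))) exprS invfM mulrA.
  by rewrite mulfV ?mul1r// gt_eqF.
rewrite sumr_const card_ord -mulrnAl size_idx -[ltRHS]mul1r.
rewrite ltr_pM2r ?invr_gt0 ?exprn_gt0// -[ltLHS]mulr_natl /c.
rewrite [ltLHS](_ : _ = n%:R * (4 / d) / M%:R); last by field; rewrite !gt_eqF.
by rewrite ltr_pdivrMr// mul1r truncnS_gt.
Qed.

(** * Skew products over a rotation of the circle *)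

Section UniformlyAlmostPeriodic.
Context {R : realType}.
Implicit Types (w : R -> R) (e : R).

Definition near_int e (t : R) : Prop := exists n : int, `|t - n%:~R| <= e.

Lemma near_intD e e' t t' : near_int e t -> near_int e' t' -> near_int (e + e') (t + t').
Proof.
move=> [n hn] [n' hn']; exists (n + n'); rewrite intrD opprD addrACA.
by rewrite (le_trans (ler_normD _ _))// lerD.
Qed.

Lemma near_intN e t : near_int e t -> near_int e (- t).
Proof. by move=> [n hn]; exists (- n); rewrite mulrNz -opprD normrN. Qed.

Lemma near_intM e (k : int) t : near_int e t -> near_int (`|k|%:~R * e) (k%:~R * t).
Proof.
move=> [n hn]; exists (k * n); rewrite intrM -mulrBr normrM intr_norm.
by rewrite ler_wpM2l.
Qed.

Lemma near_int_le e e' t : e <= e' -> near_int e t -> near_int e' t.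
Proof. by move=> ee' [n hn]; exists n; apply: le_trans ee'. Qed.

Lemma near_int_norm e t : `|t| <= e -> near_int e t.
Proof. by exists 0; rewrite subr0. Qed.

Lemma cc_near_int e x y : near_int e (x - y) -> `|cc x - cc y| <= 8 * e.
Proof.
move=> [n hn]; rewrite -(ccDint y n) (le_trans (cc_lip _ _))// ler_wpM2l//.
by rewrite opprD addrA.
Qed.

(* [w] induces a uniformly continuous map from the circle to itself. *)
Definition circle_map w : Prop := forall e, 0 < e -> exists2 d, 0 < d &
  forall x t, near_int d t -> near_int e (w (x + t) - w x).

Lemma circle_map_cst a : circle_map (fun=> a).
Proof. by move=> e e0; exists 1 => // x t _; apply: near_int_norm;
  rewrite subrr normr0 ltW. Qed.

Lemma circle_mapD w w' : circle_map w -> circle_map w' ->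
  circle_map (fun x => w x + w' x).
Proof.
move=> h h' e e0; have e20 : 0 < e / 2 by rewrite divr_gt0.
have [d d0 hd] := h _ e20; have [d' d'0 hd'] := h' _ e20.
exists (Num.min d d'); first by rewrite lt_min d0.
move=> x t ht; rewrite opprD addrACA (splitr e); apply: near_intD.
  by apply: hd; apply: near_int_le ht; rewrite ge_min lexx.
by apply: hd'; apply: near_int_le ht; rewrite ge_min lexx orbT.
Qed.

Lemma circle_mapN w : circle_map w -> circle_map (fun x => - w x).
Proof.
move=> h e /h[d d0 hd]; exists d => // x t /hd => /(_ x).
by move=> /near_intN; rewrite opprB opprK addrC.
Qed.

Lemma circle_map_shift w a : circle_map w -> circle_map (fun x => w (x + a)).
Proof.
by move=> h e /h[d d0 hd]; exists d => // x t /(hd (x + a)); rewrite addrAC.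
Qed.

Lemma circle_mapM (k : int) w : circle_map w -> circle_map (fun x => k%:~R * w x).
Proof.
move=> h e e0; have k0 : 0 < `|k|%:~R + 1 :> R by rewrite ltr_wpDl// ler0z.
have [d d0 hd] := h _ (divr_gt0 e0 k0); exists d => // x t /(hd x).
rewrite -mulrBr => /(near_intM k); apply: near_int_le.
rewrite mulrA ler_pdivrMr// mulrC ler_wpM2l ?(ltW e0)//.
by rewrite lerDl.
Qed.

Lemma circle_map_id : circle_map id.
Proof. by move=> e e0; exists e => // x t; rewrite addrAC subrr add0r. Qed.

Lemma circle_map_sum (I : Type) (r : seq I) (w : I -> R -> R) :
  (forall i, circle_map (w i)) -> circle_map (fun x => \sum_(i <- r) w i x).
Proof.
move=> h; elim: r => [|i r ih].
  by under [X in circle_map X]funext do rewrite big_nil; apply: circle_map_cst.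
by under [X in circle_map X]funext do rewrite big_cons; apply: circle_mapD.
Qed.

End UniformlyAlmostPeriodic.

Section SkewProduct.
Context {R : realType} {q : nat}.
Variables (C : 'cV[int]_q) (B : 'M[int]_q) (alpha : R) (F : R -> 'cV[R]_q).
Implicit Types (k : 'rV[int]_q) (z : R * 'cV[R]_q) (x : R).

Definition fiber_shift x : 'cV[R]_q := x *: map_mx intr C + F x.

Definition skew z : R * 'cV[R]_q :=
  (z.1 + alpha, fiber_shift z.1 + map_mx intr B *m z.2).

(** The part of the phase of [k] after [l] steps that depends on the base alone. Undoing the last
    step first turns the frequency [k] into [k *m B]. *)
Fixpoint cocycle k l x : R :=
  if l is l'.+1 then cocycle (k *m B) l' x + char k (fiber_shift (x + l'%:R * alpha))
  else 0.

Lemma charDr k (y y' : 'cV[R]_q) : char k (y + y') = char k y + char k y'.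
Proof. by rewrite /char mulmxDr mxE. Qed.

Lemma charZr k a (y : 'cV[R]_q) : char k (a *: y) = a * char k y.
Proof. by rewrite /char -scalemxAr mxE. Qed.

Lemma char_mulmx k (A : 'M[int]_q) (y : 'cV[R]_q) :
  char k (map_mx intr A *m y) = char (k *m A) y.
Proof. by rewrite /char map_mxM mulmxA. Qed.

Lemma skew_iter1 l z : (iter l skew z).1 = z.1 + l%:R * alpha.
Proof.
elim: l => [|l ih]; first by rewrite mul0r addr0.
by rewrite iterS /= ih -natr1 mulrDl mul1r addrA.
Qed.

Lemma skew_iter2 k l z :
  char k (iter l skew z).2 = char (k *m B ^+ l) z.2 + cocycle k l z.1.
Proof.
elim: l k => [|l ih] k; first by rewrite expr0 mulmx1 addr0.
rewrite iterS /= charDr char_mulmx ih skew_iter1 exprS mulmxA.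
by rewrite addrC -addrA.
Qed.

Lemma circle_map_char k : (forall i, circle_map (fun x => F x i 0)) ->
  circle_map (fun x => char k (fiber_shift x)).
Proof.
move=> hF.
have -> : (fun x => char k (fiber_shift x)) = (fun x =>
  ((k *m C) 0 0)%:~R * x + \sum_i (k 0 i)%:~R * F x i 0).
  apply/funext => x; rewrite charDr charZr mulrC; congr (_ * _ + _).
    by rewrite /char -map_mxM mxE.
  by rewrite /char mxE; apply: eq_bigr => i _; rewrite mxE.
apply: circle_mapD; first exact/circle_mapM/circle_map_id.
by apply: circle_map_sum => i; apply: circle_mapM.
Qed.

Lemma circle_map_cocycle k l : (forall i, circle_map (fun x => F x i 0)) ->
  circle_map (cocycle k l).
Proof.
move=> hF; elim: l k => [|l ih] k; first exact: circle_map_cst.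
apply: circle_mapD; first exact: ih.
by apply: (circle_map_shift (w := fun x => char k (fiber_shift x)));
  apply: circle_map_char.
Qed.

(* The two ways in which a frequency [k] fixed by a power of [B] can be
   resolved, at times that almost fix the base: the phase of [k] evolves as a
   nontrivial character of the base, or as an arithmetic progression whose
   ratio depends on the base point through a wave. *)
Definition drifting k : Prop := forall (H : nat) (e : R), 0 < e ->
  exists D : nat, forall h, (0 < h < H)%N ->
    [/\ k *m B ^+ (D * h) = k, near_int e ((D * h)%:R * alpha) &
      exists (p : int) (a : R), p != 0 /\
        forall x, near_int e (cocycle k (D * h) x - (p%:~R * x + a))].

Definition oscillating k : Prop := forall (H : nat) (e : R), 0 < e ->
  exists (D N : nat) (xi a : R), [/\ (0 < N)%N, 16^-1 <= xi <= 8^-1 &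
    forall h, (h < H)%N -> [/\ k *m B ^+ (D * h) = k, near_int e ((D * h)%:R * alpha) &
      forall x, near_int e (cocycle k (D * h) x - h%:R * (xi * ss (N%:R * x + a)))]].

Hypothesis alpha_irr : forall (p n : int), p != 0 -> p%:~R * alpha <> n%:~R.
Hypothesis F_circle : forall i, circle_map (fun x => F x i 0).

Lemma null_base (p : int) a : p != 0 -> null skew (fun z => p%:~R * z.1 + a).
Proof.
move=> p0; apply: (@null_rotation _ _ _ _ (p%:~R * alpha)) => [z|n].
  by exists 0; rewrite addr0 /=; ring.
exact: alpha_irr.
Qed.

(** One differencing, at times that almost fix the base: the contribution of [w] disappears and a
    character of the base remains. The function [w] is arbitrary because earlier differencings
    produce such terms. *)
Lemma null_drifting k (w : R -> R) : circle_map w -> drifting k ->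
  null skew (fun z => w z.1 + char k z.2).
Proof.
move=> hw hk; apply: null_vdc => H e e0.
have e1 : 0 < e / 16 by rewrite divr_gt0.
have [d d0 hd] := hw _ e1.
have m0 : 0 < Num.min d (e / 16) by rewrite lt_min d0.
have [D hD] := hk H _ m0.
exists D => h /hD[kB na [p [a [p0 hp]]]].
exists (fun z => p%:~R * z.1 + a); first exact: null_base.
move=> z; rewrite skew_iter1 skew_iter2 kB.
have n1 : near_int (e / 16) (w (z.1 + (D * h)%:R * alpha) - w z.1).
  by apply: hd; apply: near_int_le na; rewrite ge_min lexx.
have n2 : near_int (e / 16) (cocycle k (D * h) z.1 - (p%:~R * z.1 + a)).
  by apply: near_int_le (hp _); rewrite ge_min lexx orbT.
rewrite -lerBlDl (le_trans (ler_norm _))//.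
rewrite (_ : e = 8 * (e / 16 + e / 16)); last by field.
apply: cc_near_int; rewrite [X in near_int _ X](_ : _ = (w (z.1 + (D * h)%:R * alpha)
  - w z.1) + (cocycle k (D * h) z.1 - (p%:~R * z.1 + a))).
  exact: near_intD.
by ring.
Qed.

Lemma avg_le_in (s : seq nat) (f g : nat -> R) :
  {in s, forall i, f i <= g i} -> avg s f <= avg s g.
Proof.
move=> fg; rewrite /avg ler_wpM2r ?invr_ge0// big_seq [leRHS]big_seq.
exact: ler_sum.
Qed.

Lemma ss_natM (j : nat) (t : R) : `|ss (j%:R * t)| <= j%:R * `|ss t|.
Proof.
elim: j => [|j ih]; first by rewrite !mul0r ss0 normr0.
rewrite -natr1 !mulrDl !mul1r ssD (le_trans (ler_normD _ _))// lerD//.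
  by rewrite normrM (le_trans _ ih)// ler_piMr// cc_max.
by rewrite normrM ler_piMl// cc_max.
Qed.

(* The Fejer-type sum on the right detects the stationary points of the wave. *)
Lemma avg_wave (M H : nat) (xi c t : R) : (0 < M)%N -> (0 < H)%N ->
  16^-1 <= xi <= 8^-1 ->
  avg (iota 0 H) (fun h => cc (c + h%:R * (xi * ss t))) ^+ 2 <=
  (64 * M%:R / H%:R) ^+ 2 +
  2 * avg (iota 0 M) (fun j => avg (iota 0 M) (fun j' =>
    cc (j%:R * (2 * t) - j'%:R * (2 * t)))).
Proof.
move=> M0 H0 /andP[xi1 xi2].
have MR : 0 < M%:R :> R by rewrite ltr0n.
have HR : 0 < H%:R :> R by rewrite ltr0n.
set Fj := avg (iota 0 M) _; set a := avg (iota 0 H) _.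
have Fj0 : 0 <= Fj by rewrite /Fj avg_ccB addr_ge0// sqr_ge0.
have Q0 : 0 <= (64 * M%:R / H%:R) ^+ 2 :> R by exact: sqr_ge0.
have s1 := ss_max t.
(* Below this threshold [|ss (j t)| <= 1/4] for all [j < M], so each term of the Fejer sum is at
   least 1/2 and the trivial bound 1 suffices. Above it, [xi >= 1/16] keeps the ratio of the
   progression at least [1 / (64 M)]. *)
have [tl|tg] := ltP `|ss t| (4 * M%:R)^-1.
  have Fj1 : 2^-1 <= Fj.
    have szM : (0 < size (iota 0 M))%N by rewrite size_iota.
    rewrite -[leLHS](@avg_cst R _ (iota 0 M))// avg_le_in// => j.
    rewrite mem_iota add0n => /= jM.
    rewrite -[leLHS](@avg_cst R _ (iota 0 M))// avg_le_in// => j'.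
    rewrite mem_iota add0n => /= j'M.
    have -> : j%:R * (2 * t) - j'%:R * (2 * t) = (j%:R * t - j'%:R * t) + (j%:R * t -
      j'%:R * t) by ring.
    have small (i : nat) : (i < M)%N -> `|ss (i%:R * t)| <= 4^-1.
      move=> iM; rewrite (le_trans (ss_natM _ _))// (le_trans (ler_wpM2l _ (ltW tl)))//.
      by rewrite invfM mulrCA ler_piMr// ler_pdivrMr// mul1r ler_nat ltnW.
    have : `|ss (j%:R * t - j'%:R * t)| <= 2^-1.
      rewrite ssB (le_trans (ler_normB _ _))// (_ : 2^-1 = 4^-1 + 4^-1); last by field.
      by rewrite lerD// normrM -[leRHS]mulr1 ?[`|cc _| * _]mulrC ler_pM// ?small// cc_max.
    move: (_ - _) => u hu; rewrite ccD -!expr2.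
    have := cc2Dss2 u; have : ss u ^+ 2 <= 4^-1.
      rewrite (_ : 4^-1 = 2^-1 ^+ 2); last by field.
      by rewrite -[leLHS]real_normK ?num_real// lerXn2r ?nnegrE.
    lra.
  have a1 : `|a| <= 1.
    have szH : (0 < size (iota 0 H))%N by rewrite size_iota.
    rewrite (le_trans (avg_norm _ _))// -[leRHS](avg_cst _ szH).
    by apply: avg_le => i; apply: cc_max.
  have : a ^+ 2 <= 1 by rewrite -[leLHS]real_normK ?num_real// exprn_ile1.
  lra.
have := avg_cc_iota H c (xi * ss t); rewrite -/a.
have ys : `|xi * ss t| <= 8^-1.
  rewrite normrM (ger0_norm (x := xi)); last by lra.
  by rewrite -[leRHS]mulr1 ler_pM//; lra.
have := ss_half_ge ys; rewrite normrM (ger0_norm (x := xi)); last by lra.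
set v := `|ss _| => hv hav.
have v1 : (64 * M%:R)^-1 <= v.
  apply: le_trans hv; rewrite (_ : _^-1 = 16^-1 * (4 * M%:R)^-1); last by field;
    rewrite gt_eqF.
  by rewrite ler_pM// invr_ge0 mulr_ge0// ltW.
have : `|a| <= 64 * M%:R / H%:R.
  have h1 : `|a| * (H%:R * (64 * M%:R)^-1) <= 1.
    by rewrite (le_trans _ hav)// ler_wpM2l// ler_wpM2l.
  by move: h1; rewrite mulrA ler_pdivrMr ?mulr_gt0// mul1r ler_pdivlMr.
move=> a1; have : a ^+ 2 <= (64 * M%:R / H%:R) ^+ 2.
  rewrite -[leLHS]real_normK ?num_real// lerXn2r ?nnegrE// divr_ge0// mulr_ge0//;
    exact: ltW.
lra.
Qed.

Lemma mean_wave (M N : nat) (a : R) : (0 < M)%N -> (0 < N)%N ->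
  mean skew (fun z => avg (iota 0 M) (fun j => avg (iota 0 M) (fun j' =>
    cc (j%:R * (2 * (N%:R * z.1 + a)) - j'%:R * (2 * (N%:R * z.1 + a)))))) M%:R^-1.
Proof.
move=> M0 N0; rewrite -[M%:R^-1]div1r -avg_diag//.
apply: (mean_avg _ (G := fun j z => avg (iota 0 M) (fun j' =>
    cc (j%:R * (2 * (N%:R * z.1 + a)) - j'%:R * (2 * (N%:R * z.1 + a)))))) => j.
apply: (mean_avg _ (G := fun j' z =>
    cc (j%:R * (2 * (N%:R * z.1 + a)) - j'%:R * (2 * (N%:R * z.1 + a))))) => j'.
case: eqP => [->|/eqP jj]; first by apply: mean_ext (mean_cst _ 1) => z;
  rewrite subrr cc0.
pose p : int := (j%:Z - j'%:Z) * (2 * N%:Z).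
have p0 : p != 0 by rewrite /p !mulf_neq0// ?subr_eq0; lia.
apply: mean_ext (null_base ((j%:R - j'%:R) * (2 * a)) p0 0) => z.
by congr cc; rewrite /p intrM intrB intrM; ring.
Qed.

(** No differencing is used: along the times [D * h] the average at a given point is already a
    geometric sum, and [avg_wave] bounds its square by a function of the base of small mean. *)
Lemma null_oscillating k (w : R -> R) : circle_map w -> oscillating k ->
  null skew (fun z => w z.1 + char k z.2).
Proof.
move=> hw hk c; apply: mean0_of_sqr => e e0.
(* Then [2 * (16 * e') ^+ 2] is half the square of [Num.min 1 e], hence at most [e / 2]. *)
pose e' := Num.min 1 e / 32.
have e'0 : 0 < e' by rewrite divr_gt0// lt_min ltr01.
have ee' : 2 * (16 * e') ^+ 2 <= e / 2.
  have m1 : Num.min 1 e <= 1 by rewrite ge_min lexx.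
  have m2 : Num.min 1 e <= e by rewrite ge_min lexx orbT.
  by move: e'0 m1 m2; rewrite /e'; move: (Num.min 1 e) => u u0 u1 u2; nra.
have [d d0 hd] := hw _ e'0.
pose M := (Num.truncn (12 / e)).+1; have M0 : (0 < M)%N by [].
have Me : 6 / M%:R <= e / 2.
  have : 12 / e < M%:R by exact: truncnS_gt.
  rewrite ltr_pdivrMr// => h; rewrite ler_pdivrMr ?ltr0n//; lra.
(* This [H] turns [64 M / H] into [1 / M]; the mean [2 / M^2 + 4 / M] is then at most [6 / M]. *)
pose H := (64 * M ^ 2)%N; have H0 : (0 < H)%N by rewrite muln_gt0 expn_gt0.
have [|D [N [xi [a [N0 xi1 hD]]]]] := hk H (Num.min d e'); first by rewrite lt_min d0.
exists [seq (D * h)%N | h <- iota 0 H].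
exists (fun z => 2 * (16 * e') ^+ 2 + (2 / M%:R ^+ 2 + 4 * avg (iota 0 M) (fun j =>
  avg (iota 0 M) (fun j' =>
    cc (j%:R * (2 * (N%:R * z.1 + a)) - j'%:R * (2 * (N%:R * z.1 + a))))))).
exists (2 * (16 * e') ^+ 2 + (2 / M%:R ^+ 2 + 4 * M%:R^-1)); split.
- by rewrite size_map size_iota.
- apply: meanD; first exact: mean_cst.
  apply: meanD; first exact: mean_cst.
  by apply: meanZ; apply: mean_wave.
- have : 2 / M%:R ^+ 2 <= 2 / M%:R :> R.
    by rewrite ler_wpM2l// lef_pV2 ?posrE ?exprn_gt0 ?ltr0n// -natrX ler_nat leq_pmulr.
  lra.
move=> z; rewrite /orbit_avg avg_map.
set th := w z.1 + char k z.2 + c.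
set W := avg (iota 0 H) (fun h => cc (th + h%:R * (xi * ss (N%:R * z.1 + a)))).
set A := avg _ _; have AW : `|A - W| <= 16 * e'.
  rewrite /A /W -[- avg _ _]mulN1r -avgZ -avgD (le_trans (avg_norm _ _))//.
  have szH : (0 < size (iota 0 H))%N by rewrite size_iota.
  rewrite -[leRHS](avg_cst _ szH); apply: avg_le_in => h.
  rewrite mem_iota add0n => /= hH; have [kB na hx] := hD _ hH.
  rewrite mulN1r (_ : 16 * e' = 8 * (e' + e')); last by ring.
  apply: cc_near_int; rewrite skew_iter1 skew_iter2 kB /th.
  rewrite [X in near_int _ X](_ : _ = (w (z.1 + (D * h)%:R * alpha) - w z.1) +
    (cocycle k (D * h) z.1 - h%:R * (xi * ss (N%:R * z.1 + a)))); last by ring.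
  apply: near_intD; first by apply: hd; apply: near_int_le na; rewrite ge_min lexx.
  by apply: near_int_le (hx z.1); rewrite ge_min lexx orbT.
have A2 : A ^+ 2 <= 2 * (16 * e') ^+ 2 + 2 * W ^+ 2.
  have : (A - W) ^+ 2 <= (16 * e') ^+ 2.
    by rewrite -[leLHS]real_normK ?num_real// lerXn2r ?nnegrE// mulr_ge0// ltW.
  have := sqr_ge0 (A - 2 * W); nra.
have := avg_wave th (N%:R * z.1 + a) M0 H0 xi1; rewrite -/W.
have -> : (64 * M%:R / H%:R) ^+ 2 = 1 / M%:R ^+ 2 :> R.
  rewrite /H natrM natrX; move: (M%:R) (ltr0Sn R (Num.truncn (12 / e))) => y y0.
  by field; rewrite gt_eqF.
by move: (avg _ _) A2 => Fj; move: (16 * e') => u; lra.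
Qed.

(** [N] commutes with [(1 + N) ^+ h], so [k *m N] is fixed as well and by induction is killed by
    [N]. The powers of [1 + N] then act on [k] by adding multiples of [k *m N], and [h] times this
    integer vector is zero. *)
Lemma unipotent_fixed (N : 'M[int]_q) r k (h : nat) : (0 < h)%N ->
  k *m N ^+ r = 0 -> k *m (1 + N) ^+ h = k -> k *m N = 0.
Proof.
move=> h0; elim: r k => [|r ih] k; first by rewrite expr0 mulmx1 => -> _; rewrite mul0mx.
have comN : GRing.comm N ((1 + N) ^+ h).
  by apply: commrX; apply: commrD; [exact: commr1|].
move=> kN kh; have kNN : k *m N *m N = 0.
  apply: ih; first by rewrite -mulmxA (_ : N *m N ^+ r = N ^+ r.+1)// exprS.
  by rewrite -mulmxA [N *m _]comN mulmxA kh.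
have lin j : k *m (1 + N) ^+ j = k + (k *m N) *+ j.
  elim: j => [|j ihj]; first by rewrite expr0 mulmx1 mulr0n addr0.
  rewrite exprSr mulmxA ihj mulmxDr mulmx1 mulmxDl.
  rewrite [X in _ + (_ + X)](_ : _ = (k *m N *m N) *+ j); last first.
    by elim: j {ihj} => [|j ihj]; rewrite ?mul0mx// !mulrS mulmxDl ihj.
  by rewrite kNN mul0rn addr0 mulrSr addrA.
move: kh; rewrite lin => /eqP; rewrite -subr_eq0 addrC addKr => /eqP h1.
apply/rowP => i; have /rowP/(_ i) := h1; rewrite mulmxnE [RHS]mxE => /eqP.
by rewrite mulrn_eq0 eqn0Ngt h0 => /eqP ->; rewrite mxE.
Qed.

(** Induction on the nilpotency order of [k]. If [k] is not fixed by [B ^+ m], differencing at the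
    times [m * h] replaces it by [k B^(mh) - k], which is killed by a lower power and is nonzero by
    [unipotent_fixed]; the cocycle that appears joins [w]. *)
Lemma null_fiber (m : nat) r : (0 < m)%N ->
  (forall k, k != 0 -> k *m B ^+ m = k -> drifting k \/ oscillating k) ->
  forall k (w : R -> R), k != 0 -> k *m (B ^+ m - 1) ^+ r = 0 -> circle_map w ->
  null skew (fun z => w z.1 + char k z.2).
Proof.
move=> m0 hres; set N := B ^+ m - 1; elim: r => [|r ih] k w k0.
  by rewrite expr0 mulmx1 => k0'; rewrite k0' eqxx in k0.
move=> kN hw; have [kf|knf] := eqVneq (k *m N) 0.
  have kB : k *m B ^+ m = k.
    by apply/eqP; rewrite -subr_eq0 -{2}[k]mulmx1 -mulmxBr; apply/eqP.
  by have [|] := hres k k0 kB; [exact: null_drifting|exact: null_oscillating].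
apply: null_vdc => H e e0; exists m => h /andP[h0 _].
pose k' := k *m B ^+ (m * h) - k.
exists (fun z => (w (z.1 + (m * h)%:R * alpha) - w z.1 + cocycle k (m * h) z.1) +
  char k' z.2).
  apply: (ih k' (fun x => w (x + (m * h)%:R * alpha) - w x + cocycle k (m * h) x)).
  - apply: contra knf; rewrite subr_eq0 => /eqP kB; apply/eqP.
    by apply: (@unipotent_fixed N r.+1 k h) => //; rewrite [1 + _]addrC subrK -exprM.
  - have -> : k' = k *m (N *m (\sum_(i < h) (B ^+ m) ^+ i)).
      by rewrite /k' exprM -{2}[k]mulmx1 -mulmxBr; congr (_ *m _); rewrite subrX1.
    set S := \sum_(_ < _) _.
    have comN : GRing.comm (N ^+ r) S.
      apply/commr_sym/commrX/commr_sym/commr_sum => i _.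
      by apply/commrX/commr_sym/commrD; [|exact/commrN/commr1].
    rewrite -mulmxA -[N *m S *m _]mulmxA -[S *m _]comN.
    by rewrite [X in k *m X]mulmxA mulmxA (_ : N *m N ^+ r = N ^+ r.+1) ?exprS//
      -exprS kN mul0mx.
  - apply: circle_mapD; last exact: circle_map_cocycle.
    by apply: circle_mapD; [exact: circle_map_shift|exact: circle_mapN].
move=> z; rewrite skew_iter1 skew_iter2 /k' charD charN.
rewrite [X in cc X <= _](_ : _ = w (z.1 + (m * h)%:R * alpha) - w z.1 + cocycle k (m
  * h) z.1 +
   (char (k *m B ^+ (m * h)) z.2 - char k z.2)); last by ring.
by rewrite lerDl ltW.
Qed.

End SkewProduct.

(** * Series with geometrically decreasing terms *)

Section DominatedSeries.
Context {R : realType}.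
Implicit Types (u v : nat -> R) (K : R).

Definition tsum u : R := limn (series u).

Definition dominated u : Prop := exists K, forall j, `|u j| <= K / 2 ^+ j.

Lemma dominated_cvg u : dominated u -> cvgn (series u).
Proof.
move=> [K hK]; apply: normed_cvg.
have h2 : `|2^-1 : R| < 1 by rewrite ger0_norm ?invr_ge0// invf_lt1// ltr1n.
apply: series_le_cvg (is_cvg_geometric_series (a := K) h2) => n //=.
  by rewrite exprVn (le_trans _ (hK n)).
by rewrite exprVn.
Qed.

Lemma tsum_tail u n K : cvgn (series u) ->
  (forall j, `|u (n + j)%N| <= K / 2 ^+ j) ->
  `|tsum u - \sum_(j < n) u j| <= 2 * K.
Proof.
move=> cu hK.
have part k : `|series u (n + k)%N - \sum_(j < n) u j| <= K * (2 - 2 * 2^-1 ^+ k).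
  rewrite seriesEord/= big_split_ord/= addrAC subrr add0r.
  rewrite (le_trans (ler_norm_sum _ _ _))//.
  rewrite (le_trans (ler_sum _ (fun (j : 'I_k) _ => hK j)))// -mulr_sumr.
  suff -> : \sum_(j < k) (2 ^+ j)^-1 = 2 - 2 * 2^-1 ^+ k :> R by [].
  elim: k => [|k ih]; first by rewrite big_ord0 expr0; ring.
  by rewrite big_ord_recr/= ih exprSr -exprVn; field.
have K0 : 0 <= K by have := hK 0%N; rewrite expr0 divr1; apply: le_trans.
have part2 N : (n <= N)%N -> `|series u N - \sum_(j < n) u j| <= 2 * K.
  move=> /subnKC <-; rewrite (le_trans (part _))// mulrC ler_wpM2r//.
  by rewrite gerBl mulr_ge0// exprn_ge0// invr_ge0.
rewrite ler_norml; apply/andP; split.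
  rewrite lerBrDr; apply: limr_ge => //; exists n => // N /= /part2.
  by rewrite ler_norml => /andP[]; rewrite lerBrDr.
rewrite lerBlDr; apply: limr_le => //; exists n => // N /= /part2.
by rewrite ler_norml => /andP[_]; rewrite lerBlDr.
Qed.

Lemma tsum_norm u K : (forall j, `|u j| <= K / 2 ^+ j) -> `|tsum u| <= 2 * K.
Proof.
move=> hK; have := @tsum_tail u 0 K (dominated_cvg (ex_intro _ K hK)) hK.
by rewrite big_ord0 subr0.
Qed.

Lemma tsumD u v : dominated u -> dominated v ->
  tsum (fun j => u j + v j) = tsum u + tsum v.
Proof. by move=> /dominated_cvg cu /dominated_cvg cv; rewrite /tsum -lim_seriesD. Qed.

Lemma tsumZ a u : dominated u -> tsum (fun j => a * u j) = a * tsum u.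
Proof. by move=> /dominated_cvg cu; exact: lim_seriesZ. Qed.

Lemma tsum_ge_term u n : dominated u -> (forall j, 0 <= u j) ->
  \sum_(j < n) u j <= tsum u.
Proof.
move=> /dominated_cvg cu u0; apply: limr_ge => //; exists n => // N /= /subnKC <-.
by rewrite seriesEord/= big_split_ord/= lerDl sumr_ge0.
Qed.

End DominatedSeries.

(** * A Liouville rotation number *)

Section Denominators.
Context {R : realType}.
Variables (m q : nat).
Hypothesis m_gt0 : (0 < m)%N.

(** The start [16 * m] makes [m] divide every denominator and keeps [m * step J] below 1/8. The
    growing exponent makes [alpha] a Liouville number: [gap J] is eventually below any given power
    of [1 / den J]. *)
Fixpoint den J : nat := if J is J'.+1 then den J' ^ (J' + 3) else 16 * m.

Lemma den_ge16 J : (16 <= den J)%N.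
Proof.
elim: J => [|J ih] /=; first by rewrite leq_pmulr.
by rewrite (leq_trans ih)// -{1}(expn1 (den J)) leq_pexp2l ?(leq_trans _ ih)// addnS.
Qed.

Lemma den_gt0 J : (0 < den J)%N.
Proof. exact: leq_trans (den_ge16 J). Qed.

Lemma den_mul J : (16 * den J <= den J.+1)%N.
Proof.
rewrite /= addnS expnSr leq_mul// ?(leq_trans (den_ge16 J))// addnS expnSr.
by rewrite leq_pmull// expn_gt0 den_gt0.
Qed.

Lemma den_geom J j : (2 ^ j * den J <= den (J + j))%N.
Proof.
elim: j => [|j ih]; first by rewrite expn0 mul1n addn0.
rewrite addnS (leq_trans _ (den_mul _))// expnS -mulnA leq_mul//.
Qed.

Lemma den_ge_m J : (16 * m <= den J)%N.
Proof. by have := den_geom 0 J; rewrite add0n; apply: leq_trans;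
  rewrite leq_pmull// expn_gt0. Qed.

(** Absorbs the polynomial factors in [J] that come from growing amplitudes and from counting the
    waves. *)
Lemma den_cube J : (J.+1 ^ 3 <= den J)%N.
Proof.
elim: J => [|J ih]; first exact: leq_trans (den_ge16 0).
rewrite (leq_trans _ (den_mul J))// (leq_trans _ (leq_mul (leqnn 16) ih))//.
rewrite (@leq_trans ((2 * J.+1) ^ 3))//; first by rewrite leq_exp2r//; lia.
by rewrite expnMn leq_mul.
Qed.

Lemma den_dvdm J : (m %| den J)%N.
Proof.
elim: J => [|J ih] /=; first exact: dvdn_mull.
by rewrite addnS expnSr dvdn_mull.
Qed.

Lemma den_dvd j J : (j < J)%N -> (m * den j %| den J)%N.
Proof.
elim: J => [//|J ih]; rewrite ltnS leq_eqVlt => /orP[/eqP->|jJ].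
  by rewrite /= addnS expnSr addnS expnSr -mulnA dvdn_mull// dvdn_mul ?den_dvdm.
by rewrite (dvdn_trans (ih jJ))//= addnS expnSr dvdn_mull.
Qed.

(** Together with [J %% q], which selects a coordinate of the fiber, every mode from 1 to [m] occurs
    infinitely often for each coordinate. *)
Definition mode J : nat := ((J %/ q) %% m).+1.

Definition freq J : nat := mode J * (den J %/ m).

Lemma mode_le J : (mode J <= m)%N.
Proof. by rewrite /mode ltn_mod. Qed.

Lemma freq_le J : (freq J <= den J)%N.
Proof. by rewrite -[leqRHS](divnK (den_dvdm J)) [leqRHS]mulnC leq_mul2r mode_le orbT. Qed.

Lemma den_le_freq J : (den J <= m * freq J)%N.
Proof. by rewrite -[leqLHS](divnK (den_dvdm J)) [leqLHS]mulnC leq_mul2l leq_pmull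
  ?orbT. Qed.

Lemma freq_gt0 J : (0 < freq J)%N.
Proof. by have := leq_trans (den_gt0 J) (den_le_freq J); rewrite muln_gt0 => /andP[]. Qed.

Lemma den_dvd_freq j J : (j < J)%N -> (den j %| freq J)%N.
Proof.
move=> jJ; rewrite dvdn_mull// -(dvdn_pmul2l m_gt0) [X in (_ %| X)%N]mulnC.
by rewrite divnK ?den_dvdm// den_dvd.
Qed.

Lemma dvd_den j J : (j <= J)%N -> (den j %| den J)%N.
Proof.
rewrite leq_eqVlt => /orP[/eqP->//|/den_dvd]; apply: dvdn_trans.
exact: dvdn_mull.
Qed.

Definition alpha : R := tsum (fun j => (den j)%:R^-1).

Definition gap J : R := alpha - \sum_(j < J.+1) (den j)%:R^-1.

Lemma den_inv_geom J j : (den (J + j))%:R^-1 <= (den J)%:R^-1 / 2 ^+ j :> R.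
Proof.
rewrite -invfM lef_pV2 ?posrE ?mulr_gt0 ?exprn_gt0 ?ltr0n ?den_gt0//.
by rewrite -natrX -natrM ler_nat mulnC den_geom.
Qed.

Lemma dominated_den : dominated (fun j => (den j)%:R^-1 : R).
Proof.
exists (den 0)%:R^-1 => j; rewrite ger0_norm//.
by have := den_inv_geom 0 j; rewrite add0n.
Qed.

Lemma gap_le J : gap J <= 2 / (den J.+1)%:R.
Proof.
rewrite (le_trans (ler_norm _))//; apply: tsum_tail => [|j].
  exact/dominated_cvg/dominated_den.
by rewrite ger0_norm// den_inv_geom.
Qed.

Lemma gap_ge J : (den J.+1)%:R^-1 <= gap J.
Proof.
rewrite lerBrDl; have := @tsum_ge_term R _ J.+2 dominated_den (fun j => _).
by rewrite big_ord_recr/=; apply => j; rewrite invr_ge0.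
Qed.

Lemma denR_gt0 J : 0 < (den J)%:R :> R.
Proof. by rewrite ltr0n den_gt0. Qed.

Lemma gap_gt0 J : 0 < gap J.
Proof. by apply: lt_le_trans (gap_ge J); rewrite invr_gt0 denR_gt0. Qed.

Lemma gap_le_pow J : gap J <= 2 / (den J)%:R ^+ (J + 3).
Proof. by have := gap_le J; rewrite /= natrX. Qed.

Lemma den_gap J : (den J)%:R * gap J <= 2 / (den J)%:R.
Proof.
have d0 := denR_gt0 J; rewrite mulrC -ler_pdivlMr// (le_trans (gap_le_pow J))//.
rewrite -mulrA ler_wpM2l// -invfM lef_pV2 ?posrE ?exprn_gt0 ?mulr_gt0//.
by rewrite -expr2 -!natrX ler_nat leq_pexp2l ?den_gt0// addnC.
Qed.

Lemma sum_den_int (L : nat) j J : (den J %| L)%N -> (j <= J)%N ->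
  exists n : int, L%:R * \sum_(i < j.+1) (den i)%:R^-1 = n%:~R :> R.
Proof.
move=> LJ jJ; exists (\sum_(i < j.+1) (L %/ den i)%N)%:Z.
rewrite mulr_sumr -pmulrn natr_sum; apply: eq_bigr => i _.
have iL : (den i %| L)%N by rewrite (dvdn_trans _ LJ)// dvd_den// (leq_trans _ jJ)//
  -ltnS.
by rewrite -{1}(divnK iL) natrM mulfK// gt_eqF ?denR_gt0.
Qed.

Lemma mul_alpha (L : nat) J : (den J %| L)%N ->
  exists n : int, L%:R * alpha = L%:R * gap J + n%:~R.
Proof.
move=> LJ; have [n hn] := sum_den_int LJ (leqnn J); exists n.
by rewrite -hn -mulrDr subrK.
Qed.

(** Through this, the single small number [gap J] controls all the waves of index at most [J] at
    multiples of [den J]. *)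
Lemma mul_gap (L : nat) j J : (den J %| L)%N -> (j <= J)%N ->
  exists n : int, L%:R * gap j = L%:R * gap J + n%:~R.
Proof.
move=> LJ jJ; have [n hn] := mul_alpha LJ; have [n' hn'] := sum_den_int LJ jJ.
by exists (n - n'); rewrite /gap mulrBr hn hn' intrB addrA.
Qed.

Definition step J : R := (freq J)%:R * gap J.

Lemma step_gt0 J : 0 < step J.
Proof. by rewrite mulr_gt0 ?gap_gt0// ltr0n freq_gt0. Qed.

Lemma step_le J : step J <= 2 / (den J)%:R ^+ (J + 2).
Proof.
have fd : (freq J)%:R <= (den J)%:R :> R by rewrite ler_nat freq_le.
rewrite /step (le_trans (ler_wpM2r (ltW (gap_gt0 J)) fd))//.
rewrite (le_trans (ler_wpM2l _ (gap_le_pow J)))// addnS exprS invfM mulrCA.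
by rewrite mulVKf// gt_eqF ?denR_gt0.
Qed.

(** The terms of [alpha] before the [J]-th become integers since [den i] divides [freq J], the
    [J]-th one gives the fraction, and the tail gives [step J]. *)
Lemma freq_alpha J : exists n : int,
  (freq J)%:R * alpha = (mode J)%:R / m%:R + step J + n%:~R.
Proof.
have -> : alpha = \sum_(i < J) (den i)%:R^-1 + (den J)%:R^-1 + gap J.
  by rewrite /gap big_ord_recr/= [RHS]addrC subrK.
exists (\sum_(i < J) (freq J %/ den i)%N)%:Z; rewrite 2!mulrDr -/(step J).
have -> : (freq J)%:R / (den J)%:R = (mode J)%:R / m%:R :> R.
  have -> : (den J)%:R = (den J %/ m)%:R * m%:R :> R by rewrite -natrM divnK ?den_dvdm.
  have P0 : (den J %/ m)%:R != 0 :> R.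
    by rewrite pnatr_eq0 -lt0n divn_gt0// dvdn_leq ?den_gt0 ?den_dvdm.
  have m0 : m%:R != 0 :> R by rewrite pnatr_eq0 -lt0n.
  by rewrite /freq natrM; move: P0 m0 => P0 m0; field; rewrite P0 m0.
rewrite mulr_sumr [RHS]addrC addrA; congr (_ + _ + _).
rewrite -pmulrn natr_sum; apply: eq_bigr => i _.
by rewrite -{1}(divnK (den_dvd_freq (ltn_ord i))) natrM mulfK// gt_eqF ?denR_gt0.
Qed.

Lemma den_unbounded (a : R) : exists J0, forall J, (J0 <= J)%N -> a <= J%:R.
Proof.
exists (Num.truncn a).+1 => J hJ; rewrite (le_trans (ltW (truncnS_gt a)))//.
by rewrite ler_nat.
Qed.

(** Otherwise [p * den J * gap J] would be a nonzero integer, of absolute value below 1 for large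
    [J]. *)
Lemma alpha_irrational (p n : int) : p != 0 -> p%:~R * alpha <> n%:~R.
Proof.
move=> p0 e.
have [J /(_ J (leqnn J)) hJ] := den_unbounded (2 * `|p|%:~R).
have [k hk] := mul_alpha (dvdnn (den J)).
have pR : 0 < `|p|%:~R :> R by rewrite ltr0z normr_gt0.
have h : p%:~R * ((den J)%:R * gap J) = (n * den J - p * k)%:~R.
  have := congr1 (fun x => (den J)%:R * x) e.
  rewrite mulrCA hk mulrDr !intrB !intrM => h; apply/eqP; rewrite eq_sym subr_eq.
  by rewrite eq_sym h mulrC.
have : 0 < `|(n * den J - p * k)%:~R : R| < 1.
  rewrite -h normrM -intr_norm (ger0_norm (mulr_ge0 _ (ltW (gap_gt0 J))))//.
  rewrite !mulr_gt0 ?gap_gt0 ?denR_gt0//=.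
  rewrite (le_lt_trans (ler_wpM2l (ltW pR) (den_gap J)))//.
  rewrite mulrA ltr_pdivrMr ?denR_gt0// mul1r mulrC (le_lt_trans hJ)//.
  by rewrite ltr_nat (leq_trans _ (den_cube J))// -{1}(expn1 J.+1) leq_pexp2l.
by rewrite -intr_norm ltr0z -[1]/(1%:~R) ltr_int; lia.
Qed.

End Denominators.

(** * The fiber function *)

Section PhaseAmplitude.
Context {R : realType}.

Lemma polar (u v : R) : exists r t : R, [/\ 0 <= r, u = r * cc t & v = r * ss t].
Proof.
pose r := Num.sqrt (u ^+ 2 + v ^+ 2).
have r2 : r ^+ 2 = u ^+ 2 + v ^+ 2 by rewrite sqr_sqrtr// addr_ge0// sqr_ge0.
have r0 : 0 <= r by exact: sqrtr_ge0.
have [rz|rn] := eqVneq r 0.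
  exists 0, 0; move: r2; rewrite rz expr0n/= => /esym/eqP.
  by rewrite paddr_eq0 ?sqr_ge0// !sqrf_eq0 !mul0r => /andP[/eqP-> /eqP->].
have rp : 0 < r by rewrite lt_def rn.
have tau0 : (pi : R) *+ 2 != 0 by have /andP[h _] := @tau_bounds R; rewrite gt_eqF//; lra.
have ur : -1 <= u / r <= 1.
  by rewrite ler_pdivlMr// ler_pdivrMr// mulN1r mul1r -ler_norml -ler_sqr ?nnegrE//
    real_normK ?num_real// r2 lerDl sqr_ge0.
have s1 : sin (acos (u / r)) = `|v| / r.
  rewrite sin_acos// -[`|v| / r]ger0_norm ?divr_ge0// -sqrtr_sqr; congr Num.sqrt.
  rewrite !expr_div_n real_normK ?num_real// -[1](@mulfV _ (r ^+ 2)) ?sqrf_eq0//.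
  by rewrite -mulrBl r2 addrAC subrr add0r.
have c1 : cos (acos (u / r)) = u / r by rewrite acosK// in_itv.
have [v0|v0] := leP 0 v.
  exists r, (acos (u / r) / (pi *+ 2)); rewrite /cc /ss mulfVK// c1 s1 ger0_norm//.
  by split=> //; rewrite mulrC divfK.
exists r, (- acos (u / r) / (pi *+ 2));
  rewrite /cc /ss mulfVK// cosN sinN c1 s1 ltr0_norm//.
by split=> //; rewrite ?mulNr ?opprK mulrC divfK.
Qed.

(** Cosines of equal frequency add like complex numbers of modulus [b i] and argument [s i]. The
    square of the resulting modulus is expanded into a double sum in view of Parseval. *)
Lemma phase_amplitude (n : nat) (b s : 'I_n -> R) : exists r t : R,
  [/\ 0 <= r, r <= \sum_i `|b i|,
      r ^+ 2 = \sum_i \sum_j b i * b j * cc (s i - s j) &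
      forall x, \sum_i b i * cc (x + s i) = r * cc (x + t)].
Proof.
have [r [t [r0 hu hv]]] := polar (\sum_i b i * cc (s i)) (\sum_i b i * ss (s i)).
have eqx x : \sum_i b i * cc (x + s i) = r * cc (x + t).
  rewrite ccD mulrBr mulrCA -hu mulrCA -hv !mulr_sumr -sumrB.
  by apply: eq_bigr => i _; rewrite ccD; ring.
exists r, t; split=> //.
  have := eqx (- t); rewrite addNr cc0 mulr1 => <-.
  rewrite (le_trans (ler_norm _))// (le_trans (ler_norm_sum _ _ _))// ler_sum// => i _.
  by rewrite normrM ler_piMr// cc_max.
have -> : r ^+ 2 = (r * cc t) ^+ 2 + (r * ss t) ^+ 2.
  by rewrite !exprMn -mulrDr cc2Dss2 mulr1.
rewrite -hu -hv !expr2 !mulr_suml -big_split/=; apply: eq_bigr => i _.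
rewrite !mulr_sumr -big_split/=; apply: eq_bigr => j _.
by rewrite ccB; ring.
Qed.

End PhaseAmplitude.

Section FiberFunction.
Context {R : realType}.
Variables (m q : nat) (C : 'cV[int]_q) (B : 'M[int]_q).
Hypothesis m_gt0 : (0 < m)%N.

Local Notation den := (den m).
Local Notation freq := (freq m q).
Local Notation mode := (mode m q).
Local Notation alpha := (@alpha R m).
Local Notation gap := (@gap R m).
Local Notation step := (@step R m q).

Definition amp J : R := J%:R * step J.

Definition fiber_term (i : 'I_q) x J : R :=
  (J %% q == i)%N%:R * amp J * cc ((freq J)%:R * x).

Definition fiber_fun x : 'cV[R]_q := \col_i tsum (fiber_term i x).

Lemma amp_ge0 J : 0 <= amp J.
Proof. by rewrite mulr_ge0// ltW// step_gt0. Qed.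

Lemma amp_le J : amp J <= ((den J)%:R ^+ J.+1)^-1.
Proof.
have d0 := @denR_gt0 R m m_gt0 J.
rewrite /amp (le_trans (ler_wpM2l _ (step_le q m_gt0 J)))// mulrA.
rewrite ler_pdivrMr ?exprn_gt0// addn2 (exprSr _ J.+1) mulrA mulVf ?mul1r; last first.
  by rewrite gt_eqF ?exprn_gt0.
rewrite -natrM ler_nat (leq_trans _ (den_cube m_gt0 J))//.
by rewrite !expnS expn0; lia.
Qed.

Lemma den_pow_inv (J j : nat) : ((den (J + j))%:R ^+ 2)^-1 <= ((den J)%:R ^+ 2)^-1 /
  2 ^+ j :> R.
Proof.
have h := @den_inv_geom R m m_gt0 J j; have d0 := @denR_gt0 R m m_gt0.
have h2 : (den (J + j))%:R^-1 ^+ 2 <= ((den J)%:R^-1 / 2 ^+ j) ^+ 2 :> R.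
  by rewrite lerXn2r ?nnegrE ?divr_ge0 ?invr_ge0 ?exprn_ge0.
rewrite -[leLHS]exprVn -[X in X / _]exprVn (le_trans h2)//.
rewrite exprMn ler_wpM2l ?sqr_ge0// expr2 ler_piMr ?invr_ge0 ?exprn_ge0//.
by rewrite invf_le1 ?exprn_gt0// exprn_ege1// ler1n.
Qed.

Lemma amp_tail J j : amp (J.+1 + j) <= ((den J.+1)%:R ^+ 2)^-1 / 2 ^+ j.
Proof.
rewrite (le_trans _ (den_pow_inv J.+1 j))// (le_trans (amp_le _))//.
rewrite lef_pV2 ?posrE ?exprn_gt0 ?denR_gt0// -!natrX ler_nat leq_pexp2l ?den_gt0//.
Qed.

(** Gives the convergence of the series and of all its termwise derivatives. *)
Lemma amp_freq_dominated k : dominated (fun J => amp J * (freq J)%:R ^+ k).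
Proof.
have d0 := @denR_gt0 R m m_gt0.
have d1 J : 1 <= (den J)%:R :> R by rewrite ler1n den_gt0.
have f1 J : (freq J)%:R <= (den J)%:R :> R by rewrite ler_nat freq_le.
have d2 J : 2 ^+ J <= (den J)%:R :> R.
  have := den_geom m_gt0 0 J; rewrite add0n -natrX ler_nat.
  by apply: leq_trans; rewrite leq_pmulr ?den_gt0.
(* From [J = k] on the constant 1 would do; this one also covers the finitely many [J < k]. *)
exists ((den k)%:R ^+ k * 2 ^+ k) => J.
have af0 : 0 <= amp J * (freq J)%:R ^+ k by apply: mulr_ge0;
  [exact: amp_ge0|exact: exprn_ge0].
rewrite ger0_norm//.
rewrite ler_pdivlMr ?exprn_gt0//.
have [kJ|Jk] := leqP k J.
  rewrite (@le_trans _ _ 1)//; last by rewrite -[leLHS]mulr1 ler_pM// exprn_ege1// ler1n.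
  have h : amp J * (freq J)%:R ^+ k <= ((den J)%:R ^+ J.+1)^-1 * (den J)%:R ^+ J.
    rewrite ler_pM ?amp_ge0 ?exprn_ge0 ?amp_le//.
    by rewrite (le_trans (lerXn2r k _ _ (f1 J))) ?nnegrE// ler_weXn2l.
  have t0 : 0 <= 2 ^+ J :> R by rewrite exprn_ge0.
  rewrite (le_trans (ler_pM af0 t0 h (d2 J)))//.
  by rewrite -mulrA -exprSr mulVf// gt_eqF ?exprn_gt0.
have a1 : amp J <= 1.
  by rewrite (le_trans (amp_le J))// invf_le1 ?exprn_gt0// exprn_ege1.
have e1 : 2 ^+ J <= 2 ^+ k :> R by rewrite ler_weXn2l ?ler1n// ltnW.
have e2 : (freq J)%:R ^+ k <= (den k)%:R ^+ k :> R.
  rewrite lerXn2r ?nnegrE// (le_trans (f1 J))// ler_nat dvdn_leq ?den_gt0//.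
  by rewrite dvd_den// ltnW.
have e3 : amp J * (freq J)%:R ^+ k <= (den k)%:R ^+ k.
  by rewrite -[leRHS]mul1r; apply: ler_pM; rewrite ?amp_ge0 ?exprn_ge0.
exact: ler_pM.
Qed.

Lemma fiber_term_le i x J : `|fiber_term i x J| <= amp J.
Proof.
rewrite /fiber_term 2!normrM (ger0_norm (amp_ge0 J)) normr_nat mulrAC.
by rewrite ler_piMl ?amp_ge0// mulr_ile1// ?cc_max// lern1 leq_b1.
Qed.

Lemma dominated_le (u v : nat -> R) : (forall j, `|u j| <= `|v j|) -> dominated v ->
  dominated u.
Proof. by move=> uv [K hK]; exists K => j; apply: le_trans (hK j). Qed.

Lemma fiber_term_dominated i x : dominated (fiber_term i x).
Proof.
apply: dominated_le (amp_freq_dominated 0) => J.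
by rewrite expr0 mulr1 (le_trans (fiber_term_le _ _ _))// ler_norm.
Qed.

Lemma fiber_fun_trunc i x J :
  `|fiber_fun x i 0 - \sum_(j < J.+1) fiber_term i x j| <= 2 * ((den J.+1)%:R ^+ 2)^-1.
Proof.
rewrite mxE; apply: tsum_tail => [|j]; first exact/dominated_cvg/fiber_term_dominated.
by rewrite (le_trans (fiber_term_le _ _ _))// amp_tail.
Qed.

Lemma fiber_fun_circle i : circle_map (fun x => fiber_fun x i 0).
Proof.
have [K hK] := amp_freq_dominated 1.
have K0 : 0 <= K by have := hK 0%N; rewrite expr0 divr1; apply: le_trans.
move=> e e0; exists (e / (16 * K + 1)); first by rewrite divr_gt0// ltr_wpDl// mulr_ge0.
move=> x t [n hn]; apply: near_int_norm.
have per y : fiber_fun y i 0 = fiber_fun (y + n%:~R) i 0.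
  rewrite !mxE; congr tsum; apply/funext => J; rewrite /fiber_term mulrDr; congr (_ * _).
  by rewrite -[(freq J)%:R * n%:~R](intrM _ (freq J) n) ccDint.
rewrite -(subrK n%:~R t) addrA -per; set s := t - n%:~R in hn *.
rewrite !mxE -[X in _ + X]mulN1r -tsumZ; last exact: fiber_term_dominated.
have dN : dominated (fun j => -1 * fiber_term i x j).
  by apply: dominated_le (fiber_term_dominated i x) => j; rewrite mulN1r normrN.
rewrite -tsumD//; last exact: fiber_term_dominated.
have D0 : 0 < 16 * K + 1 by rewrite ltr_wpDl// mulr_ge0.
have sK : `|s| * (16 * K + 1) <= e by rewrite -ler_pdivlMr.
rewrite (@le_trans _ _ (2 * (8 * K * `|s|)))//; last by have := normr_ge0 s; nra.
apply: tsum_norm => j; rewrite mulN1r /fiber_term -mulrBr [_ * (x + s)]mulrDr normrM.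
have h1 : `|(j %% q == i)%N%:R * amp j| <= amp j.
  by rewrite normrM (ger0_norm (amp_ge0 j)) normr_nat ler_piMl ?amp_ge0// lern1 leq_b1.
have h2 := cc_lip ((freq j)%:R * x + (freq j)%:R * s) ((freq j)%:R * x).
rewrite (_ : (freq j)%:R * x + (freq j)%:R * s - _ = (freq j)%:R * s) in h2; last by ring.
rewrite normrM normr_nat in h2.
rewrite (le_trans (ler_pM (normr_ge0 _) (normr_ge0 _) h1 h2))//.
have := le_trans (ler_norm _) (hK j); rewrite expr1 => h3.
have -> : amp j * (8 * ((freq j)%:R * `|s|)) = 8 * `|s| * (amp j * (freq j)%:R) by ring.
have -> : 8 * K * `|s| / 2 ^+ j = 8 * `|s| * (K / 2 ^+ j) by ring.
by rewrite ler_wpM2l// mulr_ge0.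
Qed.

End FiberFunction.

(** * Decomposition of the cocycle into waves *)

Section CocycleSums.
Context {R : realType} {q : nat}.
Variables (C : 'cV[int]_q) (B : 'M[int]_q) (alpha : R) (F : R -> 'cV[R]_q).
Implicit Types (k : 'rV[int]_q) (x : R).
Local Notation cocycle := (cocycle C B alpha F).

Lemma cocycleE k l x : cocycle k l x =
  \sum_(r < l) char (k *m B ^+ (l - r.+1)) (fiber_shift C F (x + r%:R * alpha)).
Proof.
elim: l k => [|l ih] k; first by rewrite big_ord0.
rewrite big_ord_recr/= subnn expr0 mulmx1 ih; congr (_ + _).
apply: eq_bigr => r _; rewrite subSn// exprS mulmxA//.
Qed.

Lemma cocycleD k l l' x :
  cocycle k (l + l') x = cocycle (k *m B ^+ l') l x + cocycle k l' (x + l%:R * alpha).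
Proof.
elim: l' k => [|l' ih] k; first by rewrite addn0 expr0 mulmx1 addr0.
rewrite addnS/= ih exprS mulmxA -addrA; congr (_ + (_ + char _ (fiber_shift _ _ _))).
by rewrite natrD; ring.
Qed.

Lemma fixed_expr k (m L : nat) : k *m B ^+ m = k -> k *m B ^+ (m * L) = k.
Proof.
move=> kB; rewrite exprM; elim: L => [|L ih]; first by rewrite expr0 mulmx1.
by rewrite exprSr mulmxA ih.
Qed.

Lemma cocycle_mul k (m L : nat) x : k *m B ^+ m = k ->
  cocycle k (m * L) x = \sum_(i < L) cocycle k m (x + (m * i)%:R * alpha).
Proof.
move=> kB; elim: L => [|L ih]; first by rewrite muln0 big_ord0.
by rewrite big_ord_recr/= mulnS addnC cocycleD kB ih.
Qed.

End CocycleSums.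

Section BlockDecomposition.
Context {R : realType}.
Variables (m q : nat) (C : 'cV[int]_q) (B : 'M[int]_q).
Hypothesis m_gt0 : (0 < m)%N.

Local Notation den := (den m).
Local Notation freq := (freq m q).
Local Notation mode := (mode m q).
Local Notation alpha := (@alpha R m).
Local Notation gap := (@gap R m).
Local Notation step := (@step R m q).
Local Notation amp := (@amp R m q).
Local Notation fiber_fun := (@fiber_fun R m q).
Local Notation fiber_term := (@fiber_term R m q).
Local Notation cocycle := (cocycle C B alpha fiber_fun).
Implicit Types (k : 'rV[int]_q) (x : R).

(* The coefficient of [k] seen by the [J]-th term of [fiber_fun]. *)
Definition weight k J : R := \sum_(i < q) (J %% q == i)%N%:R * (k 0 i)%:~R.

Definition norm1 k : R := \sum_i `|k 0 i|%:~R.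

Lemma norm1_ge0 k : 0 <= norm1 k.
Proof. by apply: sumr_ge0 => i _; rewrite ler0z. Qed.

Lemma weight_le k J : `|weight k J| <= norm1 k.
Proof.
rewrite (le_trans (ler_norm_sum _ _ _))// ler_sum// => i _.
by rewrite normrM normr_nat intr_norm ler_piMl// lern1 leq_b1.
Qed.

Lemma char_fiber_fun k x J :
  `|char k (fiber_fun x) - \sum_(j < J.+1) weight k j * (amp j * cc ((freq j)%:R * x))| <=
  norm1 k * (2 / (den J.+1)%:R ^+ 2).
Proof.
have -> : char k (fiber_fun x) - \sum_(j < J.+1) weight k j * (amp j * cc ((freq
  j)%:R * x)) =
  \sum_i (k 0 i)%:~R * (fiber_fun x i 0 - \sum_(j < J.+1) fiber_term i x j).
  under [RHS]eq_bigr do rewrite mulrBr.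
  rewrite sumrB /char mxE; congr (_ - _); first by apply: eq_bigr => i _; rewrite mxE.
  under [RHS]eq_bigr do rewrite mulr_sumr.
  rewrite exchange_big; apply: eq_bigr => j _; rewrite mulr_suml; apply: eq_bigr => i _.
  by rewrite /fiber_term; ring.
rewrite (le_trans (ler_norm_sum _ _ _))// mulr_suml ler_sum// => i _.
by rewrite normrM intr_norm ler_wpM2l// fiber_fun_trunc.
Qed.

(** [slope] and [drift] are the coefficients of [x] and of [alpha] in the contribution of [C] to the
    phase over [m] steps. *)
Definition slope k : int := \sum_(r < m) (k *m B ^+ (m - r.+1) *m C) 0 0.
Definition drift k : int := \sum_(r < m) (k *m B ^+ (m - r.+1) *m C) 0 0 * r%:Z.
Definition block_norm k : R := \sum_(r < m) norm1 (k *m B ^+ (m - r.+1)).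

Lemma block_norm_ge0 k : 0 <= block_norm k.
Proof. by apply: sumr_ge0 => i _; exact: norm1_ge0. Qed.

Definition block_wave k J x : R := \sum_(r < m)
  weight (k *m B ^+ (m - r.+1)) J * cc ((freq J)%:R * (x + r%:R * alpha)).

Lemma cocycle_block k J x :
  `|cocycle k m x - ((slope k)%:~R * x + (drift k)%:~R * alpha +
      \sum_(j < J.+1) amp j * block_wave k j x)| <=
  block_norm k * (2 / (den J.+1)%:R ^+ 2).
Proof.
have -> : cocycle k m x - ((slope k)%:~R * x + (drift k)%:~R * alpha +
      \sum_(j < J.+1) amp j * block_wave k j x) =
   \sum_(r < m) (char (k *m B ^+ (m - r.+1)) (fiber_fun (x + r%:R * alpha)) -
     \sum_(j < J.+1) weight (k *m B ^+ (m - r.+1)) j * (amp j * cc ((freq j)%:R * (x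
       + r%:R * alpha)))).
  rewrite cocycleE sumrB opprD addrA; congr (_ - _); last first.
    rewrite exchange_big; apply: eq_bigr => j _; rewrite mulr_sumr.
    by apply: eq_bigr => r _; ring.
  apply/eqP; rewrite subr_eq addrC; apply/eqP.
  rewrite /slope /drift !rmorph_sum/= !mulr_suml -!big_split/=; apply: eq_bigr => r _.
  rewrite charDr charZr /char -map_mxM [X in (_ * X)]mxE intrM; ring.
rewrite (le_trans (ler_norm_sum _ _ _))// mulr_suml ler_sum// => r _.
exact: char_fiber_fun.
Qed.

Lemma block_wave_phase k J : exists r t : R,
  [/\ 0 <= r, r <= block_norm k,
    r ^+ 2 = \sum_(i < m) \sum_(j < m)
      weight (k *m B ^+ (m - i.+1)) J * weight (k *m B ^+ (m - j.+1)) J *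
        cc ((i%:R - j%:R) * ((mode J)%:R / m%:R + step J)) &
    forall x, block_wave k J x = r * cc ((freq J)%:R * x + t)].
Proof.
have [r [t [r0 rs r2 hx]]] := @phase_amplitude R m
  (fun r => weight (k *m B ^+ (m - r.+1)) J) (fun r =>
    r%:R * ((mode J)%:R / m%:R + step J)).
exists r, t; split=> //.
- by rewrite (le_trans rs)// ler_sum// => i _; exact: weight_le.
- by rewrite r2; apply: eq_bigr => i _; apply: eq_bigr => j _; rewrite mulrBl.
move=> x; rewrite -hx; apply: eq_bigr => i _; congr (_ * _).
have [n hn] := @freq_alpha R m q m_gt0 J.
rewrite mulrDr mulrCA hn mulrDr addrA.
by rewrite (_ : i%:R * n%:~R = (i%:Z * n)%:~R) ?ccDint// intrM.
Qed.

Lemma step_small J : 0 < m%:R * step J <= 8^-1.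
Proof.
rewrite mulr_gt0 ?ltr0n ?step_gt0//=; have d0 := @denR_gt0 R m m_gt0 J.
have h1 : m%:R * 16 <= (den J)%:R :> R by rewrite -natrM mulnC ler_nat den_ge_m.
have h2 : 16 <= (den J)%:R :> R by rewrite ler_nat den_ge16.
have h3 : step J <= 2 / (den J)%:R ^+ 2.
  rewrite (le_trans (step_le q m_gt0 J))// ler_wpM2l// lef_pV2 ?posrE ?exprn_gt0//.
  by rewrite ler_weXn2l ?leq_addl//; lra.
rewrite (le_trans (ler_wpM2l _ h3))// mulrA ler_pdivrMr ?exprn_gt0//.
move: h1 h2 => h1 h2; rewrite expr2; nra.
Qed.

(** From one block to the next the phase advances by [m * freq J * alpha], that is by
    [y = m * step J] up to an integer, so the sum is geometric and telescopes. The bounds on [a]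
    come from [y <= ss (y / 2) <= 4 * y]; in [amp J = J * step J] the step cancels and the factor
    [J] remains. *)
Lemma wave_sum k J : exists r a t : R, [/\ 0 <= r, r <= block_norm k,
    r ^+ 2 = \sum_(i < m) \sum_(j < m)
      weight (k *m B ^+ (m - i.+1)) J * weight (k *m B ^+ (m - j.+1)) J *
        cc ((i%:R - j%:R) * ((mode J)%:R / m%:R + step J)) &
    [/\ J%:R * r / (8 * m%:R) <= a, a <= J%:R * r &
    forall x (L : nat),
      amp J * \sum_(i < L) block_wave k J (x + (m * i)%:R * alpha) =
      a * (ss ((freq J)%:R * x + t + L%:R * (m%:R * step J)) - ss ((freq J)%:R * x +
        t))]].
Proof.
have [r [t [r0 rs r2 hx]]] := block_wave_phase k J.
have /andP[y0 y1] := step_small J; set y := m%:R * step J in y0 y1 *.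
have mR : 0 < m%:R :> R by rewrite ltr0n.
have s0 : y <= ss (y / 2) by apply: ss_half_ge0; rewrite (ltW y0).
have s1 : ss (y / 2) <= 4 * y.
  have := ss_lip (y / 2) 0; rewrite ss0 !subr0 (ger0_norm (x :=
    y / 2)) ?divr_ge0 ?(ltW y0)//.
  by move=> /(le_trans (ler_norm _)); lra.
have sp : 0 < ss (y / 2) by apply: lt_le_trans s0.
exists r, (amp J * r / (2 * ss (y / 2))), (t - y / 2); split=> //; split.
- rewrite ler_pdivlMr ?mulr_gt0// /amp -/(step J).
  have -> : J%:R * r / (8 * m%:R) * (2 * ss (y / 2)) = J%:R * r * (ss (y / 2) / (4 *
    m%:R)).
    by field; rewrite gt_eqF.
  rewrite [leRHS]mulrAC ler_wpM2l ?mulr_ge0// ler_pdivrMr ?mulr_gt0//.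
  by move: s1; rewrite /y; lra.
- rewrite ler_pdivrMr ?mulr_gt0// /amp -/(step J) [leLHS]mulrAC ler_wpM2l ?mulr_ge0//.
  have m1 : 1 <= m%:R :> R by rewrite ler1n.
  have st0 : 0 < step J by exact: step_gt0.
  by move: s0; rewrite /y; nra.
move=> x L.
have -> : \sum_(i < L) block_wave k J (x + (m * i)%:R * alpha) =
    r * \sum_(h <- iota 0 L) cc ((freq J)%:R * x + t + h%:R * y).
  rewrite -[L in iota _ L]subn0 -/(index_iota 0 L) big_mkord mulr_sumr;
    apply: eq_bigr => i _.
  rewrite hx; congr (_ * _); have [n hn] := @freq_alpha R m q m_gt0 J.
  rewrite mulrDr mulrCA hn.
  rewrite (_ : _ + _ + t = (freq J)%:R * x + t + i%:R * y +
      (i%:Z * ((mode J)%:Z + m%:Z * n))%:~R) ?ccDint//.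
  rewrite intrM intrD intrM natrM /y -!pmulrn; field.
  by rewrite gt_eqF.
have := geometric_cc L ((freq J)%:R * x + t) y; move: (\sum_(h <- _) _) => S hS.
have -> : (freq J)%:R * x + (t - y / 2) + L%:R * y = (freq J)%:R * x + t + L%:R * y -
  y / 2 by ring.
rewrite [(freq J)%:R * x + (t - y / 2)]addrA -hS; field.
by rewrite gt_eqF.
Qed.

End BlockDecomposition.

(** * Waves at multiples of a denominator: nonzero slopes and resonant modes *)

Section Resolution.
Context {R : realType}.
Variables (m q : nat) (C : 'cV[int]_q) (B : 'M[int]_q).
Hypothesis m_gt0 : (0 < m)%N.

Local Notation den := (den m).
Local Notation freq := (freq m q).
Local Notation mode := (mode m q).
Local Notation alpha := (@alpha R m).
Local Notation gap := (@gap R m).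
Local Notation step := (@step R m q).
Local Notation fiber_fun := (@fiber_fun R m q).
Local Notation cocycle := (cocycle C B alpha fiber_fun).
Local Notation weight := (@weight R q).
Local Notation block_norm := (@block_norm R m q B).
Local Notation slope := (slope m C B).
Local Notation drift := (drift m C B).
Implicit Types (k : 'rV[int]_q) (x : R).

(** The squared amplitude of the [J]-th wave of one block. *)
Definition power_sum k J : R := \sum_(i < m) \sum_(j < m)
  weight (k *m B ^+ (m - i.+1)) J * weight (k *m B ^+ (m - j.+1)) J *
    cc ((i%:R - j%:R) * ((mode J)%:R / m%:R + step J)).

Definition affine_part k L : R :=
  \sum_(i < L) ((slope k)%:~R * ((m * i)%:R * alpha) + (drift k)%:~R * alpha).

Lemma cocycle_decomposition k : k *m B ^+ m = k -> exists r a t : nat -> R,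
  (forall J, [/\ 0 <= r J, r J ^+ 2 = power_sum k J,
     J%:R * r J / (8 * m%:R) <= a J & a J <= J%:R * block_norm k]) /\
  forall J0 L x, `|cocycle k (m * L) x - ((slope k)%:~R * L%:R * x + affine_part k L +
      \sum_(J < J0.+1) a J * (ss ((freq J)%:R * x + t J + L%:R * (m%:R * step J)) -
                              ss ((freq J)%:R * x + t J)))| <=
    L%:R * (block_norm k * (2 / (den J0.+1)%:R ^+ 2)).
Proof.
move=> kB.
have /choice[r /choice[a /choice[t rat]]] := @wave_sum R m q B m_gt0 k.
exists r, a, t; split=> [J|J0 L x].
  have [r0 rn r2 [a1 a2 _]] := rat J; split=> //.
  by rewrite (le_trans a2)// ler_wpM2l.
under eq_bigr => J _ do rewrite -(let: And4 _ _ _ (And3 _ _ h) := rat J in h x L).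
rewrite cocycle_mul//.
rewrite (_ : _ + _ + _ = \sum_(i < L) ((slope k)%:~R * (x + (m * i)%:R * alpha) +
   (drift k)%:~R * alpha + \sum_(j < J0.+1) @amp R m q j * @block_wave R m q B k j (x
     + (m * i)%:R * alpha))).
  rewrite -sumrB (le_trans (ler_norm_sum _ _ _))//.
  rewrite (le_trans (ler_sum _ (fun (i : 'I_L) _ => cocycle_block C B m_gt0 k J0 _)))//.
  by rewrite sumr_const card_ord -[leLHS]mulr_natl.
rewrite big_split/=; congr (_ + _).
  rewrite /affine_part; under [RHS]eq_bigr do rewrite mulrDr -addrA.
  rewrite [RHS]big_split/=; congr (_ + _).
  by rewrite sumr_const card_ord -[RHS]mulr_natl mulrA [L%:R * _]mulrC.
by rewrite exchange_big/=; apply: eq_bigr => j _; rewrite mulr_sumr.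
Qed.

(** Since [L] is a multiple of [den J0], the displacement may be computed with [gap J0] instead of
    the much larger [gap J]. *)
Lemma wave_move J J0 L (X : R) : (J <= J0)%N -> (den J0 %| L)%N ->
  `|ss (X + L%:R * (m%:R * step J)) - ss X| <= 8 * ((L * m * freq J)%:R * gap J0).
Proof.
move=> JJ0 dL; have dL' : (den J0 %| L * m * freq J)%N by rewrite -mulnA dvdn_mulr.
have [n hn] := @mul_gap R m m_gt0 _ _ _ dL' JJ0.
rewrite (_ : L%:R * (m%:R * step J) = (L * m * freq J)%:R * gap J); last first.
  by rewrite /step !natrM !mulrA.
rewrite hn addrA ssDint (le_trans (ss_lip _ _))// addrAC subrr add0r ler_wpM2l//.
by rewrite ger0_norm// mulr_ge0// ltW// gap_gt0.
Qed.

Lemma den_gap2 J : (den J)%:R ^+ 2 * gap J <= 2 / (den J)%:R.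
Proof.
have d0 := @denR_gt0 R m m_gt0 J.
have h : gap J <= 2 / (den J)%:R ^+ 3.
  rewrite (le_trans (gap_le_pow m_gt0 J))// ler_wpM2l// lef_pV2 ?posrE ?exprn_gt0//.
  by rewrite ler_weXn2l ?leq_addl// ler1n den_gt0.
rewrite (le_trans (ler_wpM2l (sqr_ge0 _) h))// le_eqVlt; apply/orP; left; apply/eqP.
by field; rewrite gt_eqF.
Qed.

(** At multiples of [den J0] the waves up to [J0] hardly move: about [J0] of them, of amplitude at
    most of order [J0], move by [O (1 / den J0)]. The linear term in [x] remains, with a nonzero
    integer coefficient. *)
Lemma drifting_of_slope k : k *m B ^+ m = k -> slope k != 0 ->
  drifting C B alpha fiber_fun k.
Proof.
move=> kB p0 H e e0; have [r [a [t [hrat hdec]]]] := cocycle_decomposition kB.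
set K := block_norm k in hrat hdec; have K0 : 0 <= K by exact: block_norm_ge0.
have mR : 0 < m%:R :> R by rewrite ltr0n.
(* Every error is a constant over [u = J0 + 1]. The 18 is 16 for the waves up to [J0] plus 2 for the
   later ones; the last term is the displacement of the base. *)
pose c : R := 18 * K * H%:R * m%:R + 2 * m%:R * H%:R.
have [J0 /(_ J0 (leqnn J0)) hJ0] := den_unbounded (c / e).
rewrite ler_pdivrMr// in hJ0.
pose d : R := (den J0)%:R; have d0 : 0 < d by exact: denR_gt0.
pose u : R := J0.+1%:R; have u1 : 1 <= u by rewrite ler1n.
have du : u ^+ 3 <= d by rewrite -natrX ler_nat den_cube.
have cu : c <= e * u.
  by rewrite (le_trans hJ0)// mulrC ler_wpM2l ?(ltW e0)// ler_nat.
have gd : d * gap J0 <= 2 / d by exact: den_gap.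
set g := gap J0 in gd; have g0 : 0 < g by exact: gap_gt0.
have d1 : 1 <= d by rewrite ler1n den_gt0.
have gd2 : d ^+ 2 * g <= 2 / d by exact: den_gap2.
have ud : u <= d by rewrite (le_trans _ du)// -{1}(expr1 u) ler_weXn2l.
have HR h : (h < H)%N -> h%:R <= H%:R :> R by move=> /ltnW hH; rewrite ler_nat.
exists (m * den J0)%N => h /andP[h0 hH]; split.
- by rewrite -mulnA; apply: fixed_expr.
- have [n hn] := @mul_alpha R m m_gt0 (m * den J0 * h) J0 (dvdn_mulr _ (dvdn_mull _
  (dvdnn _))).
  exists n; rewrite hn addrK ger0_norm ?mulr_ge0 ?(ltW (gap_gt0 m_gt0 J0))//.
  rewrite !natrM -/d -/g (_ : _ * d * _ * g = m%:R * h%:R * (d * g)); last by ring.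
  have mh : m%:R * h%:R <= m%:R * H%:R :> R by rewrite ler_wpM2l// HR.
  rewrite (le_trans (ler_pM _ _ mh gd))// ?mulr_ge0 ?(ltW d0) ?(ltW g0)//.
  rewrite mulrA ler_pdivrMr// (le_trans _ (ler_wpM2l (ltW e0) ud))// (le_trans _ cu)//.
  by rewrite /c mulrC mulrA lerDr !mulr_ge0.
exists (slope k * (den J0 * h)%N%:Z), (affine_part k (den J0 * h)); split.
  by rewrite mulf_neq0// -lt0n muln_gt0 den_gt0.
move=> x; apply: near_int_norm.
rewrite -mulnA; set L := (den J0 * h)%N.
have := hdec J0 L x; set S := \sum_(J < J0.+1) _ => h1.
have LR : L%:R <= H%:R * d by rewrite /L natrM mulrC ler_wpM2r ?(ltW d0)// HR.
have hS : `|S| <= 16 * K * H%:R * m%:R / u.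
  rewrite (le_trans (ler_norm_sum _ _ _))//.
  have term (J : 'I_J0.+1) : `|a J * (ss ((freq J)%:R * x + t J + L%:R * (m%:R * step
    J)) -
      ss ((freq J)%:R * x + t J))| <= u * K * (8 * (H%:R * m%:R * (2 / d))).
    have [r0 _ a1 a2] := hrat J.
    have JJ0 : (J <= J0)%N by rewrite -ltnS.
    have a0 : 0 <= a J by rewrite (le_trans _ a1)// divr_ge0// mulr_ge0.
    have au : a J <= u * K by rewrite (le_trans a2)// ler_wpM2r// ler_nat leqW.
    have mv := wave_move ((freq J)%:R * x + t J) JJ0 (dvdn_mulr h (dvdnn (den J0))).
    rewrite normrM (ger0_norm a0) ler_pM// (le_trans mv)// ler_wpM2l//.
    rewrite -/L -/g 2!natrM.
    have fd : (freq J)%:R <= d.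
      by rewrite ler_nat (leq_trans (freq_le _ m_gt0 _))// dvdn_leq ?den_gt0 ?dvd_den.
    rewrite (@le_trans _ _ (H%:R * d * m%:R * d * g))//.
      rewrite ler_wpM2r ?(ltW g0)// ler_pM ?mulr_ge0//.
      by rewrite ler_wpM2r.
    rewrite (_ : _ * g = H%:R * m%:R * (d ^+ 2 * g)); last by ring.
    by rewrite ler_wpM2l// mulr_ge0.
  rewrite (le_trans (ler_sum _ (fun J _ =>
    term J)))// sumr_const card_ord -[leLHS]mulr_natl -/u.
  rewrite [leLHS](_ : _ = 16 * K * H%:R * m%:R * (u ^+ 2 / d)); last first.
    by have := lt0r_neq0 d0; move: (u) (d) => u' d' hd'; field.
  rewrite ler_wpM2l ?mulr_ge0// ler_pdivrMr// ler_pdivlMl; last by lra.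
  by rewrite -exprS.
have hE : L%:R * (K * (2 / (den J0.+1)%:R ^+ 2)) <= 2 * K * H%:R * m%:R / u.
  have D0 : 0 < (den J0.+1)%:R :> R by exact: denR_gt0.
  have dD : d <= (den J0.+1)%:R by rewrite ler_nat dvdn_leq ?den_gt0 ?dvd_den.
  have KD : 0 <= K * (2 / (den J0.+1)%:R ^+ 2) by rewrite mulr_ge0 ?divr_ge0 ?exprn_ge0.
  rewrite (le_trans (ler_wpM2r KD LR))//.
  have -> : H%:R * d * (K * (2 / (den J0.+1)%:R ^+ 2)) = 2 * K * H%:R * (d / (den
    J0.+1)%:R ^+ 2).
    by field; rewrite gt_eqF.
  rewrite -[leRHS]mulrA ler_wpM2l ?mulr_ge0//.
  rewrite ler_pdivlMr; last by lra.
  rewrite mulrAC ler_pdivrMr ?exprn_gt0// (@le_trans _ _ ((den J0.+1)%:R ^+ 2))//.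
    by rewrite expr2 ler_pM ?(ltW d0)//; lra.
  by rewrite ler_peMl ?sqr_ge0// ler1n.
rewrite (_ : _ - _ = (cocycle k (m * L) x - ((slope k)%:~R * L%:R * x + affine_part k
  L + S)) + S); last first.
  by rewrite intrM -pmulrn; ring.
rewrite (le_trans (ler_normD _ _))// (le_trans (lerD (le_trans h1 hE) hS))//.
rewrite -mulrDl ler_pdivrMr; last by lra.
rewrite (le_trans _ cu)// /c -!mulrDl.
have : 0 <= 2 * m%:R * H%:R :> R by rewrite !mulr_ge0.
by rewrite (_ : 18 = 16 + 2); [lra|ring].
Qed.

Lemma sum_cc_roots (n : int) : n != 0 -> `|n| < m%:Z ->
  \sum_(j < m) cc (n%:~R * (j.+1%:R / m%:R)) = 0 :> R.
Proof.
move=> n0 nm; have mR : m%:R != 0 :> R by rewrite pnatr_eq0 -lt0n.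
pose y : R := n%:~R / m%:R.
have : 2 * ss (y / 2) * \sum_(j < m) cc (n%:~R * (j.+1%:R / m%:R)) = 0.
  transitivity (2 * ss (y / 2) * \sum_(h <- iota 0 m) cc (y + h%:R * y)).
    rewrite -[m in iota _ m]subn0 -/(index_iota 0 m) big_mkord; congr (_ * _).
    by apply: eq_bigr => j _; congr cc; rewrite -natr1 /y; field.
  rewrite geometric_cc (_ : y + m%:R * y - y / 2 = y - y / 2 + n%:~R) ?ssDint ?subrr//.
  by rewrite /y; field.
move=> /eqP; rewrite -mulrA mulf_eq0 pnatr_eq0/= mulf_eq0 => /orP[/eqP s0|/eqP//].
have [n' hn'] : exists n' : int, y = n'%:~R.
  apply: cc_eq1; have -> : y = y / 2 + y / 2 by field.
  by have := cc2Dss2 (y / 2); rewrite ccD -!expr2 s0 expr0n/= addr0 subr0.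
have e : n = n' * m.
  apply: (@intr_inj R); rewrite intrM -hn' /y -pmulrn.
  by rewrite divfK.
exfalso; move: n0 nm; rewrite e normrM mulf_eq0 negb_or => /andP[n'0 _].
by rewrite [`|m%:Z|]ger0_norm// ltNge ler_peMl// -gtz0_ge1 normr_gt0.
Qed.

(** With [step] neglected, the squared amplitudes average over the [m] modes to the sum of the
    squares of the [b i], by orthogonality, and this is positive. So some mode has a positive value;
    it recurs for arbitrarily large [J], where [step J] is negligible. *)
Lemma resonant k : k != 0 -> exists2 rho : R, 0 < rho &
  forall J1, exists2 J, (J1 <= J)%N & rho ^+ 2 <= power_sum k J.
Proof.
move=> k0; have [i0 ki0] : exists i, k 0 i != 0.
  apply/existsP; apply: contraR k0; rewrite negb_exists => /forallP h.
  by apply/eqP/rowP => i; rewrite mxE; have := h i; rewrite negbK => /eqP.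
pose b (i : 'I_m) : R := weight (k *m B ^+ (m - i.+1)) i0.
pose S (j0 : nat) : R := \sum_(i < m) \sum_(j < m) b i * b j *
   cc ((i%:R - j%:R) * (j0.+1%:R / m%:R)).
have S_sum : \sum_(j0 < m) S j0 = m%:R * \sum_(i < m) b i ^+ 2.
  rewrite exchange_big mulr_sumr/=; apply: eq_bigr => i _.
  rewrite exchange_big (bigD1 i)//= [X in _ + X]big1 ?addr0 => [|j ji].
    rewrite (eq_bigr (fun=> b i ^+ 2)) => [|j _];
      last by rewrite subrr mul0r cc0 mulr1 -expr2.
    by rewrite sumr_const card_ord -[LHS]mulr_natl.
  rewrite -mulr_sumr; apply/eqP; rewrite mulf_eq0; apply/orP; right; apply/eqP.
  have := @sum_cc_roots (i%:Z - j%:Z); rewrite intrB; apply.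
    by rewrite subr_eq0; apply: contra ji => /eqP[/ord_inj ->].
  by have := ltn_ord i; have := ltn_ord j; lia.
have [j0 Sj0] : exists j0 : 'I_m, 0 < S j0.
  apply/existsP; apply: contraT => /existsPn h.
  have : \sum_(j0 < m) S j0 <= 0 by apply: sumr_le0 => j _; rewrite leNgt.
  rewrite S_sum leNgt => /negP[]; rewrite mulr_gt0 ?ltr0n//.
  (* The index [m.-1] carries the power [B ^+ 0], and its weight is the nonzero entry [k 0 i0]. *)
  have m1 : (m.-1 < m)%N by rewrite prednK.
  rewrite (bigD1 (Ordinal m1))//= ltr_pwDl//; last by apply: sumr_ge0 => i _;
    exact: sqr_ge0.
  rewrite exprn_even_gt0//= /b prednK// subnn expr0 mulmx1 /weight (bigD1 i0)//=
    modn_small//.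
  rewrite eqxx mul1r big1 ?addr0 ?intr_eq0// => i ii0.
  by rewrite eq_sym (negPf (_ : (i : nat) != i0)) ?mul0r.
exists (Num.sqrt (S j0 / 2)); first by rewrite sqrtr_gt0 divr_gt0.
move=> J1; set N := block_norm k.
have [J2 hJ2] := den_unbounded (N ^+ 2 * 32 / S j0).
(* Chosen so that [J %% q = i0] and [mode J = j0.+1], and as large as desired. *)
pose J := (i0 + (j0 + m * (J1 + J2)) * q)%N.
have q0 : (0 < q)%N by exact: leq_ltn_trans (leq0n _) (ltn_ord i0).
have JJ : (J1 + J2 <= J)%N.
  rewrite /J (leq_trans _ (leq_addl _ _))// (leq_trans _ (leq_pmulr _ q0))//.
  by rewrite (leq_trans _ (leq_addl _ _))// leq_pmull.
exists J; first exact: leq_trans (leq_addr _ _) JJ.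
have Jq : J = i0 %[mod q] by rewrite /J addnC modnMDl.
have Jm : mode J = j0.+1.
  rewrite /mode /J divnDMl ?(leq_ltn_trans _ (ltn_ord i0))// divn_small// add0n.
  by rewrite mulnC addnC modnMDl modn_small.
rewrite sqr_sqrtr ?divr_ge0 ?(ltW Sj0)//.
have wb (i : 'I_m) : weight (k *m B ^+ (m - i.+1)) J = b i.
  by rewrite /b /weight; apply: eq_bigr => i' _; rewrite Jq.
have : `|power_sum k J - S j0| <= N ^+ 2 * (8 * (m%:R * step J)).
  rewrite /power_sum /S -sumrB (le_trans (ler_norm_sum _ _ _))//.
  rewrite expr2 {1}/N /block_norm -mulrA mulr_suml ler_sum// => i _.
  rewrite -sumrB (le_trans (ler_norm_sum _ _ _))//.
  rewrite /N [block_norm k * _]mulr_suml mulr_sumr ler_sum// => j _.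
  rewrite !wb -mulrBr normrM Jm normrM mulrA.
  rewrite ler_pM ?mulr_ge0//; first by rewrite ler_pM// weight_le.
  rewrite (le_trans (cc_lip _ _))// ler_wpM2l// mulrDr addrAC subrr add0r normrM.
  rewrite (ger0_norm (ltW (step_gt0 _ _ _)))// ler_wpM2r ?(ltW (step_gt0 _ _ _))//.
  have := ltn_ord i; have := ltn_ord j; rewrite -!(ltr_nat R) ler_norml => hj hi.
  by have := ler0n R i; have := ler0n R j => h1' h2'; apply/andP; split; lra.
have : N ^+ 2 * (8 * (m%:R * step J)) <= S j0 / 2.
  have d0 := @denR_gt0 R m m_gt0 J.
  have ms : m%:R * step J <= 2 / (den J)%:R.
    have h : step J <= 2 / (den J)%:R ^+ 2.
      rewrite (le_trans (step_le q m_gt0 J))// ler_wpM2l// lef_pV2 ?posrE ?exprn_gt0//.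
      by rewrite ler_weXn2l ?leq_addl// ler1n den_gt0.
    rewrite (le_trans (ler_wpM2l _ h))// mulrCA ler_wpM2l// ler_pdivrMr ?exprn_gt0//.
    rewrite expr2 mulKf ?gt_eqF// ler_nat (leq_trans _ (den_ge_m m_gt0 J))// leq_pmull//.
  rewrite (@le_trans _ _ (N ^+ 2 * 16 / (den J)%:R))//.
    rewrite -mulrA ler_wpM2l ?sqr_ge0//; lra.
  rewrite ler_pdivrMr//.
  have := hJ2 J (leq_trans (leq_addl _ _) JJ); rewrite ler_pdivrMr// => h.
  have : J%:R * S j0 <= (den J)%:R * S j0.
    rewrite ler_wpM2r ?(ltW Sj0)// ler_nat (leq_trans _ (den_cube m_gt0 J))//.
    by rewrite (leq_trans (leqnSn J))// -{1}(expn1 J.+1) leq_pexp2l.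
  lra.
rewrite ler_norml => h1 /andP[h2 _]; lra.
Qed.

End Resolution.

Lemma ss_taylor (R : realType) (x t : R) :
  `|ss (x + t) - ss x - t * (pi *+ 2) * ss (x + 4^-1)| <= 64 * t ^+ 2.
Proof.
have := cc_taylor (x - 4^-1) t.
rewrite -ssDquarter -(ssDquarter (x - 4^-1)) subrK.
have -> : x - 4^-1 + t + 4^-1 = x + t by ring.
have -> : ss (x - 4^-1) = - ss (x + 4^-1).
  by have := ccDquarter (x - 4^-1); rewrite subrK ssDquarter => ->; rewrite opprK.
by rewrite mulrN.
Qed.

(** * Frequencies of slope zero *)

Section Flat.
Context {R : realType}.
Variables (m q : nat) (C : 'cV[int]_q) (B : 'M[int]_q).
Hypothesis m_gt0 : (0 < m)%N.

Local Notation den := (den m).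
Local Notation freq := (freq m q).
Local Notation mode := (mode m q).
Local Notation alpha := (@alpha R m).
Local Notation gap := (@gap R m).
Local Notation step := (@step R m q).
Local Notation fiber_fun := (@fiber_fun R m q).
Local Notation cocycle := (cocycle C B alpha fiber_fun).
Local Notation block_norm := (@block_norm R m q B).
Local Notation slope := (slope m C B).
Local Notation drift := (drift m C B).
Local Notation affine_part := (@affine_part R m q C B).
Implicit Types (k : 'rV[int]_q) (x : R).

(** At suitable multiples of [den J0], with [J0] resonant, the waves below [J0] are frozen and those
    above are negligible. The wave [J0] has a large amplitude and a slowly moving phase, so that it
    changes linearly in [h]. *)
Lemma oscillating_of_flat k : k != 0 -> k *m B ^+ m = k -> slope k = 0 ->
  oscillating C B alpha fiber_fun k.
Proof.
move=> k0 kB p0 H e e0; have [r [a [t [hrat hdec]]]] :=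
  @cocycle_decomposition R m q C B m_gt0 k kB.
have [rho rho0 hres] := @resonant R m q B m_gt0 k k0.
set K := block_norm k in hrat hdec; have K0 : 0 <= K by exact: block_norm_ge0.
have mR : 0 < m%:R :> R by rewrite ltr0n.
pose Hr : R := H%:R; have Hr0 : 0 <= Hr by exact: ler0n.
pose dr : R := `|drift k|%:~R; have dr0 : 0 <= dr by rewrite ler0z.
(* In this order: the drift, the waves below [J0], the Taylor remainder of the wave [J0], the later
   waves, and the displacement of the base. Each is divided by [u = J0]. *)
pose c : R := dr * Hr + 8 * K * m%:R * Hr + Hr ^+ 2 * m%:R / rho + 2 * K * Hr + m%:R * Hr.
have [J1 hJ1] := @den_unbounded R (c / e).
have [J2 hJ2] := @den_unbounded R (8 * m%:R / rho).
have [J3 hJ3] := @den_unbounded R (256 * K).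
have [J0 JJ0 hrho] := hres (J1 + J2 + J3).+1.
(* The denominator of the predecessor [J'] bounds the frequencies of the waves below [J0], and
   [den J' ^ 2 <= den J0] makes their motion negligible. *)
case: J0 JJ0 hrho => [//|J'] JJ0 hrho; set J0 := J'.+1 in JJ0 hrho.
have [j1 j2 j3] : [/\ J1 <= J0, J2 <= J0 & J3 <= J0]%N.
  split; rewrite (leq_trans _ (ltnW JJ0))//; first by rewrite -addnA leq_addr.
    by rewrite addnAC leq_addl.
  by rewrite leq_addl.
pose u : R := J0%:R.
have u1 : 1 <= u by rewrite ler1n.
have u0 : 0 < u by apply: lt_le_trans u1.
have cu : c <= e * u by rewrite mulrC -ler_pdivrMr//; exact: hJ1.
have um : 8 * m%:R <= u * rho by rewrite -ler_pdivrMr//; exact: hJ2.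
have uK : 256 * K <= u by exact: hJ3.
pose d' : R := (den J')%:R; pose d : R := (den J0)%:R; pose D1 : R := (den J0.+1)%:R.
have d'0 : 0 < d' by exact: denR_gt0.
have d0 : 0 < d by exact: denR_gt0.
have D10 : 0 < D1 by exact: denR_gt0.
have ud' : u ^+ 3 <= d' by rewrite -natrX ler_nat den_cube.
have d'd : d' ^+ 2 <= d.
  by rewrite /d /d' /= natrX ler_weXn2l ?ler1n ?den_gt0// addn3.
have d'1 : 1 <= d' by rewrite ler1n den_gt0.
have d'd1 : d' <= d by rewrite (le_trans _ d'd)// expr2 ler_peMl// ltW.
have ud'1 : u <= d' by rewrite (le_trans _ ud')// -{1}(expr1 u) ler_weXn2l.
have ud : u <= d by apply: le_trans d'd1.
have dD1 : d <= D1 by rewrite ler_nat dvdn_leq ?den_gt0 ?dvd_den.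
set g := gap J0; have g0 : 0 < g by exact: gap_gt0.
have [r0 r2 a1 a2] := hrat J0; rewrite -/u in a1 a2.
have rrho : rho <= r J0.
  by rewrite -ler_sqr ?nnegrE ?(ltW rho0)// r2.
set A := a J0 in a1 a2.
have Arho : u * rho / (8 * m%:R) <= A.
  rewrite (le_trans _ a1)// ler_wpM2r ?invr_ge0 ?mulr_ge0//.
  by rewrite ler_wpM2l// ltW.
have A1 : 1 <= A by rewrite (le_trans _ Arho)// ler_pdivlMr ?mulr_gt0// mul1r.
have A0 : 0 < A by apply: lt_le_trans A1.
have /andP[tau4 tau8] := @tau_bounds R; set tau := pi *+ 2 in tau4 tau8.
have tau0 : 0 < tau by lra.
set y := m%:R * step J0; have y0 : 0 < y by rewrite mulr_gt0 ?step_gt0.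
have dy : d * y <= 2 / d.
  have h : step J0 <= 2 / d ^+ 3.
    rewrite (le_trans (step_le q m_gt0 J0))// ler_wpM2l// lef_pV2 ?posrE ?exprn_gt0//.
    by rewrite ler_weXn2l ?ler1n ?den_gt0// !addSn addn2.
  have md : m%:R <= d by rewrite ler_nat (leq_trans _ (den_ge_m m_gt0 J0))// leq_pmull.
  rewrite (@le_trans _ _ (d * (d * (2 / d ^+ 3))))//.
    by rewrite ler_wpM2l ?(ltW d0)// /y ler_pM// ltW// step_gt0.
  by rewrite le_eqVlt; apply/orP; left; apply/eqP; field; rewrite gt_eqF.
pose w := A * tau * (d * y).
have w0 : 0 < w := mulr_gt0 (mulr_gt0 A0 tau0) (mulr_gt0 d0 y0).
have w1 : w <= 16^-1.
  rewrite (@le_trans _ _ (u * K * 8 * (2 / d)))//.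
    have At : A * tau <= u * K * 8 := ler_pM (ltW A0) (ltW tau0) a2 tau8.
    exact: ler_pM (ltW (mulr_gt0 A0 tau0)) (ltW (mulr_gt0 d0 y0)) At dy.
  rewrite mulrA ler_pdivrMr// -ler_pdivrMl ?invr_gt0// invrK.
  have : u * u <= d.
    by rewrite (le_trans _ d'd)// expr2; apply: ler_pM => //; exact: ltW.
  have : 256 * K * u <= u * u by rewrite ler_wpM2r// ltW.
  lra.
(* [n] is the first multiplier with [n * w > 1/16]. As [w <= 1/16], rounding up does not exceed
   1/8. *)
set tr := Num.truncn ((16 * w)^-1); pose n := tr.+1.
have tr1 : tr%:R <= (16 * w)^-1 by rewrite truncn_le// invr_ge0 mulr_ge0// ltW.
have tr2 : (16 * w)^-1 < n%:R by exact: truncnS_gt.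
clearbody tr; rewrite invfM in tr1 tr2.
pose xi := n%:R * w.
have xi1 : 16^-1 <= xi by move: tr2; rewrite ltr_pdivrMr// => /ltW.
have xi2 : xi <= 8^-1.
  by rewrite /xi /n -natr1 mulrDl mul1r; move: tr1; rewrite ler_pdivlMr//; lra.
pose sg := n%:R * (d * y).
have sg0 : 0 < sg := mulr_gt0 (ltr0Sn _ _) (mulr_gt0 d0 y0).
have xisg : xi = A * tau * sg by rewrite /xi /sg /w; ring.
have sgA : A * sg <= 32^-1.
  have : A * sg * 4 <= xi by rewrite xisg mulrAC; apply: ler_wpM2r (ltW sg0) _ _ _;
    exact: ler_wpM2l (ltW A0) _ _ tau4.
  lra.
(* The quarter period turns the derivative of [ss] into [ss] again. *)
exists (m * den J0 * n)%N, (freq J0), xi, (t J0 + 4^-1); split.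
- exact: freq_gt0.
- by rewrite xi1.
move=> h hH; pose L := (den J0 * n * h)%N.
have mL : (m * den J0 * n * h = m * L)%N by rewrite /L !mulnA.
have hHr : h%:R <= Hr by rewrite ler_nat ltnW.
have Ly : L%:R * y = h%:R * sg by rewrite /L !natrM -/d /sg; ring.
(* No direct bound on [n] is used: [L] is controlled through [L * y = h * sg <= Hr] and
   [d * g <= y]. *)
have Lg : L%:R * g <= Hr / d.
  have fR : 0 < (freq J0)%:R :> R by rewrite ltr0n freq_gt0.
  have df : d <= m%:R * (freq J0)%:R by rewrite -natrM ler_nat den_le_freq.
  rewrite ler_pdivlMr// (@le_trans _ _ (L%:R * y))//.
    have -> : L%:R * y = L%:R * g * (m%:R * (freq J0)%:R) by rewrite /y /step -/g; ring.
    by apply: ler_wpM2l df; rewrite mulr_ge0// ltW.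
  rewrite Ly -[leRHS]mulr1; apply: ler_pM hHr _ => //; first exact: ltW.
  have : 1 * sg <= A * sg := ler_wpM2r (ltW sg0) A1.
  move: sgA; move: (A * sg) => v; lra.
have Lg0 : 0 <= L%:R * g by rewrite mulr_ge0// ltW.
have dL : (den J0 %| L)%N by rewrite /L -mulnA dvdn_mulr.
have [z hz] := @mul_alpha R m m_gt0 L J0 dL; rewrite -/g in hz.
have bound c' : 0 <= c' -> c' * Hr <= c -> c' * (L%:R * g) <= e.
  move=> c0 hc; rewrite (le_trans (ler_wpM2l c0 Lg))// mulrA ler_pdivrMr//.
  by rewrite (le_trans hc)// (le_trans cu)// ler_wpM2l// ltW.
split.
- by rewrite mL; apply: fixed_expr.
- exists (m%:Z * z); rewrite mL natrM -mulrA hz intrM -pmulrn mulrDr addrK.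
  rewrite ger0_norm; last exact: mulr_ge0 (ler0n _ _) Lg0.
  apply: bound => //.
  by rewrite /c lerDr !addr_ge0 ?mulr_ge0 ?sqr_ge0 ?invr_ge0 ?(ltW rho0) ?exprn_ge0.
move=> x; rewrite mL; set X := (freq J0)%:R * x + t J0.
have := hdec J0 L x; rewrite p0 mul0r mul0r add0r big_ord_recr/= -/A -/X -/y Ly.
set S := \sum_(J < J0) _; set Af := affine_part k L => h1.
have hS : `|S| <= 8 * K * m%:R * Hr / u.
  rewrite (le_trans (ler_norm_sum _ _ _))//.
  have term (J : 'I_J0) : `|a J * (ss ((freq J)%:R * x + t J + L%:R * (m%:R * step J)) -
      ss ((freq J)%:R * x + t J))| <= u * K * (8 * (m%:R * d' * (Hr / d))).
    have [rJ0 _ aJ1 aJ2] := hrat J.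
    have JJ : (J <= J0)%N by exact: ltnW.
    have aJ0 : 0 <= a J by rewrite (le_trans _ aJ1)// divr_ge0// mulr_ge0.
    have au : a J <= u * K by rewrite (le_trans aJ2)// ler_wpM2r// ler_nat.
    have mv := wave_move q m_gt0 ((freq J)%:R * x + t J) JJ dL.
    rewrite normrM (ger0_norm aJ0) ler_pM// (le_trans mv)// ler_wpM2l//.
    rewrite -/g 2!natrM.
    have fd : (freq J)%:R <= d'.
      rewrite ler_nat (leq_trans (freq_le _ m_gt0 _))// dvdn_leq ?den_gt0// dvd_den//.
      by rewrite -ltnS.
    rewrite (_ : L%:R * _ * _ * g = m%:R * (freq J)%:R * (L%:R * g)); last by ring.
    have mf : m%:R * (freq J)%:R <= m%:R * d' := ler_wpM2l (ltW mR) fd.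
    exact: ler_pM (mulr_ge0 (ler0n _ _) (ler0n _ _)) Lg0 mf Lg.
  rewrite (le_trans (ler_sum _ (fun J _ =>
    term J)))// sumr_const card_ord -[leLHS]mulr_natl -/u.
  rewrite [leLHS](_ : _ = 8 * K * m%:R * Hr * (u ^+ 2 * d' / d)); last by field;
    rewrite gt_eqF.
  rewrite ler_wpM2l ?mulr_ge0// ler_pdivrMr// ler_pdivlMl// mulrA -exprS.
  by rewrite (le_trans _ d'd)// expr2 ler_wpM2r// ltW.
have hE : L%:R * (K * (2 / D1 ^+ 2)) <= 2 * K * Hr / u.
  have LD : L%:R <= Hr * D1.
    have gD : D1^-1 <= g by exact: gap_ge.
    rewrite -ler_pdivrMr// (le_trans (ler_wpM2l _ gD))// (le_trans Lg)//.
    by rewrite ler_piMr// invf_le1// (le_trans u1).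
  have KD : 0 <= K * (2 / D1 ^+ 2) by rewrite mulr_ge0 ?divr_ge0 ?exprn_ge0 ?(ltW D10).
  rewrite (le_trans (ler_wpM2r KD LD))//.
  rewrite [leLHS](_ : _ = 2 * K * Hr * D1^-1); last by field; rewrite gt_eqF.
  by rewrite ler_wpM2l ?mulr_ge0// lef_pV2 ?posrE// (le_trans ud).
(* The remainder is of order [h^2 A sg^2]. As [A * sg] is bounded, [sg] is of order at most [1 / A],
   and the remainder vanishes because the amplitude [A] tends to infinity. *)
have hT : `|A * (ss (X + h%:R * sg) - ss X) - h%:R * (xi * ss (X + 4^-1))| <= Hr ^+ 2
  * m%:R / rho / u.
  have -> : A * (ss (X + h%:R * sg) - ss X) - h%:R * (xi * ss (X + 4^-1)) =
     A * (ss (X + h%:R * sg) - ss X - h%:R * sg * (pi *+ 2) * ss (X + 4^-1)).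
    by rewrite xisg -/tau; ring.
  rewrite normrM (gtr0_norm A0) (le_trans (ler_wpM2l (ltW A0) (ss_taylor _ _)))//.
  have s2 : sg * (u * rho) <= m%:R / 4.
    rewrite (@le_trans _ _ (sg * (A * (8 * m%:R))))//.
      by apply: ler_wpM2l (ltW sg0) _ _ _; rewrite -ler_pdivrMr ?mulr_gt0.
    have : m%:R * (A * sg) <= m%:R * 32^-1 := ler_wpM2l (ltW mR) sgA.
    rewrite (_ : sg * (A * (8 * m%:R)) = 8 * (m%:R * (A * sg))); last by ring.
    by move: (m%:R * (A * sg)) => v; lra.
  rewrite ler_pdivlMr// ler_pdivlMr//.
  rewrite [leLHS](_ : _ = 64 * h%:R ^+ 2 * ((A * sg) * (sg * (u * rho)))); last by ring.
  have s3 : (A * sg) * (sg * (u * rho)) <= 32^-1 * (m%:R / 4).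
    apply: ler_pM s2 => //; first exact: mulr_ge0 (ltW A0) (ltW sg0).
    exact: mulr_ge0 (ltW sg0) (mulr_ge0 (ltW u0) (ltW rho0)).
  have s4 : 0 <= 64 * h%:R ^+ 2 :> R by rewrite mulr_ge0// sqr_ge0.
  rewrite (le_trans (ler_wpM2l s4 s3))//.
  have : h%:R ^+ 2 * m%:R <= Hr ^+ 2 * m%:R.
    by apply: ler_wpM2r (ltW mR) _ _ _; rewrite lerXn2r ?nnegrE.
  have : 0 <= h%:R ^+ 2 * m%:R :> R by rewrite mulr_ge0// sqr_ge0.
  rewrite (_ : 64 * _ * _ = h%:R ^+ 2 * m%:R / 2); last by field.
  by move: (h%:R ^+ 2 * m%:R) (Hr ^+ 2 * m%:R) => v1 v2; lra.
have hAf : near_int (dr * Hr / u) Af.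
  exists (drift k * z); rewrite /Af /affine_part p0.
  under eq_bigr do rewrite mul0r add0r.
  rewrite sumr_const card_ord -[X in X - _]mulr_natl mulrCA hz intrM mulrDr addrK.
  rewrite normrM -intr_norm (ger0_norm Lg0) -mulrA ler_wpM2l// (le_trans Lg)//.
  by rewrite ler_wpM2l// lef_pV2 ?posrE.
set T := A * (ss (X + h%:R * sg) - ss X) in h1 hT.
rewrite (_ : _ - _ = (cocycle k (m * L) x - (Af + (S + T))) + (S + Af) +
   (T - h%:R * (xi * ss (X + 4^-1)))); last by rewrite addrA; ring.
apply: (@near_int_le _ (2 * K * Hr / u + (8 * K * m%:R * Hr / u + dr * Hr / u) + Hr
  ^+ 2 * m%:R / rho / u)).
  rewrite -!mulrDl ler_pdivrMr// (le_trans _ cu)// /c.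
  have : 0 <= m%:R * Hr by rewrite mulr_ge0.
  by lra.
apply: near_intD; last exact: near_int_norm.
apply: near_intD; first by apply: near_int_norm; apply: le_trans hE.
by apply: near_intD => //; apply: near_int_norm.
Qed.

End Flat.

(** * Nullity of all characters *)

Section Assembly.
Context {R : realType}.
Variables (m q : nat) (C : 'cV[int]_q) (B : 'M[int]_q).
Hypothesis m_gt0 : (0 < m)%N.

Local Notation alpha := (@alpha R m).
Local Notation fiber_fun := (@fiber_fun R m q).

Lemma null_skew (r : nat) (k0 : int) (k : 'rV[int]_q) :
  (B ^+ m - 1) ^+ r = 0 -> (k0 != 0) || (k != 0) ->
  null (skew C B alpha fiber_fun) (fun z => k0%:~R * z.1 + char k z.2).
Proof.
move=> Br kk; have [k_0|kn0] := eqVneq k 0.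
  move: kk; rewrite k_0 eqxx orbF => k00 c.
  apply: mean_ext (null_base C B fiber_fun (alpha_irrational m_gt0) 0 k00 c) => z.
  by rewrite /char map_mx0 mul0mx mxE.
apply: (null_fiber (alpha_irrational m_gt0) _ m_gt0 (r := r)) => //.
- exact: fiber_fun_circle.
- move=> kap kap0 kapB; have [s0|s0] := eqVneq (slope m C B kap) 0.
    by right; exact: oscillating_of_flat.
  by left; exact: drifting_of_slope.
- by rewrite Br mulmx0.
by apply: circle_mapM; exact: circle_map_id.
Qed.

Definition base_fun (X : 'cV[R]_1) : 'cV[R]_q := fiber_fun (X 0 0).

Definition skew_vec : 'cV[R]_(1 + q) -> 'cV[R]_(1 + q) :=
  skew_map 1%:M (const_mx alpha) C B base_fun.

Definition split_vec (z : 'cV[R]_(1 + q)) : R * 'cV[R]_q := (usubmx z 0 0, dsubmx z).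

Lemma split_skew z : split_vec (skew_vec z) = skew C B alpha fiber_fun (split_vec z).
Proof.
rewrite /split_vec /skew_vec /skew_map col_mxKu col_mxKd /skew/= /affine_map.
rewrite map_mx1 mul1mx !mxE; congr (_, _).
rewrite /fiber_shift addrAC; congr (_ + _ + _).
  by apply/colP => i; rewrite !mxE big_ord1 !mxE mulrC.
by rewrite /base_fun mxE.
Qed.

Lemma char_split (w : 'rV[int]_(1 + q)) z :
  char w z = (lsubmx w 0 0)%:~R * (split_vec z).1 + char (rsubmx w) (split_vec z).2.
Proof.
rewrite /char -{1}(hsubmxK w) -{1}(vsubmxK z) map_row_mx mul_row_col !mxE big_ord1 !mxE.
by congr (_ * _ + _); rewrite /split_vec mxE.
Qed.

Lemma skew_vec_null (r : nat) (w : 'rV[int]_(1 + q)) :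
  (B ^+ m - 1) ^+ r = 0 -> w != 0 -> null skew_vec (char w).
Proof.
move=> Br w0 c.
have kk : (lsubmx w 0 0 != 0) || (rsubmx w != 0).
  apply: contraR w0; rewrite negb_or !negbK => /andP[/eqP w1 /eqP w2].
  rewrite -(hsubmxK w) w2; apply/eqP/rowP => i; rewrite !mxE; case: splitP => j _;
    last by rewrite mxE.
  by rewrite ord1 w1.
apply: mean_ext (mean_factor split_skew (null_skew Br kk c)) => z /=.
by rewrite char_split.
Qed.

Definition rotation : 'cV[R]_1 -> 'cV[R]_1 := affine_map 1%:M (const_mx alpha).

Lemma rotation_null (w : 'rV[int]_1) : w != 0 -> null rotation (char w).
Proof.
move=> w0; apply: (@null_rotation _ _ _ _ ((w 0 0)%:~R * alpha)) => [z|n].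
  exists 0; rewrite addr0 /char /rotation /affine_map map_mx1 mul1mx mulmxDr
    [LHS]mxE; congr (_ + _).
  by rewrite !mxE big_ord1 !mxE.
apply: alpha_irrational => //; apply: contra w0 => /eqP w00.
by apply/eqP/rowP => i; rewrite ord1 w00 mxE.
Qed.

End Assembly.

(** * Self-maps of the torus *)

Section ToralMaps.
Local Open Scope quotient_scope.
Context {R : realType} {n : nat}.
Implicit Types (f g : 'cV[R]_n -> 'cV[R]_n) (phi : torus R n -> torus R n).

Definition equivariant (L : 'M[int]_n) f : Prop := forall x (l : 'cV[int]_n),
  f (x + map_mx intr l) = f x + map_mx intr (L *m l).

Lemma equivariant_lift L f : equivariant L f -> is_lift f (toral_map f).
Proof. by move=> fL; apply: toral_map_lift => x l; exists (L *m l); apply: fL. Qed.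

Lemma torus_projK (t : torus R n) : exists x, t = torus_proj x.
Proof. by exists (repr t); rewrite /torus_proj reprK. Qed.

Lemma lift_unique f phi psi : is_lift f phi -> is_lift f psi -> phi = psi.
Proof.
by move=> h h'; apply/funext => t; have [x ->] := torus_projK t; rewrite h h'.
Qed.

Lemma lift_comp f g phi psi : is_lift f phi -> is_lift g psi ->
  is_lift (f \o g) (phi \o psi).
Proof. by move=> h h' x /=; rewrite h' h. Qed.

Lemma lift_cancel f g phi psi : is_lift f phi -> is_lift g psi -> cancel f g ->
  cancel phi psi.
Proof.
by move=> h h' fg t; have [x ->] := torus_projK t; rewrite h h' fg.
Qed.

Lemma lift_iter f phi l : is_lift f phi -> is_lift (iter l f) (iter l phi).
Proof. by move=> h; elim: l => [|l ih] x //=; rewrite ih h. Qed.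

Lemma torus_proj_continuous : continuous (@torus_proj R n).
Proof. exact: pi_continuous. Qed.

Lemma lift_continuous f phi : is_lift f phi -> continuous f -> continuous phi.
Proof.
move=> h fc; apply/quotient_continuous.
have -> : phi \o \pi_(quotient_topology (torus R n)) = torus_proj \o f by
  apply/funext => x; exact: h.
by move=> x; apply: continuous_comp; [exact: fc|exact: torus_proj_continuous].
Qed.

Lemma toral_minimal f g L L' : equivariant L f -> equivariant L' g ->
  continuous f -> continuous g -> cancel f g -> cancel g f ->
  (forall w, w != 0 -> null f (char w)) -> is_minimal (toral_map f).
Proof.
move=> /equivariant_lift fl /equivariant_lift gl fc gc fg gf fnull; split.
  split; first exact: lift_continuous fl fc.
  exists (toral_map g); split; last exact: lift_continuous gl gc.
  - exact: lift_cancel fl gl fg.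
  - exact: lift_cancel gl fl gf.
move=> t U [u Uu] oU; have [z ->] := torus_projK t; have [z0 uz0] := torus_projK u.
have : nbhs z0 (torus_proj @^-1` U).
  apply: torus_proj_continuous; apply: open_nbhs_nbhs; split => //.
  by rewrite -uz0.
move=> /nbhs_ballP[e /= e0 he].
have [l hl] := null_dense fnull z z0 e0.
have /choice[k hk] := hl.
exists (torus_proj (iter l f z)); split; last first.
  by exists l; left; rewrite (lift_iter l fl).
have -> : torus_proj (iter l f z) = torus_proj (iter l f z - map_mx intr (\col_i k i)).
  by apply/torus_proj_eqP; exists (\col_i k i); rewrite subrK.
apply: he; split=> // i j; rewrite ord1 !mxE -ball_normE/= distrC.
by rewrite addrAC.
Qed.

End ToralMaps.

(** * Smoothness *)

Section RidgeFunctions.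
Context {R : realType}.

Lemma derive_of_quadratic (V W : normedModType R) (f : V -> W) (x v : V) (w : W) (K : R) :
  (forall h : R, `|f (h *: v + x) - f x - h *: w| <= K * h ^+ 2) ->
  derivable f x v /\ 'D_v f x = w.
Proof.
move=> hK; suff : h^-1 *: ((f \o shift x) (h *: v) - f x) @[h --> 0^'] --> w.
  by move=> h; split; [apply/cvg_ex; exists w|exact: cvg_lim h].
apply/cvgrPdist_le => e e0.
have K1 : 0 < `|K| + 1 by rewrite ltr_wpDl.
near=> h.
have h0 : h != 0 by near: h; exact: nbhs_dnbhs_neq.
have he : `|h| <= e / (`|K| + 1).
  near: h; apply: dnbhs0_le; exact: divr_gt0.
rewrite distrC /= -[w](scalerK h0) -scalerBr normrZ normfV.
rewrite ler_pdivrMl ?normr_gt0// (le_trans (hK h))//.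
rewrite -[h ^+ 2]real_normK ?num_real// expr2 mulrCA ler_wpM2l//.
rewrite (le_trans (ler_wpM2r _ (ler_norm K)))// (le_trans (ler_wpM2l _ he))//.
by rewrite mulrCA ler_piMr ?(ltW e0)// ler_pdivrMr// mul1r lerDl.
Unshelve. all: by end_near. Qed.

(** [G k.+1] is the derivative of [G k], stated through a quadratic remainder uniform in [x]; this
    form passes to dominated series term by term. *)
Definition tower (G : nat -> R -> R) : Prop := forall k, exists K : R, forall x t,
  `|G k (x + t) - G k x - t * G k.+1 x| <= K * t ^+ 2.

Lemma tower_succ G : tower G -> tower (fun k => G k.+1).
Proof. by move=> hG k; apply: hG. Qed.

Lemma tower_continuous G k : tower G -> continuous (G k).
Proof.
move=> hG x; have [K hK] := hG k.
have [] := @derive_of_quadratic R^o R^o (G k) x 1 (G k.+1 x) K.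
  by move=> h; rewrite [h *: 1]mulr1 [h + x]addrC; apply: hK.
by move=> /derivable1_diffP/differentiable_continuous.
Qed.

Lemma tower_cst a : tower (fun k _ => if k is 0 then a else 0).
Proof. by move=> k; exists 0 => x t; rewrite subrr mulr0 subr0 normr0 mul0r. Qed.

Lemma tower_id : tower (fun k x => match k with 0 => x | 1 => 1 | _ => 0 end).
Proof.
move=> [|[|k]]; exists 0 => x t; rewrite ?subrr ?mulr0 ?subrr ?normr0 ?mul0r//.
by rewrite mulr1 [x + t]addrC addrK subrr normr0.
Qed.

Lemma tower_shift G a : tower G -> tower (fun k x => G k (x + a)).
Proof. by move=> hG k; have [K hK] := hG k; exists K => x t;
  rewrite [x + t + a]addrAC; apply: hK. Qed.

Context {n p : nat}.
Implicit Types (f : 'cV[R]_n -> 'cV[R]_p).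

Definition linear_form (w : 'rV[R]_n) (z : 'cV[R]_n) : R := (w *m z) 0 0.

Lemma linear_form_continuous w : continuous (linear_form w).
Proof.
have -> : linear_form w = fun z => \sum_j w 0 j * z j 0.
  by apply/funext => z; rewrite /linear_form mxE.
move=> z; apply: (@cvg_big R^o _ +%R 0 xpredT).
- exact: add_continuous.
- exact: (nbhs_filter z).
move=> j _; apply: (@cvgM R _ (nbhs z)); first exact: cvg_cst.
exact: coord_continuous.
Qed.

Lemma Ck_continuous k f : Ck k f -> continuous f.
Proof. by case: k => [|k] []. Qed.

(** A partial derivative of such a function is of the same kind, with the tower shifted and [v]
    scaled by [w 0 i], so the induction closes without chain or product rules. *)
Lemma Ck_ridge (k : nat) (G : nat -> R -> R) w (v : 'cV[R]_p) : tower G ->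
  Ck k (fun z : 'cV[R]_n => G 0%N (linear_form w z) *: v).
Proof.
elim: k G v => [|k ih] G v hG.
  split=> // z; apply: cvgZr_tmp; first exact: (nbhs_filter z).
  apply: (@continuous_comp _ _ _ (linear_form w) (G 0%N) z).
    exact: linear_form_continuous.
  exact: tower_continuous.
split.
  exact: Ck_continuous (ih G v hG).
move=> i; have [K hK] := hG 0%N.
have hd (x : 'cV[R]_n) := @derive_of_quadratic _ _ (fun z : 'cV[R]_n =>
  G 0%N (linear_form w z) *: v) x
  (delta_mx i 0) (G 1%N (linear_form w x) *: (w 0 i *: v)) (K * w 0 i ^+ 2 * `|v|).
have lin (x : 'cV[R]_n) h : linear_form w (h *: delta_mx i 0 + x) = linear_form w x +
  h * w 0 i.
  rewrite /linear_form mulmxDr -scalemxAr mxE [LHS]addrC; congr (_ + _).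
  rewrite mxE; congr (_ * _).
  by rewrite mxE (bigD1 i)//= big1 ?addr0 ?mxE ?eqxx ?mulr1// => j ji;
    rewrite mxE (negPf ji) mulr0.
have {}hd x : derivable (fun z : 'cV[R]_n =>
  G 0%N (linear_form w z) *: v) x (delta_mx i 0) /\
  'D_(delta_mx i 0) (fun z : 'cV[R]_n =>
    G 0%N (linear_form w z) *: v) x = G 1%N (linear_form w x) *: (w 0 i *: v).
  apply: hd => h; rewrite lin !scalerA -!scalerBl normrZ [leRHS]mulrAC ler_wpM2r//.
  rewrite -[leRHS]mulrA -exprMn [w 0 i * h]mulrC.
  by rewrite (_ : h * (_ * _) = h * w 0 i * G 1%N (linear_form w x)) ?hK//; ring.
split; first by move=> x; case: (hd x).
have -> : (fun x => 'D_(delta_mx i 0) (fun z : 'cV[R]_n =>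
  G 0%N (linear_form w z) *: v) x) =
  (fun z => G 1%N (linear_form w z) *: (w 0 i *: v)).
  by apply/funext => x; case: (hd x).
exact: (ih (fun k => G k.+1) _ (tower_succ hG)).
Qed.

Lemma Ck_cst k (a : 'cV[R]_p) : Ck k (fun _ : 'cV[R]_n => a).
Proof.
have := @Ck_ridge k _ 0 a (tower_cst 1).
by under [X in Ck k X]funext do rewrite scale1r.
Qed.

Lemma CkD k f g : Ck k f -> Ck k g -> Ck k (fun z => f z + g z).
Proof.
elim: k f g => [|k ih] f g [fc hf] [gc hg].
  by split=> // z; apply: cvgD; [exact: (nbhs_filter z)|exact: fc|exact: gc].
split=> [z|i]; first by apply: cvgD; [exact: (nbhs_filter z)|exact: fc|exact: gc].
have [df Df] := hf i; have [dg Dg] := hg i.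
split=> [x|]; first exact: derivableD.
have -> : (fun x => 'D_(delta_mx i 0) (fun z => f z + g z) x) =
   (fun x => 'D_(delta_mx i 0) f x + 'D_(delta_mx i 0) g x).
  by apply/funext => x; apply: deriveD.
exact: ih.
Qed.

Lemma Ck_sum k (I : Type) (r : seq I) (f : I -> 'cV[R]_n -> 'cV[R]_p) :
  (forall i, Ck k (f i)) -> Ck k (fun z => \sum_(i <- r) f i z).
Proof.
move=> h; elim: r => [|i r ih].
  by under [X in Ck k X]funext do rewrite big_nil; apply: Ck_cst.
by under [X in Ck k X]funext do rewrite big_cons; apply: CkD.
Qed.

Lemma smooth_linear (M : 'M[R]_(p, n)) : smooth (fun z => M *m z).
Proof.
move=> k; have -> : (fun z => M *m z) = (fun z =>
  \sum_j linear_form (delta_mx 0 j) z *: col j M).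
  apply/funext => z; apply/colP => i; rewrite mxE summxE; apply: eq_bigr => j _.
  rewrite !mxE mulrC; congr (_ * _).
  by rewrite /linear_form mxE (bigD1 j)//= big1 ?addr0 ?mxE ?eqxx ?mul1r// => i' i'j;
    rewrite mxE (negPf i'j) andbF mul0r.
by apply: Ck_sum => j; apply: (Ck_ridge _ _ _ tower_id).
Qed.

Lemma smoothD f g : smooth f -> smooth g -> smooth (fun z => f z + g z).
Proof. by move=> hf hg k; apply: CkD. Qed.

Lemma smooth_cst (a : 'cV[R]_p) : smooth (fun _ : 'cV[R]_n => a).
Proof. by move=> k; apply: Ck_cst. Qed.

Lemma smooth_ridge_sum (q : nat) (G : 'I_q -> nat -> R -> R) w (v : 'I_q -> 'cV[R]_p) :
  (forall i, tower (G i)) -> smooth (fun z => \sum_i G i 0%N (linear_form w z) *: v i).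
Proof. by move=> hG k; apply: Ck_sum => i; apply: Ck_ridge. Qed.

Lemma smooth_continuous f : smooth f -> continuous f.
Proof. by move=> /(_ 0%N)[]. Qed.

End RidgeFunctions.

Section FiberSmoothness.
Context {R : realType}.
Variables (m q : nat).
Hypothesis m_gt0 : (0 < m)%N.

Local Notation freq := (freq m q).
Local Notation amp := (@amp R m q).

(* The [k]-th derivative of the [i]-th coordinate of [fiber_fun]. *)
Definition fiber_tower (i : 'I_q) k (x : R) : R := tsum (fun J =>
  (J %% q == i)%N%:R * (amp J * (freq J)%:R ^+ k) * (pi *+ 2) ^+ k *
  cc ((freq J)%:R * x + k%:R / 4)).

Lemma fiber_tower0 i x : fiber_tower i 0 x = @fiber_fun R m q x i 0.
Proof.
rewrite mxE; congr tsum; apply/funext => J.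
by rewrite /fiber_term !expr0 !mulr1 mul0r addr0.
Qed.

Lemma fiber_tower_dominated i k x : dominated (fun J =>
  (J %% q == i)%N%:R * (amp J * (freq J)%:R ^+ k) * (pi *+ 2) ^+ k *
  cc ((freq J)%:R * x + k%:R / 4)).
Proof.
have [K hK] := @amp_freq_dominated R m q m_gt0 k.
exists (K * (pi *+ 2) ^+ k) => J.
have t0 : 0 <= (pi *+ 2) ^+ k :> R by rewrite exprn_ge0// mulrn_wge0// pi_ge0.
rewrite normrM normrM (ger0_norm t0) -mulrA.
rewrite (@le_trans _ _ (`|amp J * (freq J)%:R ^+ k| * (pi *+ 2) ^+ k))//.
  apply: ler_pM => //; first by rewrite mulr_ge0.
    by rewrite normrM normr_nat ler_piMl// lern1 leq_b1.
  by rewrite ler_piMr// cc_max.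
by rewrite [leRHS]mulrAC ler_wpM2r.
Qed.

(** The Taylor remainder of the [J]-th term is at most a constant times
    [amp J * freq J ^ (k + 2) * t^2], which is dominated in [J]. *)
Lemma fiber_tower_tower i : tower (fiber_tower i).
Proof.
move=> k; have [K hK] := @amp_freq_dominated R m q m_gt0 k.+2.
have t0 : 0 <= (pi *+ 2) ^+ k :> R by rewrite exprn_ge0// mulrn_wge0// pi_ge0.
exists (2 * (64 * K * (pi *+ 2) ^+ k)) => x t.
have domZ a (u : nat -> R) : dominated u -> dominated (fun j => a * u j).
  move=> [K' hK']; exists (`|a| * K') => j.
  by rewrite normrM -mulrA ler_wpM2l.
have domD (u v : nat -> R) : dominated u -> dominated v -> dominated (fun j => u j + v j).
  move=> [K1 h1] [K2 h2]; exists (K1 + K2) => j.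
  by rewrite mulrDl (le_trans (ler_normD _ _))// lerD.
have d0 := fiber_tower_dominated i k (x + t).
have d1 := domZ (-1) _ (fiber_tower_dominated i k x).
have d2 := domZ (- t) _ (fiber_tower_dominated i k.+1 x).
rewrite /fiber_tower -[X in _ + X - _]mulN1r -[X in _ + X]mulNr.
rewrite -(tsumZ (- t) (fiber_tower_dominated i k.+1 x)) -(tsumZ (-1)
  (fiber_tower_dominated i k x)).
rewrite -(tsumD d0 d1) -(tsumD (domD _ _ d0 d1) d2).
rewrite -mulrA; apply: tsum_norm => J.
set b := (J %% q == i)%N%:R; set w := (freq J)%:R; set y := w * x + k%:R / 4.
have -> : w * (x + t) + k%:R / 4 = y + w * t by rewrite /y; ring.
have -> : w * x + k.+1%:R / 4 = y + 4^-1 by rewrite /y -natr1; field.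
have -> : b * (amp J * w ^+ k) * (pi *+ 2) ^+ k * cc (y + w * t) +
   -1 * (b * (amp J * w ^+ k) * (pi *+ 2) ^+ k * cc y) +
   - t * (b * (amp J * w ^+ k.+1) * (pi *+ 2) ^+ k.+1 * cc (y + 4^-1)) =
   b * (amp J * w ^+ k) * (pi *+ 2) ^+ k *
     (cc (y + w * t) - cc y + w * t * (pi *+ 2) * ss y).
  by rewrite ccDquarter !exprS; ring.
rewrite normrM.
have a0 : 0 <= amp J * w ^+ k by apply: mulr_ge0; [exact: amp_ge0|rewrite exprn_ge0].
have h1 : `|b * (amp J * w ^+ k) * (pi *+ 2) ^+ k| <= amp J * w ^+ k * (pi *+ 2) ^+ k.
  rewrite normrM (ger0_norm t0) ler_wpM2r// normrM (ger0_norm a0) normr_nat.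
  by rewrite ler_piMl// lern1 leq_b1.
rewrite (le_trans (ler_pM (normr_ge0 _) (normr_ge0 _) h1 (cc_taylor y (w * t))))//.
have h2 := le_trans (ler_norm _) (hK J).
rewrite [leLHS](_ : _ = 64 * (pi *+ 2) ^+ k * t ^+ 2 * (amp J * w ^+ k.+2));
  last by rewrite !exprS; ring.
rewrite [leRHS](_ : _ = 64 * (pi *+ 2) ^+ k * t ^+ 2 * (K / 2 ^+ J)); last by ring.
by rewrite ler_wpM2l// mulr_ge0 ?sqr_ge0// mulr_ge0.
Qed.

Lemma fiber_tower_periodic i k x (n : int) : fiber_tower i k (x + n%:~R) =
  fiber_tower i k x.
Proof.
congr tsum; apply/funext => J; congr (_ * _).
by rewrite mulrDr -[(freq J)%:R * n%:~R](intrM _ (freq J) n) addrAC ccDint.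
Qed.

End FiberSmoothness.

(** * Integer matrices *)

(** Since [L - 1] is singular, its Smith form [U D V] has a zero row [i], and row [i] of [U^-1]
    kills [L - 1] from the left. As a row of a unimodular matrix it already belongs to a basis; a
    swap puts it first. *)
Lemma first_row_fixed q (L : 'M[int]_(1 + q)) :
  eigenvalue (map_mx intr L : 'M[algC]_(1 + q)) 1 ->
  exists2 P : 'M[int]_(1 + q), P \in unitmx & row 0 P *m L = row 0 P.
Proof.
move=> /eigenvalueP[v vL v0]; rewrite scale1r in vL.
have dN : \det (L - 1%:M) = 0.
  apply: (@intr_inj algC); rewrite -det_map_mx rmorph0; apply/eqP/det0P.
  by exists v => //; rewrite map_mxB map_mx1 mulmxBr mulmx1 vL subrr.
have [U Uu [V Vu [d _ hN]]] := int_Smith_normal_form (L - 1%:M).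
set D := \matrix_(i, j) _ in hN.
have [i di] : exists i : 'I_(1 + q), d`_i = 0.
  have : \det D == 0.
    move: dN; rewrite hN !det_mulmx => /eqP; rewrite !mulf_eq0 orbAC => /orP[|//].
    move: Uu Vu; rewrite !unitmxE => Uu Vu /orP[] /eqP e0.
      by rewrite e0 unitr0 in Uu.
    by rewrite e0 unitr0 in Vu.
  have -> : D = diag_mx (\row_j d`_j).
    by apply/matrixP => i j; rewrite !mxE -val_eqE.
  rewrite det_diag prodf_seq_eq0 => /hasP[i _ /=]; rewrite mxE => /eqP h.
  by exists i.
exists (xrow 0 i (invmx U)).
  by rewrite xrowE unitmx_mul unitmx_perm unitmx_inv.
have -> : row 0 (xrow 0 i (invmx U)) = row i (invmx U).
  by apply/rowP => j; rewrite !mxE tpermL.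
apply/eqP; rewrite -subr_eq0 -{2}[row i (invmx U)]mulmx1 -mulmxBr hN -row_mul.
rewrite !mulmxA mulVmx// mul1mx row_mul.
have -> : row i D = 0.
  by apply/rowP => j; rewrite !mxE di mul0rn.
by rewrite mul0mx.
Qed.

Lemma block_of_fixed_row q (L P : 'M[int]_(1 + q)) : P \in unitmx ->
  row 0 P *m L = row 0 P ->
  exists (C : 'M[int]_(q, 1)) (B : 'M[int]_q), P *m L = block_mx 1%:M 0 C B *m P.
Proof.
move=> Pu hP; pose M := P *m L *m invmx P.
exists (dlsubmx M), (drsubmx M).
have r0 : usubmx M = row_mx 1%:M 0.
  have -> : usubmx M = row 0 M.
    by apply/matrixP => i j; rewrite [LHS]mxE [RHS]mxE ord1; congr (M _ _);
      apply: val_inj.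
  rewrite /M !row_mul hP -row_mul mulmxV//.
  apply/rowP => j; rewrite !mxE; case: splitP => k jk; rewrite !mxE.
    by rewrite -!val_eqE /= jk.
  by rewrite -val_eqE /= jk.
have -> : block_mx 1%:M 0 (dlsubmx M) (drsubmx M) = M.
  rewrite -[RHS]vsubmxK r0 -[dsubmx M]hsubmxK block_mxEv.
  by congr (col_mx _ (row_mx _ _)).
by rewrite /M mulmxKV.
Qed.

(** A left eigenvector [v] of [B] for [z <> 1] extends to the block matrix, its first entry being
    forced to be [(z - 1)^-1 v C]. *)
Lemma quasi_unipotent_block q (L P : 'M[int]_(1 + q)) C B :
  P \in unitmx -> quasi_unipotent L ->
  P *m L = block_mx 1%:M 0 C B *m P -> quasi_unipotent B.
Proof.
move=> Pu Lqu PL z /eigenvalueP[v vB v0].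
have [->|z1] := eqVneq z 1; first by exists 1%N.
apply: Lqu; apply/eigenvalueP.
pose F := @map_mx int algC intr.
pose w := row_mx ((z - 1)^-1 *: (v *m F _ _ C)) v.
have wM : w *m F _ _ (block_mx 1%:M 0 C B) = z *: w.
  rewrite /F map_block_mx map_mx1 map_mx0 mul_row_block mulmx1 mulmx0 add0r vB.
  rewrite /w scale_row_mx scalerA; congr row_mx.
  rewrite -{2}[v *m _]scale1r -scalerDl; congr (_ *: _).
  have z10 : z - 1 != 0 by rewrite subr_eq0.
  by field.
exists (w *m F _ _ P).
  by rewrite -mulmxA -map_mxM PL map_mxM mulmxA wM scalemxAl.
have Pu' : F _ _ P \in unitmx by rewrite /F unitmxE det_map_mx rmorph_unit -?unitmxE.
apply: contra v0 => /eqP wP0.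
have : w = 0 by rewrite -[w](mulmxK Pu') wP0 mul0mx.
by rewrite /w -row_mx0 => /eq_row_mx[_ ->].
Qed.

(** For a common multiple [m] of the orders of the eigenvalues, the characteristic polynomial
    divides a power of [X^m - 1], and Cayley-Hamilton applies. *)
Lemma unipotent_power q (B : 'M[int]_q) : quasi_unipotent B ->
  exists2 m, (0 < m)%N & exists r, (B ^+ m - 1) ^+ r = 0.
Proof.
case: q B => [|q] B hB.
  by exists 1%N => //; exists 1%N; apply/matrixP => -[].
pose A : 'M[algC]_q.+1 := map_mx intr B.
have [rs hrs] := closed_field_poly_normal (char_poly A).
have /monicP lc := char_poly_monic A; rewrite lc scale1r in hrs.
have /choice[k hk] : forall z, exists k : nat, z \in rs -> (0 < k)%N /\ z ^+ k = 1.
  move=> z; have [zrs|] := boolP (z \in rs); last by exists 0%N.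
  have : eigenvalue A z by rewrite eigenvalue_root_char hrs root_prod_XsubC.
  by move=> /hB[k k0 zk]; exists k.
pose m := (\prod_(z <- rs) k z)%N.
have m0 : (0 < m)%N by rewrite /m big_seq prodn_cond_gt0// => z /hk[].
have zm z : z \in rs -> z ^+ m = 1.
  move=> zrs; have : (k z %| m)%N by rewrite /m (big_rem z)//= dvdn_mulr.
  by move=> /dvdnP[j ->]; rewrite mulnC exprM (hk z zrs).2 expr1n.
exists m => //; exists (size rs).
have dv : char_poly A %| ('X^m - 1) ^+ size rs.
  rewrite hrs; elim: (rs) zm => [|z s ih] h; first by rewrite big_nil dvd1p.
  rewrite big_cons exprS dvdp_mul//.
    by rewrite dvdp_XsubCl /root !hornerE h ?subrr// mem_head.
  by apply: ih => y ys; apply: h; rewrite inE ys orbT.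
have : horner_mx A (('X^m - 1) ^+ size rs) = 0.
  by move: dv => /dvdpP[p ->]; rewrite rmorphM/= Cayley_Hamilton mulr0.
rewrite rmorphXn rmorphB rmorphXn rmorph1/= horner_mx_X => hA.
have inj : injective (@map_mx int algC intr q.+1 q.+1).
  by move=> M1 M2 /matrixP h; apply/matrixP => i j; have := h i j;
    rewrite !mxE => /intr_inj.
apply: inj; rewrite map_mx0 -[RHS]hA.
by rewrite rmorphXn rmorphB rmorphXn rmorph1.
Qed.

(** * The diffeomorphism *)

Section Realization.
Context {R : realType}.
Variables (q m : nat) (L P : 'M[int]_(1 + q)) (C : 'M[int]_(q, 1)) (B : 'M[int]_q).
Hypotheses (m_gt0 : (0 < m)%N) (P_unit : P \in unitmx) (L_unit : L \in unitmx).
Hypothesis PL : P *m L = block_mx 1%:M 0 C B *m P.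

Local Notation alpha := (@alpha R m).
Local Notation N2R := (map_mx (intr : int -> R)).
Local Notation tow i := (@fiber_tower R m q i 0).

Definition base_form (z : 'cV[R]_(1 + q)) : R := linear_form (N2R (row 0 P)) z.

Definition base_vec : 'cV[R]_(1 + q) := N2R (invmx P) *m col_mx (const_mx alpha) 0.

Definition fiber_vec i : 'cV[R]_(1 + q) := N2R (invmx P) *m col_mx 0 (delta_mx i 0).

Definition perturbation (s : R) : 'cV[R]_(1 + q) := \sum_i tow i s *: fiber_vec i.

(** Written in the original coordinates rather than as a conjugate by [P], so that the linear part
    [L] and the periodic remainder can be read off. *)
Definition lift_map (z : 'cV[R]_(1 + q)) : 'cV[R]_(1 + q) :=
  N2R L *m z + (base_vec + perturbation (base_form z)).

(** [lift_map] adds [alpha] to the base coordinate, so the perturbation to remove is known from the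
    image and the inverse is explicit. *)
Definition lift_inv (z : 'cV[R]_(1 + q)) : 'cV[R]_(1 + q) :=
  N2R (invmx L) *m (z - (base_vec + perturbation (base_form z - alpha))).

Lemma base_formE z : base_form z = (N2R P *m z) 0 0.
Proof. by rewrite /base_form /linear_form map_row -row_mul mxE. Qed.

Lemma base_formD z z' : base_form (z + z') = base_form z + base_form z'.
Proof. by rewrite !base_formE mulmxDr mxE. Qed.

Lemma N2RK (A : 'M[int]_(1 + q)) : A \in unitmx -> N2R A *m N2R (invmx A) = 1%:M.
Proof. by move=> Au; rewrite -map_mxM mulmxV// map_mx1. Qed.

Lemma N2RVK (A : 'M[int]_(1 + q)) : A \in unitmx -> N2R (invmx A) *m N2R A = 1%:M.
Proof. by move=> Au; rewrite -map_mxM mulVmx// map_mx1. Qed.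

Lemma base_form_mul z : base_form (N2R L *m z) = base_form z.
Proof.
rewrite !base_formE mulmxA -map_mxM PL map_mxM -mulmxA map_block_mx map_mx1 map_mx0.
rewrite -{1}[N2R P *m z]vsubmxK mul_block_col mul1mx mul0mx addr0.
by rewrite mxE; case: splitP => // j j0; rewrite [LHS]mxE; congr ((_ *m _) _ _);
  apply: val_inj; rewrite /= -j0.
Qed.

Lemma base_form_invmul z : base_form (N2R (invmx L) *m z) = base_form z.
Proof. by rewrite -[in RHS](mul1mx z) -(N2RK L_unit) -mulmxA base_form_mul. Qed.

Lemma base_form_base_vec : base_form base_vec = alpha.
Proof.
rewrite base_formE /base_vec mulmxA N2RK// mul1mx mxE; case: splitP => // j _.
by rewrite mxE.
Qed.

Lemma base_form_fiber_vec i : base_form (fiber_vec i) = 0.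
Proof.
rewrite base_formE /fiber_vec mulmxA N2RK// mul1mx mxE; case: splitP => // j _.
by rewrite mxE.
Qed.

Lemma base_form_perturbation s : base_form (perturbation s) = 0.
Proof.
rewrite base_formE /perturbation mulmx_sumr summxE big1// => i _.
by rewrite -scalemxAr mxE -base_formE base_form_fiber_vec mulr0.
Qed.

Lemma base_form_int (l : 'cV[int]_(1 + q)) : base_form (N2R l) = ((P *m l) 0 0)%:~R.
Proof. by rewrite base_formE -map_mxM mxE. Qed.

Lemma perturbation_periodic s (n : int) : perturbation (s + n%:~R) = perturbation s.
Proof. by apply: eq_bigr => i _; rewrite fiber_tower_periodic. Qed.

Lemma base_form_lift z : base_form (lift_map z) = base_form z + alpha.
Proof. by rewrite !base_formD base_form_mul base_form_base_vec base_form_perturbation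
  addr0. Qed.

Lemma lift_mapK : cancel lift_map lift_inv.
Proof.
move=> z; rewrite /lift_inv base_form_lift addrK /lift_map addrK mulmxA N2RVK//.
exact: mul1mx.
Qed.

Lemma base_form_inv z : base_form (lift_inv z) = base_form z - alpha.
Proof.
rewrite base_form_invmul; set S := base_vec + _.
have hS : base_form S = alpha.
  by rewrite base_formD base_form_base_vec base_form_perturbation addr0.
by have := base_formD (z - S) S; rewrite subrK hS => ->; rewrite addrK.
Qed.

Lemma lift_invK : cancel lift_inv lift_map.
Proof.
move=> z; rewrite /lift_map base_form_inv /lift_inv mulmxA N2RK// mul1mx.
exact: subrK.
Qed.

Lemma lift_map_equivariant : equivariant L lift_map.
Proof.
move=> z l; rewrite /lift_map base_formD base_form_int perturbation_periodic.
by rewrite mulmxDr -map_mxM addrAC.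
Qed.

Lemma lift_inv_equivariant : equivariant (invmx L) lift_inv.
Proof.
move=> z l; rewrite /lift_inv base_formD base_form_int [base_form z + _ - _]addrAC
  perturbation_periodic.
by rewrite addrAC mulmxDr -map_mxM.
Qed.

Lemma smooth_perturbation (a : R) (A : 'M[R]_(1 + q)) :
  smooth (fun z => A *m perturbation (base_form z + a)).
Proof.
have -> : (fun z => A *m perturbation (base_form z + a)) =
  (fun z => \sum_i tow i (linear_form (N2R (row 0 P)) z + a) *: (A *m fiber_vec i)).
  apply/funext => z; rewrite /perturbation mulmx_sumr; apply: eq_bigr => i _.
  by rewrite -scalemxAr.
apply: (@smooth_ridge_sum R _ _ q (fun i k x => @fiber_tower R m q i k (x + a))) => i.
apply: tower_shift; exact: fiber_tower_tower.
Qed.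

Lemma smooth_perturbed (a : R) (A M : 'M[R]_(1 + q)) (c : 'cV[R]_(1 + q)) :
  smooth (fun z => M *m z + (c + A *m perturbation (base_form z + a))).
Proof.
apply: smoothD; first exact: smooth_linear.
by apply: smoothD; [exact: smooth_cst|exact: smooth_perturbation].
Qed.

Lemma smooth_lift_map : smooth lift_map.
Proof.
have -> : lift_map = fun z => N2R L *m z + (base_vec + 1%:M *m perturbation
  (base_form z + 0)).
  by apply/funext => z; rewrite addr0 mul1mx.
exact: smooth_perturbed.
Qed.

Lemma smooth_lift_inv : smooth lift_inv.
Proof.
have -> : lift_inv = fun z => N2R (invmx L) *m z +
    (- (N2R (invmx L) *m base_vec) + (- N2R (invmx L)) *m perturbation (base_form z -
      alpha)).
  by apply/funext => z; rewrite mulNmx -opprD -mulmxDr -mulmxBr.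
exact: smooth_perturbed.
Qed.

Lemma lift_map_conj z : N2R P *m lift_map z = skew_vec m C B (N2R P *m z).
Proof.
rewrite /lift_map !mulmxDr mulmxA -map_mxM PL map_mxM map_block_mx map_mx1 map_mx0.
rewrite /base_vec [N2R P *m (_ *m col_mx _ _)]mulmxA N2RK// mul1mx.
have -> : N2R P *m perturbation (base_form z) = col_mx 0 (fiber_fun m q (base_form z)).
  rewrite /perturbation mulmx_sumr.
  have -> : col_mx 0 (fiber_fun m q (base_form z)) =
      \sum_i fiber_fun m q (base_form z) i 0 *: col_mx (0 : 'cV[R]_1) (delta_mx i 0 :
        'cV[R]_q).
    have {1}-> : fiber_fun m q (base_form z) =
        \sum_i fiber_fun m q (base_form z) i 0 *: (delta_mx i 0 : 'cV[R]_q).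
      by rewrite {1}[LHS]matrix_sum_delta; apply: eq_bigr => i _; rewrite big_ord1.
    rewrite (big_morph (col_mx (0 : 'cV[R]_1)) (id1 := 0) (op1 := +%R)).
    - by apply: eq_bigr => i _; rewrite scale_col_mx scaler0.
    - by move=> x y; rewrite add_col_mx addr0.
    by rewrite col_mx0.
  apply: eq_bigr => i _; rewrite -scalemxAr /fiber_vec mulmxA N2RK// mul1mx.
  by rewrite fiber_tower0.
rewrite -mulmxA -{1}[N2R P *m z]vsubmxK mul_block_col mul1mx mul0mx addr0.
rewrite addrA !add_col_mx !addr0 /skew_vec /skew_map /affine_map map_mx1 mul1mx.
congr (col_mx _ (_ + _ + _)).
rewrite /base_fun; congr fiber_fun; rewrite base_formE [RHS]mxE.
by congr ((_ *m _) _ _); apply: val_inj.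
Qed.

Lemma lift_map_null (r : nat) w : (B ^+ m - 1) ^+ r = 0 -> w != 0 ->
  null lift_map (char w).
Proof.
move=> Br w0 c.
have w'0 : w *m invmx P != 0.
  by apply: contra w0 => /eqP h; rewrite -[w](mulmxKV P_unit) h mul0mx.
have h1 := @skew_vec_null R m q C B m_gt0 r _ Br w'0 c.
have h2 := mean_factor lift_map_conj h1.
apply: mean_ext h2 => z /=.
by rewrite char_mulmx mulmxKV.
Qed.

End Realization.

(** * Minimality of the base rotation and regularity of the fiber function *)

Section Conclusion.
Context {R : realType}.
Variables (q m : nat) (C : 'M[int]_(q, 1)) (B : 'M[int]_q).
Hypothesis m_gt0 : (0 < m)%N.
Local Notation alpha := (@alpha R m).

Lemma rotation_minimal : is_minimal (toral_map (affine_map 1%:M (const_mx alpha :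
  'cV[R]_1))).
Proof.
have eqv (a : 'cV[R]_1) : equivariant 1%:M (affine_map 1%:M a).
  by move=> x l; rewrite /affine_map map_mx1 !mul1mx addrAC.
have cont (a : 'cV[R]_1) : continuous (affine_map 1%:M a).
  by apply: smooth_continuous; apply: smoothD; [exact: smooth_linear|exact: smooth_cst].
apply: (toral_minimal (g := affine_map 1%:M (- const_mx alpha)) (eqv _) (eqv _)) => //.
- by move=> x; rewrite /affine_map !map_mx1 !mul1mx addrK.
- by move=> x; rewrite /affine_map !map_mx1 !mul1mx subrK.
by move=> w; apply: rotation_null.
Qed.

Lemma base_fun_smooth : smooth (@base_fun R m q).
Proof.
have -> : @base_fun R m q =
    fun X => \sum_i @fiber_tower R m q i 0 (linear_form 1%:M X) *: (delta_mx i 0 :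
      'cV[R]_q).
  apply/funext => X; rewrite /base_fun [LHS]matrix_sum_delta; apply: eq_bigr => i _.
  by rewrite big_ord1 /linear_form mul1mx fiber_tower0.
by apply: smooth_ridge_sum => i; apply: fiber_tower_tower.
Qed.

Lemma base_fun_periodic : Zn_periodic (@base_fun R m q).
Proof.
move=> X l; apply/colP => i; rewrite /base_fun -!fiber_tower0.
have -> : (X + map_mx intr l) 0 0 = X 0 0 + (l 0 0)%:~R by rewrite !mxE.
exact: fiber_tower_periodic.
Qed.

End Conclusion.

Theorem theorem2 (R : realType) (n : nat) (hn : (1 <= n < 5)%N)
    (L : 'M[int]_n) (hL : L \in unitmx) (hqu : quasi_unipotent L)
    (h1 : eigenvalue (map_mx intr L : 'M[algC]_n) 1) :
  exists phi : torus R n -> torus R n,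
    [/\ skew_product_diffeo phi, is_minimal phi & has_linear_part phi L].
Proof.
case: n hn L hL hqu h1 => [//|q] _ L hL hqu h1.
have [P Pu hP] := @first_row_fixed q L h1.
have [C [B PL]] := @block_of_fixed_row q L P Pu hP.
have [m m0 [r Br]] := unipotent_power (@quasi_unipotent_block q L P C B Pu hqu PL).
pose f := @lift_map R q m L P; pose g := @lift_inv R q m L P.
have f_eqv : equivariant L f by apply: lift_map_equivariant.
have g_eqv : equivariant (invmx L) g by apply: lift_inv_equivariant.
have fg : cancel f g by exact: (lift_mapK m Pu hL PL).
have gf : cancel g f by exact: (lift_invK m Pu hL PL).
have fs : smooth f by exact: smooth_lift_map.
have gs : smooth g by exact: smooth_lift_inv.
have fl := equivariant_lift f_eqv; have gl := equivariant_lift g_eqv.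
have Pl := @toral_affine_map_lift R q.+1 P 0.
have PE z : affine_map P (0 : 'cV[R]_(1 + q)) z = map_mx intr P *m z by rewrite
  /affine_map addr0.
have conj z : map_mx intr P *m f z = skew_vec m C B (map_mx intr P *m z).
  exact: (lift_map_conj m Pu PL).
(* The skew map is the conjugate of [f] by [P], which gives its equivariance, with linear part
   [P L P^-1]. *)
have sl : is_lift (@skew_vec R m q C B) (toral_map (@skew_vec R m q C B)).
  apply: (@equivariant_lift R q.+1 (P *m L *m invmx P)) => x l.
  have Pi y : map_mx intr P *m (map_mx intr (invmx P) *m y) = y :> 'cV[R]_(1 + q).
    by rewrite mulmxA -map_mxM mulmxV// map_mx1 mul1mx.
  rewrite -{1}(Pi x) -{1}(Pi (map_mx intr l)) -mulmxDr -conj -map_mxM f_eqv mulmxDr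
    conj Pi.
  by rewrite -map_mxM !mulmxA.
exists (toral_map f); split.
- split.
    split; first by exists f.
    exists (toral_map g); split; last by exists g.
      exact: lift_cancel fl gl fg.
    exact: lift_cancel gl fl gf.
  exists P, (toral_map (@skew_vec R m q C B)), 1%N, q, (erefl q.+1), 1%:M,
    (const_mx (alpha m)), C, B, (base_fun m q).
  split=> //.
  + apply: lift_unique (lift_comp Pl fl) _.
    have -> : affine_map P 0 \o f = @skew_vec R m q C B \o affine_map P 0.
      by apply/funext => z; rewrite /= !PE conj.
    exact: lift_comp sl Pl.
  split=> //.
  + by split; [exact: unitmx1|exists 1%N; rewrite subrr expr1].
  + exact: rotation_minimal.
  + split; last by exists m => //; exists r.
    (* [B] is invertible because the block matrix is conjugate to [L]. *)
    have : \det (P *m L) \is a GRing.unit by rewrite det_mulmx unitrM -!unitmxE Pu hL.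
    by rewrite PL det_mulmx det_lblock det1 mul1r unitrM -!unitmxE => /andP[].
  + by split; [exact: base_fun_smooth|exact: base_fun_periodic].
- apply: (toral_minimal f_eqv g_eqv (smooth_continuous fs) (smooth_continuous gs) fg gf).
  by move=> w w0; exact: (lift_map_null m0 Pu PL Br w0).
exists (fun z => base_vec m P + perturbation m P (base_form P z)); split => //.
- have -> : (fun z => base_vec m P + perturbation m P (base_form P z)) =
      (fun z => f z - map_mx intr L *m z).
    by apply/funext => z; rewrite /f /lift_map addrAC subrr add0r.
  move=> z; apply: cvgB; first exact: (nbhs_filter z).
    exact: smooth_continuous fs z.
  exact: (smooth_continuous (smooth_linear (map_mx intr L)) (x := z)).
by move=> x l; rewrite base_formD base_form_int perturbation_periodic.
Qed.
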